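(* Let $\mathcal{S}$ be a finite set of lattice polytopes in $\mathbb{R}^n$ which is a positive basis. Then $\mathbb{Z}[\mathcal{S}]$ has unique and local factorization. Furthermore, $\mathbb{Z}[\mathcal{S}]=\mathbb{E}[\mathcal{S}]$ if and only if $\mathcal{S}$ is a full positive basis, and in this case a tropical polynomial $f$ lies in $\mathbb{Z}[\mathcal{S}]=\mathbb{E}[\mathcal{S}]$ if and only if every edge of $\Delta_f$ is, as a vector, parallel to an integer multiple of an edge of some polytope in $\mathcal{S}$.
   Context: Tropical semiring: $a\odot b=a+b$, $a\oplus b=\max(a,b)$. A tropical polynomial is $f(x)=\max_{a\in A}(c_a+a\cdot x)$ with $A\subset\mathbb{Z}^n$ finite; $\mathrm{Newt}(f)=\mathrm{conv}(A)$; $\Delta_f$ is the regular subdivision of $\mathrm{Newt}(f)$ given by projecting the lower faces of $\mathrm{conv}\{(a,-c_a)\}$. Tropical polynomials are regarded as equal if they differ by $a+v\cdot x$ ($a\in\mathbb{R},v\in\mathbb{Z}^n$). $f\odot g$ is the pointwise sum. A unit is an $f$ with $\Delta_f$ trivial. $P\equiv Q$ means $P=v+Q$, $v\in\mathbb{Z}^n$; $Q\le P$ means $Q$ is a Minkowski summand of $P$; signed Minkowski difference $P-Q=\{x:x+Q\subseteq P\}$, and integer combinations $\sum y_SS$ with some $y_S<0$ mean $(\sum_{y_S>0}y_SS)-(\sum_{y_S<0}|y_S|S)$. An $\mathcal{S}$-unit is a unit $f$ with $\mathrm{Newt}(f)\equiv S\in\mathcal{S}$. $\mathbb{N}[\mathcal{S}]$: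 tropical products of $\mathcal{S}$-units. $\mathbb{Z}[\mathcal{S}]$: polynomials $f$ with $f\odot g\in\mathbb{N}[\mathcal{S}]$ for some $g\in\mathbb{N}[\mathcal{S}]$. $\mathbb{E}[\mathcal{S}]$: polynomials $f$ with $f\odot g\in\mathbb{N}[\mathcal{S}]$ for some $g$ a tropical product of units. $\mathbb{N}\mathcal{S}=\{$lattice $F: F\equiv\sum y_SS, y_S\in\mathbb{N}\}$; $\mathbb{Z}\mathcal{S}=\{$lattice $F:\exists G\in\mathbb{N}\mathcal{S}$ with $F+G\in\mathbb{N}\mathcal{S}\}$. $\mathbb{Z}[\mathcal{S}]$ has local factorization if every $f$ all of whose cells of $\Delta_f$ lie in $\mathbb{Z}\mathcal{S}$ belongs to $\mathbb{Z}[\mathcal{S}]$; it has unique factorization in the sense that for each $f\in\mathbb{Z}[\mathcal{S}]$ there is a unique minimal $g\in\mathbb{N}[\mathcal{S}]$ with $f\odot g\in\mathbb{N}[\mathcal{S}]$, minimal meaning every $g'\in\mathbb{N}[\mathcal{S}]$ with $f\odot g'\in\mathbb{N}[\mathcal{S}]$ contains $g$ in its factorization into $\mathcal{S}$-units. Faces: $\mathrm{face}_v(P)$ = maximizers of $v\cdot x$ on $P$; a proper face is a face that is neither $P$ nor a vertex. For a lattice polytope $P$ of dimension $k\ge1$, $H(P)$ has as rows the primitive outer normal vectors of the $(k-1)$-faces of $P$. $Q$ is $H(P)$-representable if $Q\le cP$ for some integer $c>0$; then $b^{H}(Q)$ is the minimal $b$ with $Q=\{x:H(P)x\le b\}$.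 $H=H(\sum_{S\in\mathcal{S}}S)$ is the $H$-matrix of $\mathcal{S}$; $B(\mathcal{S})=\{b^H(S):S\in\mathcal{S}\}$; $\overline{B(\mathcal{S})}=\{b^H(F):F$ a nonempty $H$-representable lattice polytope$\}$. $\mathcal{S}$ is a basis if $B(\mathcal{S})$ is a $\mathbb{Z}$-basis of $\mathbb{Z}B(\mathcal{S})$, and a full basis if $B(\mathcal{S})$ is a $\mathbb{Z}$-basis of $\mathbb{Z}\overline{B(\mathcal{S})}$. $\mathcal{S}$ is hierarchical if every proper face of every $S\in\mathcal{S}$ lies in $\mathbb{N}\mathcal{S}$. An orientation is $\tau:$ rows of $H\to\{\pm1\}$ with $\tau(-v)=-\tau(v)$; $\mathcal{S}$ is positive with orientation $\tau$ if $\mathrm{face}_{-v}(S)$ is not a proper face of $S$ whenever $\tau(v)=+1$, $S\in\mathcal{S}$. A positive basis is a hierarchical basis positive for some orientation; a full positive basis is a positive basis that is a full basis.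
   Formalization: ''Basis'' and ''full basis'' are read modulo lattice translations (vectors b^H compared modulo Ht, t in Z^n); read literally the claim fails, e.g. S={[0,1]} has Z[S]=E[S] but is not a full basis, since b^H of points lies in the lattice. *)

(* Defs.v *)
From mathcomp Require Export all_boot all_order all_algebra finmap.
From mathcomp Require Export boolp classical_sets reals.

Set Implicit Arguments.
Unset Strict Implicit.
Unset Printing Implicit Defensive.
Import Order.TTheory GRing.Theory Num.Theory.
Local Open Scope classical_set_scope.
Local Open Scope ring_scope.

Section Polytopes.
Variables (R : realType) (n : nat).
Implicit Types P Q F : set 'rV[R]_n.

Definition emb (v : 'rV[int]_n) : 'rV[R]_n := map_mx intr v.

Definition dot (u x : 'rV[R]_n) : R := \sum_i u ord0 i * x ord0 i.

Definition conv (s : seq 'rV[R]_n) : set 'rV[R]_n :=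
  [set x | exists l : 'I_(size s) -> R,
     [/\ forall i, 0 <= l i, \sum_i l i = 1 & x = \sum_i l i *: s`_i]].

(* Polytopes are nonempty throughout. *)
Definition polytope P : Prop :=
  exists s : seq 'rV[R]_n, s != [::] /\ P = conv s.

Definition lattice_polytope P : Prop :=
  exists s : seq 'rV[int]_n, s != [::] /\ P = conv [seq emb v | v <- s].

(* The affine dimension: the largest k such that P contains k + 1 affinely
   independent points (and 0 if P is empty). *)
Definition pdim P : nat :=
  \max_(k < n.+1 | `[< exists p : 'I_k.+1 -> 'rV[R]_n,
      (forall i, P (p i)) /\
      row_free (\matrix_(i < k) (p (fintype.lift ord0 i) - p ord0)) >]) k.

Definition face (u : 'rV[R]_n) P : set 'rV[R]_n :=
  [set x | P x /\ forall y, P y -> dot u y <= dot u x].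

Definition is_face F P : Prop := exists u, F = face u P.

Definition proper_face F P : Prop :=
  [/\ is_face F P, F <> P & ~ exists x, F = [set x]].

(* u is the vector of the edge E, determined up to sign. *)
Definition edge_vector (E : set 'rV[R]_n) (u : 'rV[R]_n) : Prop :=
  u != 0 /\ exists x, E = conv [:: x; x + u].

Definition mink P Q : set 'rV[R]_n :=
  [set z | exists x y, [/\ P x, Q y & z = x + y]].

Definition dilate (c : R) P : set 'rV[R]_n := [set c *: x | x in P].

Definition translate_equiv P Q : Prop :=
  exists v, P = [set emb v + x | x in Q].

Definition mink_summand Q P : Prop := exists T, polytope T /\ P = mink Q T.

Definition primitive (v : 'rV[int]_n) : Prop := \big[gcdn/0%N]_i `|v ord0 i|%N = 1%N.

(* The rows of H(P): all primitive v whose face on P has dimension dim P - 1.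
   For dim P = n these are the finitely many facet normals.  For dim P < n, a
   facet has several primitive outer normals and all of them are rows: among
   their inequalities are those which cut out the affine span of P, so that
   Q = {x : H(P) x <= b} can also hold for polytopes Q of dimension < n. *)
Definition Hrows P : set 'rV[int]_n :=
  [set v | primitive v /\ (pdim (face (emb v) P)).+1 = pdim P].

Definition Hsystem P (b : Hrows P -> R) : set 'rV[R]_n :=
  [set x | forall v : Hrows P, dot (emb (val v)) x <= b v].

Definition is_bH P Q (b : Hrows P -> R) : Prop :=
  Q = Hsystem b /\ forall b' : Hrows P -> R, Q = Hsystem b' -> forall v, b v <= b' v.

(* b^H(Q) for H = H(P); the junk value 0 is used only if Q is not of the form
   {x : H(P) x <= b}. *)
Definition bH P Q : Hrows P -> R := xget (fun=> 0) (@is_bH P Q).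

Definition H_representable P Q : Prop :=
  exists c : nat, (0 < c)%N /\ mink_summand Q (dilate c%:R P).

(* A lattice translation Q |-> t + Q changes b^H(Q) by H t.  Polytopes being
   considered up to lattice translation, the vectors b^H are compared modulo
   the vectors H t. *)
Definition eq_mod_translation P (b b' : Hrows P -> R) : Prop :=
  exists t : 'rV[int]_n,
    forall v : Hrows P, b v = b' v + dot (emb (val v)) (emb t).

Definition Zspan P (X : set (Hrows P -> R)) : set (Hrows P -> R) :=
  [set b | exists (k : nat) (x : 'I_k -> Hrows P -> R) (y : 'I_k -> int),
     (forall i, X (x i)) /\
     eq_mod_translation b (fun v => \sum_i (y i)%:~R * x i v)].

End Polytopes.

Arguments bH {R n} P Q.

Section TropicalPolynomials.
Variables (R : realType) (n : nat).

(* The exponent set A is the set of entries of tsupp; tcoef is relevant only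
   on A. *)
Record tpoly : Type := TPoly {
  tsupp : seq 'rV[int]_n;
  tcoef : 'rV[int]_n -> R;
  tsupp_neq0 : tsupp != [::]
}.

Implicit Types f g : tpoly.

Definition tterm f (a : 'rV[int]_n) (x : 'rV[R]_n) : R :=
  tcoef f a + dot (emb R a) x.

(* The default value of the maximum is one of its terms. *)
Definition teval f (x : 'rV[R]_n) : R :=
  \big[Num.max/tterm f (head 0 (tsupp f)) x]_(a <- tsupp f) tterm f a x.

Coercion teval : tpoly >-> Funclass.

Definition Newt f : set 'rV[R]_n := conv [seq emb R a | a <- tsupp f].

Definition tlift f : set 'rV[R]_(n + 1) :=
  conv [seq row_mx (emb R a) (- tcoef f a)%:M | a <- tsupp f].

(* The cells, of all dimensions, of the regular subdivision Delta_f.  A lower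
   face is a face with an outer normal vector w whose last entry is negative. *)
Definition subdivision f : set (set 'rV[R]_n) :=
  [set C | exists w : 'rV[R]_(n + 1),
     w ord0 (rshift n ord0) < 0 /\ C = lsubmx @` face w (tlift f)].

(* Equality of tropical polynomials: equality as functions up to a + v.x with
   v integral. *)
Definition tequiv (f g : 'rV[R]_n -> R) : Prop :=
  exists (a : R) (v : 'rV[int]_n), forall x, f x = g x + (a + dot (emb R v) x).

(* Delta_f is trivial: it consists of Newt(f) and its faces. *)
Definition is_unit f : Prop :=
  subdivision f = [set C | is_face C (Newt f)].

End TropicalPolynomials.

Section Factorization.
Variables (R : realType) (n : nat).
Variable S : {fset set 'rV[R]_n}.
Implicit Types f g : tpoly R n.

Definition msum (y : set 'rV[R]_n -> nat) : set 'rV[R]_n :=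
  \big[@mink R n/[set 0]]_(P <- S) dilate (y P)%:R P.

Definition NS (F : set 'rV[R]_n) : Prop :=
  lattice_polytope F /\ exists y, translate_equiv F (msum y).

Definition ZS (F : set 'rV[R]_n) : Prop :=
  lattice_polytope F /\ exists G, NS G /\ NS (mink F G).

Definition S_unit f : Prop :=
  is_unit f /\ exists2 P, P \in S & translate_equiv (Newt f) P.

(* h is, up to tequiv, a finite (possibly empty) tropical product, i.e. a
   pointwise sum, of polynomials satisfying U. *)
Definition tproduct_of (U : tpoly R n -> Prop) (h : 'rV[R]_n -> R) : Prop :=
  exists (k : nat) (u : 'I_k -> tpoly R n),
    (forall i, U (u i)) /\ tequiv h (fun x => \sum_i u i x).

Definition Npoly (h : 'rV[R]_n -> R) : Prop := tproduct_of S_unit h.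

Definition Zpoly : set (tpoly R n) :=
  [set f | exists g, Npoly g /\ Npoly (f \+ g)].

Definition Epoly : set (tpoly R n) :=
  [set f | exists g, tproduct_of (@is_unit R n) g /\ Npoly (f \+ g)].

(* Every factorization of g' into S-units contains a factorization of g. *)
Definition contains_factorization g' g : Prop :=
  forall (k : nat) (u : 'I_k -> tpoly R n),
    (forall i, S_unit (u i)) -> tequiv g' (fun x => \sum_i u i x) ->
    exists J : {set 'I_k}, tequiv g (fun x => \sum_(i in J) u i x).

Definition minimal_cofactor f g : Prop :=
  [/\ Npoly g, Npoly (f \+ g) &
      forall g', Npoly g' -> Npoly (f \+ g') -> contains_factorization g' g].

Definition unique_factorization : Prop :=
  forall f, Zpoly f ->
    exists g, minimal_cofactor f g /\
      forall g', minimal_cofactor f g' -> tequiv g' g.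

Definition local_factorization : Prop :=
  forall f, (forall C, subdivision f C -> ZS C) -> Zpoly f.

(* H = H(Stotal) is the H-matrix of S. *)
Definition Stotal : set 'rV[R]_n := \big[@mink R n/[set 0]]_(P <- S) P.

Definition BS : set (Hrows Stotal -> R) := [set bH Stotal P | P in [set` S]].

Definition BSbar : set (Hrows Stotal -> R) :=
  [set bH Stotal F | F in
     [set F | lattice_polytope F /\ H_representable Stotal F]].

(* B(S), as the family of the b^H(P) for P in S, is a Z-basis of L. *)
Definition BS_Zbasis_of (L : set (Hrows Stotal -> R)) : Prop :=
  let comb (y : set 'rV[R]_n -> int) : Hrows Stotal -> R :=
    fun v => \sum_(P <- S) (y P)%:~R * bH Stotal P v in
  (forall y, eq_mod_translation (comb y) (fun=> 0) ->
     forall P, P \in S -> y P = 0) /\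
  (forall b, L b <-> exists y, eq_mod_translation b (comb y)).

Definition basis : Prop := BS_Zbasis_of (Zspan BS).

Definition full_basis : Prop := BS_Zbasis_of (Zspan BSbar).

Definition hierarchical : Prop :=
  forall P F, P \in S -> proper_face F P -> NS F.

Definition orientation (tau : Hrows Stotal -> int) : Prop :=
  (forall v, tau v = 1 \/ tau v = -1) /\
  (forall v w, val w = - val v -> tau w = - tau v).

Definition positive_for (tau : Hrows Stotal -> int) : Prop :=
  forall (v : Hrows Stotal) P, tau v = 1 -> P \in S ->
    ~ proper_face (face (- emb R (val v)) P) P.

Definition positive_basis : Prop :=
  [/\ basis, hierarchical & exists tau, orientation tau /\ positive_for tau].

Definition full_positive_basis : Prop := positive_basis /\ full_basis.

Definition parallel (u w : 'rV[R]_n) : Prop :=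
  exists c : R, c != 0 /\ u = c *: w.

(* rel u w relates an edge vector u of Delta_f to an edge vector w of some
   polytope in S. *)
Definition edges_related (rel : 'rV[R]_n -> 'rV[R]_n -> Prop) f : Prop :=
  forall E u, subdivision f E -> edge_vector E u ->
    exists P F w, [/\ P \in S, is_face F P, edge_vector F w & rel u w].

Definition edges_parallel : tpoly R n -> Prop :=
  edges_related (fun u w => exists k : int, k != 0 /\ parallel u (k%:~R *: w)).

Definition edges_integer_multiple : tpoly R n -> Prop :=
  edges_related (fun u w => exists k : int, u = k%:~R *: w).

End Factorization.

(* Main.v *)
(* Near a point x a tropical polynomial f equals f x plus the support function of
   the cell of Delta_f dual to x, so the cells of f, in all dimensions, are its
   germs.  A unit with Newton polytope P is, up to tequiv, supf P (x - z), and z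
   matters only modulo the space of directions on which the width of P vanishes.

   By freeness of S each cell in ZS has unique integer coefficients on S, and by
   the hierarchy a proper face of P in S involves only polytopes of S whose
   direction space of zero width is strictly larger (larger rank rk below).
   Reading off the coefficients at z, in order of increasing rank, shows that the
   functions supf P (x - z) are linearly independent modulo affine functions, which
   is unique factorization.  Conversely, if all cells of f lie in ZS, then the
   coefficient of a polytope P of least rank is a function of x which is constant
   on translates of the space of P and supported on finitely many of them;
   subtracting the corresponding units raises the least rank, until only an
   affine function is left.

   For the statements on E[S] and on edges, a polytope is a summand of a multiple
   of the sum M of S as soon as k supf M - supf F is subadditive for some k.
   Subadditivity is local off a subspace of codimension two, so it is enough to
   check it for edges; and such an F is cut out by facet normals of M, so a full
   basis expands it. *)
Require Import Defs.
From mathcomp Require Import ring lra.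
Set Implicit Arguments.
Unset Strict Implicit.
Unset Printing Implicit Defensive.
Import Order.TTheory GRing.Theory Num.Theory.
Local Open Scope classical_set_scope.
Local Open Scope ring_scope.

(** * Support functions and polytopes *)

(** Germs rather than cells carry the computations, because units have to be subtracted: the
    difference is piecewise linear but no longer convex, so it has no cells, while it still has
    unique homogeneous germs with integer coefficients on [S]. Points of the whole space parametrize
    these germs, so finiteness must come from elsewhere; this is the purpose of [tame]. The vectors
    b^H control support functions at the rows of H only. To return from an equation of right-hand
    sides to one of polytopes, both sides must be cut out by rows of H, which a signed combination
    need not be; negative parts are therefore moved to the other side first. That a summand of a
    multiple of M is cut out by the rows of H is shown without normal fans: a separating integral
    direction is written as a positive combination of two directions with strictly larger faces, one
    of which still separates, until a facet normal or a direction constant on M is reached. *)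

Section Dot.
Variables (R : realType) (n : nat).
Implicit Types (a b : int) (u v x y : 'rV[R]_n) (s t : 'rV[int]_n).

Lemma dotC u x : dot u x = dot x u.
Proof. by apply: eq_bigr => i _; rewrite mulrC. Qed.

Lemma dotDr u x y : dot u (x + y) = dot u x + dot u y.
Proof. by rewrite -big_split; apply: eq_bigr => i _; rewrite mxE mulrDr. Qed.

Lemma dotZr u c x : dot u (c *: x) = c * dot u x.
Proof. by rewrite big_distrr; apply: eq_bigr => i _; rewrite mxE mulrCA. Qed.

Lemma dotNr u x : dot u (- x) = - dot u x.
Proof. by rewrite -scaleN1r dotZr mulN1r. Qed.

Lemma dotBr u x y : dot u (x - y) = dot u x - dot u y.
Proof. by rewrite dotDr dotNr. Qed.

Lemma dot0r u : dot u 0 = 0.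
Proof. by rewrite -[0](scale0r u) dotZr mul0r. Qed.

Lemma dotDl u x y : dot (x + y) u = dot x u + dot y u.
Proof. by rewrite !(dotC _ u) dotDr. Qed.

Lemma dotZl u c x : dot (c *: x) u = c * dot x u.
Proof. by rewrite !(dotC _ u) dotZr. Qed.

Lemma dotNl u x : dot (- x) u = - dot x u.
Proof. by rewrite !(dotC _ u) dotNr. Qed.

Lemma dotBl u x y : dot (x - y) u = dot x u - dot y u.
Proof. by rewrite !(dotC _ u) dotBr. Qed.

Lemma dot0l u : dot 0 u = 0.
Proof. by rewrite dotC dot0r. Qed.

Lemma dot_sumr (I : Type) (r : seq I) (P : pred I) (F : I -> 'rV[R]_n) u :
  dot u (\sum_(i <- r | P i) F i) = \sum_(i <- r | P i) dot u (F i).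
Proof.
by elim/big_rec2: _ => [|i y1 y2 _ <-]; rewrite ?dot0r ?dotDr.
Qed.

Lemma dot_ge0 u : 0 <= dot u u.
Proof. by apply: sumr_ge0 => i _; rewrite -expr2 sqr_ge0. Qed.

Lemma dot_eq0 u : dot u u = 0 -> u = 0.
Proof.
move=> /eqP; rewrite psumr_eq0 => [/allP h|i _]; last by rewrite -expr2 sqr_ge0.
apply/rowP => i; rewrite mxE; apply/eqP.
by have := h i (mem_index_enum _); rewrite -expr2 sqrf_eq0.
Qed.

Lemma dot_inj x y : (forall u, dot u x = dot u y) -> x = y.
Proof.
move=> h; apply/eqP; rewrite -subr_eq0; apply/eqP/dot_eq0.
by rewrite dotBr h subrr.
Qed.

Lemma dot_gt0 u : u != 0 -> 0 < dot u u.
Proof.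
move=> u0; rewrite lt_neqAle dot_ge0 andbT eq_sym.
by apply: contra_neq u0 => /dot_eq0.
Qed.

Lemma embD s t : emb R (s + t) = emb R s + emb R t.
Proof. by rewrite /emb map_mxD. Qed.

Lemma emb0 : emb R (0 : 'rV_n) = 0.
Proof. by rewrite /emb map_mx0. Qed.

Lemma embN s : emb R (- s) = - emb R s.
Proof. by rewrite /emb map_mxN. Qed.

Lemma embB s t : emb R (s - t) = emb R s - emb R t.
Proof. by rewrite embD embN. Qed.

Lemma embMz a s : emb R (a *: s) = a%:~R *: emb R s.
Proof. by apply/rowP => i; rewrite !mxE intrM. Qed.

Lemma emb_sum (I : Type) (r : seq I) (P : pred I) (F : I -> 'rV[int]_n) :
  emb R (\sum_(i <- r | P i) F i) = \sum_(i <- r | P i) emb R (F i).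
Proof.
by elim/big_rec2: _ => [|i y1 y2 _ <-]; rewrite ?emb0 ?embD.
Qed.

Lemma emb_inj : injective (@emb R n).
Proof.
move=> s t /rowP h; apply/rowP => i.
by have := h i; rewrite !mxE => /eqP; rewrite eqr_int => /eqP.
Qed.

End Dot.

(** * Maxima of finitely many affine functions and their germs *)

Section MaxAffine.
Variables (R : realType) (n : nat).
Implicit Types (u v x y : 'rV[R]_n) (l : seq (R * 'rV[R]_n)) (s t : seq 'rV[R]_n).

Definition aterm (p : R * 'rV[R]_n) x : R := p.1 + dot p.2 x.

Definition maff l x : R := \big[Num.max/aterm (head (0, 0) l) x]_(p <- l) aterm p x.

Lemma bigmax_ge (I : eqType) (r : seq I) (F : I -> R) z i : i \in r ->
  F i <= \big[Num.max/z]_(j <- r) F j.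
Proof.
elim: r => // j r IH; rewrite inE big_cons le_max => /predU1P[->|/IH ->].
  by rewrite lexx.
by rewrite orbT.
Qed.

Lemma bigmax_in (I : eqType) (r : seq I) (F : I -> R) i : i \in r ->
  exists2 j, j \in r & \big[Num.max/F i]_(k <- r) F k = F j.
Proof.
move=> ir; suff: \big[Num.max/F i]_(k <- r) F k = F i \/
    exists2 j, j \in r & \big[Num.max/F i]_(k <- r) F k = F j.
  by case=> // h; exists i.
elim: {ir}r => [|k r IH]; first by left; rewrite big_nil.
rewrite big_cons; case: leP => _; last by right; exists k; rewrite ?mem_head.
case: IH => [->|[j jr ->]]; first by left.
by right; exists j; rewrite // inE jr orbT.
Qed.

Lemma maff_ge l x p : p \in l -> aterm p x <= maff l x.
Proof. exact: (bigmax_ge (fun p => aterm p x)). Qed.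

Lemma maff_in l x : l != [::] -> exists2 p, p \in l & maff l x = aterm p x.
Proof.
case: l => // p l _.
exact: (@bigmax_in _ _ (fun p => aterm p x) p (mem_head _ _)).
Qed.

Lemma maff_le l x M : l != [::] -> (forall p, p \in l -> aterm p x <= M) ->
  maff l x <= M.
Proof. by move=> /(maff_in x)[p pl ->]; apply. Qed.

(** For a tropical polynomial these are the exponents whose hull is the cell dual to [x]. *)
Definition active l x := [seq p.2 | p <- l & aterm p x == maff l x].

Lemma active_neq0 l x : l != [::] -> active l x != [::].
Proof.
move=> /(maff_in x)[p pl e]; rewrite -size_eq0 size_map size_eq0 -has_filter.
by apply/hasP; exists p; rewrite ?e.
Qed.

Definition lin0 s : seq (R * 'rV[R]_n) := [seq (0, a) | a <- s].

(** The support function of the convex hull of [s] ([supf_conv]). As an instance of [maff] it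
    inherits the existence and the form of germs. *)
Definition hs s := maff (lin0 s).

Lemma hs_ge s u a : a \in s -> dot u a <= hs s u.
Proof.
move=> h; rewrite -(add0r (dot _ _)) dotC.
by apply: (@maff_ge _ _ (0, a)); apply: map_f.
Qed.

Lemma hs_in s u : s != [::] -> exists2 a, a \in s & hs s u = dot u a.
Proof.
move=> s0; have [|p /mapP[a ai ->] e] := @maff_in (lin0 s) u; first by case: (s) s0.
by exists a; rewrite // /hs e /aterm /= add0r dotC.
Qed.

Lemma hs_le s u M : s != [::] -> (forall a, a \in s -> dot u a <= M) -> hs s u <= M.
Proof. by move=> /(hs_in u)[p pl ->]; apply. Qed.

Lemma hs_sub s t u : s != [::] -> {subset s <= t} -> hs s u <= hs t u.
Proof. by move=> s0 st; apply: hs_le => // a /st; apply: hs_ge. Qed.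

Definition argmax s u := [seq a <- s | dot u a == hs s u].

Lemma active_lin0 s u : active (lin0 s) u = argmax s u.
Proof.
rewrite /active filter_map -map_comp -[RHS]map_id; congr map.
by apply: eq_filter => a /=; rewrite /aterm /= add0r dotC.
Qed.

Lemma mem_argmax s u a : (a \in argmax s u) = (a \in s) && (dot u a == hs s u).
Proof. by rewrite mem_filter andbC. Qed.

Lemma argmax_neq0 s u : s != [::] -> argmax s u != [::].
Proof. by move=> s0; rewrite -active_lin0 active_neq0 //; case: s s0. Qed.

Definition box (r : R) v := forall i, `|v ord0 i| <= r.

Lemma box_dot a : exists2 c : R, 0 < c & forall r v, 0 <= r -> box r v ->
  forall e, c * r <= e -> `|dot a v| <= e.
Proof.
exists (1 + \sum_i `|a ord0 i|).
  by rewrite ltr_pwDl // sumr_ge0.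
move=> r v r0 bv e; apply: le_trans.
rewrite mulrDl mul1r -[leLHS]add0r lerD // big_distrl /=.
apply: le_trans (ler_norm_sum _ _ _) _; apply: ler_sum => i _.
by rewrite normrM ler_wpM2l.
Qed.

Lemma box_le r r' v : r <= r' -> box r v -> box r' v.
Proof. by move=> rr bv i; apply: le_trans rr. Qed.

Lemma boxD r r' v w : box r v -> box r' w -> box (r + r') (v + w).
Proof.
by move=> h k i; rewrite mxE; apply: le_trans (ler_normD _ _) _; apply: lerD.
Qed.

Lemma boxZ r v c : box r v -> box (`|c| * r) (c *: v).
Proof. by move=> h i; rewrite mxE normrM ler_wpM2l. Qed.

Lemma box_ex v : exists2 r, 0 < r & box r v.
Proof.
exists (1 + \sum_i `|v ord0 i|); first by rewrite ltr_pwDl // sumr_ge0.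
move=> i; rewrite (bigD1 i) //= addrCA -{1}[leLHS]addr0 lerD //.
by rewrite addr_ge0 // sumr_ge0.
Qed.

(** A common radius for finitely many conditions, each stable under shrinking. *)
Lemma minr_seq (I : eqType) (r : seq I) (Q : R -> I -> Prop) :
  (forall i e e', Q e i -> 0 < e' <= e -> Q e' i) ->
  (forall i, i \in r -> exists2 e, 0 < e & Q e i) ->
  exists2 e, 0 < e & forall i, i \in r -> Q e i.
Proof.
move=> mono; elim: r => [|i r IH] h; first by exists 1.
have [|e e0 he] := IH; first by move=> j jr; apply: h; rewrite inE jr orbT.
have [e' e'0 he'] := h i (mem_head _ _).
exists (Num.min e e'); first by rewrite lt_min e0 e'0.
move=> j; rewrite inE => /predU1P[->|/he]; [move: he'|]; move=> /mono; apply;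
by rewrite lt_min e0 e'0 ge_min lexx ?orbT.
Qed.

(** Homogeneity of [phi] is kept apart as [homog]. Together they make the germ unique ([germ_uniq]),
    which is how expansions of equal functions are compared. *)
Definition germ (F : 'rV[R]_n -> R) x (phi : 'rV[R]_n -> R) :=
  exists2 r, 0 < r & forall v, box r v -> F (x + v) = F x + phi v.

(** Terms inactive at [x] lie below the maximum by a positive gap, so on a small box they stay below
    every active term. The radius has to serve all pairs of an inactive and an active term, hence
    the nested minima. *)
Lemma germ_maff l x : l != [::] -> germ (maff l) x (hs (active l x)).
Proof.
move=> l0.
have [||r r0 hr] := @minr_seq _ l (fun r p => forall q v, q \in l -> box r v ->
    aterm q x = maff l x -> aterm p x != maff l x ->
    dot p.2 v - dot q.2 v <= maff l x - aterm p x).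
- move=> p e e' h /andP[_ ee'] q v ql /(box_le ee'); exact: h.
- move=> p pl.
  have [|pa] := eqVneq (aterm p x) (maff l x); first by exists 1.
  have gap : 0 < maff l x - aterm p x by rewrite subr_gt0 lt_neqAle pa maff_ge.
  have [||r r0 hr] := @minr_seq _ l (fun r q => forall v, box r v ->
    dot p.2 v - dot q.2 v <= maff l x - aterm p x).
  - by move=> q e e' h /andP[_ ee'] v /(box_le ee'); exact: h.
  - move=> q ql; have [c c0 hc] := box_dot (p.2 - q.2).
    exists ((maff l x - aterm p x) / c); first by rewrite divr_gt0.
    move=> v bv; rewrite -dotBl; apply: le_trans (ler_norm _) _.
    apply: (hc _ _ _ bv); first by rewrite divr_ge0 ?ltW.
    by rewrite mulrC divfK ?gt_eqF.
  by exists r => // q v ql bv _ _; apply: hr.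
exists r => // v bv; have A0 := active_neq0 x l0.
apply/eqP; rewrite eq_le; apply/andP; split; last first.
  have [a /mapP[p]] := hs_in v A0; rewrite mem_filter => /andP[/eqP pa pl] -> ->.
  by rewrite -pa dotC -addrA -dotDr; apply: maff_ge.
apply: maff_le => // p pl; rewrite /aterm dotDr addrA -/(aterm p x).
have [pa|pa] := eqVneq (aterm p x) (maff l x).
  rewrite pa lerD2l dotC; apply: hs_ge; apply/mapP; exists p => //.
  by rewrite mem_filter pa eqxx.
have [q ql qa] := maff_in x l0.
have := hr p pl q v ql bv (esym qa) pa; rewrite lerBlDr => h.
have : dot q.2 v <= hs (active l x) v.
  by rewrite dotC; apply: hs_ge; apply/mapP; exists q; rewrite // mem_filter qa eqxx.
lra.
Qed.

Lemma hsZ s u c : s != [::] -> 0 <= c -> hs s (c *: u) = c * hs s u.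
Proof.
move=> s0 c0; apply/eqP; rewrite eq_le; apply/andP; split.
  by apply: hs_le => // a ai; rewrite dotZl ler_wpM2l // hs_ge.
by have [a ai ->] := hs_in u s0; rewrite -dotZl hs_ge.
Qed.

Lemma hsD s u v : s != [::] -> hs s (u + v) <= hs s u + hs s v.
Proof. by move=> s0; apply: hs_le => // a ai; rewrite dotDl lerD ?hs_ge. Qed.

Definition homog (phi : 'rV[R]_n -> R) := forall c u, 0 <= c -> phi (c *: u) = c * phi u.

Lemma homog_hs s : s != [::] -> homog (hs s).
Proof. by move=> s0 c u c0; rewrite hsZ. Qed.

Lemma germ_hs s u : s != [::] -> germ (hs s) u (hs (argmax s u)).
Proof. by move=> s0; rewrite -active_lin0; apply: germ_maff; case: s s0. Qed.

End MaxAffine.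

(** * Farkas' lemma *)

Section Farkas.
Variables (R : realType) (n : nat).
Implicit Types (u v x y a b : 'rV[R]_n) (s t : seq 'rV[R]_n).

(** Induction on the number of generators. If a functional [u] separating [b] from the tail is
    positive on the head [a], everything is projected along [a] to the kernel of [u], where one
    generator fewer remains. *)
Lemma farkas s b :
  (exists l : nat -> R, (forall i, 0 <= l i) /\ b = \sum_(i < size s) l i *: s`_i) \/
  (exists2 u, forall a, a \in s -> dot u a <= 0 & 0 < dot u b).
Proof.
have [k] := ubnP (size s); elim: k => // k IH in s b *.
case: s => [|a s] sk.
  have [->|b0] := eqVneq b 0; [left|right; exists b => //; exact: dot_gt0].
  by exists (fun=> 0); rewrite big_ord0.
have [[l [l0 eb]]|[u us ub]] := IH s b sk.
  left; exists (fun i => if i is j.+1 then l j else 0); split=> [[]//|].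
  by rewrite /= big_ord_recl scale0r add0r.
have [ua|ua] := leP (dot u a) 0.
  by right; exists u => // c; rewrite inE => /predU1P[->|/us].
pose pr c := c - (dot u c / dot u a) *: a.
have [] := IH [seq pr c | c <- s] (pr b); first by rewrite size_map.
  case=> l [l0 eb]; left.
  (* The coefficient of [a] forced by undoing the projection; it is nonnegative because [u] is
     positive on [a] and [b] and nonpositive on [s]. *)
  pose m := dot u b / dot u a - \sum_(i < size s) l i * (dot u s`_i / dot u a).
  exists (fun i => if i is j.+1 then l j else m); split.
    case=> [|j]; last exact: l0.
    have s_le0 : \sum_(i < size s) l i * (dot u s`_i / dot u a) <= 0.
      rewrite -oppr_ge0 -sumrN; apply: sumr_ge0 => i _.
      by rewrite -mulrN -mulNr mulr_ge0 // divr_ge0 ?(ltW ua) // oppr_ge0 us ?mem_nth.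
    by rewrite subr_ge0 (le_trans s_le0) // divr_ge0 // ltW.
  rewrite /= big_ord_recl /=; move: eb; rewrite size_map /pr => /eqP.
  rewrite subr_eq => /eqP ->; rewrite scalerBl addrC -!addrA; congr (_ + _).
  rewrite scaler_suml addrC -sumrB; apply: eq_bigr => i _ /=.
  by rewrite (nth_map 0) // /pr scalerBr scalerA.
(* The multiple of [u] is chosen to make the functional vanish on [a]; on any other vector it takes
   the value of [v] on the projection. *)
case=> v vs vb; right; exists (v - (dot v a / dot u a) *: u).
  move=> c; rewrite inE dotBl dotZl => /predU1P[->|cs].
    by rewrite divfK ?gt_eqF // subrr.
  have := vs _ (map_f pr cs); rewrite /pr dotBr dotZr.
  by rewrite mulrAC [dot u c * _]mulrC mulrAC.
by move: vb; rewrite /pr dotBl dotBr !dotZl dotZr mulrAC [dot u b * _]mulrC mulrAC.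
Qed.

End Farkas.

Lemma dot_row_mx (R : realType) (n : nat) (w : 'rV[R]_(n + 1)) (x : 'rV[R]_n) c :
  dot w (row_mx x c%:M) = dot (lsubmx w) x + w ord0 (rshift n ord0) * c.
Proof.
rewrite /dot big_split_ord big_ord1; congr (_ + _).
  by apply: eq_bigr => i _; rewrite row_mxEl mxE.
by rewrite row_mxEr !mxE.
Qed.

(** Coefficients indexed by [nat] survive rewriting the size of the list. *)
Lemma conv_idx (R : realType) (n : nat) (s : seq 'rV[R]_n) x :
  conv s x <-> exists l : nat -> R,
  [/\ forall i, 0 <= l i, \sum_(i < size s) l i = 1 & x = \sum_(i < size s) l i *: s`_i].
Proof.
split=> [[l [l0 l1 ->]]|[l [l0 l1 ->]]]; last by exists (fun i => l i).
exists (fun i => oapp l 0 (insub i)); split.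
- by move=> i; case: insub => //=.
- by rewrite -l1; apply: eq_bigr => i _; rewrite valK.
- by apply: eq_bigr => i _; rewrite valK.
Qed.

Lemma conv_map (R : realType) (n m : nat) (f : 'rV[R]_n -> 'rV[R]_m) s :
  (forall k (l : 'I_k -> R) p, \sum_i l i = 1 ->
     f (\sum_i l i *: p i) = \sum_i l i *: f (p i)) ->
  [set f x | x in conv s] = conv [seq f a | a <- s].
Proof.
move=> fP; apply/seteqP; split=> [_ [x /conv_idx[l [l0 l1 ->]] <-]|x].
  apply/conv_idx; exists l; rewrite size_map; split=> //.
  by rewrite fP //; apply: eq_bigr => i _; rewrite (nth_map 0).
move=> /conv_idx[l]; rewrite size_map => -[l0 l1 ->].
exists (\sum_(i < size s) l i *: s`_i); first by apply/conv_idx; exists l.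
by rewrite fP //; apply: eq_bigr => i _; rewrite (nth_map 0).
Qed.

(** * Polytopes, faces and widths through support functions *)

Section Conv.
Variables (R : realType) (n : nat).
Implicit Types (u v x y a b : 'rV[R]_n) (s t : seq 'rV[R]_n) (P Q : set 'rV[R]_n).

(** Farkas' lemma for [s] placed at height one: the last coordinate turns a conical combination into
    a convex one, and a separating functional into an affine inequality violated by [x]. *)
Lemma convP s x : s != [::] -> conv s x <-> forall u, dot u x <= hs s u.
Proof.
move=> s0; split=> [[l [l0 l1 ->]] u|h].
  rewrite dot_sumr -[leRHS]mul1r -l1 big_distrl; apply: ler_sum => i _ /=.
  by rewrite dotZr ler_wpM2l // hs_ge // mem_nth.
pose up a := row_mx a (1%:M : 'M[R]_1).
have [[l [l0]]|[w ws]] := farkas [seq up a | a <- s] (up x).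
  rewrite size_map => e; apply/conv_idx; exists l; split=> //.
    have /rowP/(_ (rshift n ord0)) := e.
    rewrite row_mxEr mxE eqxx summxE mulr1n => /esym <-; apply: eq_bigr => i _.
    by rewrite mxE (nth_map 0) // row_mxEr mxE eqxx mulr1.
  have := congr1 lsubmx e; rewrite row_mxKl => ->; rewrite linear_sum.
  by apply: eq_bigr => i _; rewrite linearZ (nth_map 0) //= row_mxKl.
rewrite dot_row_mx mulr1 => hw; exfalso.
have : hs s (lsubmx w) <= - w ord0 (rshift n ord0).
  apply: hs_le => // a ai.
  by have := ws _ (map_f up ai); rewrite dot_row_mx mulr1; lra.
by have := h (lsubmx w); lra.
Qed.

Lemma conv_mem s a : a \in s -> conv s a.
Proof.
by move=> ai; apply/convP=> [|u]; [case: s ai | exact: hs_ge].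
Qed.

Lemma conv_neq0 s x : conv s x -> s != [::].
Proof.
case: s => // -[l [_]]; rewrite big_ord0 => /esym/eqP.
by rewrite oner_eq0.
Qed.

Lemma conv_comb s k (l : 'I_k -> R) (p : 'I_k -> 'rV[R]_n) :
  (forall i, 0 <= l i) -> \sum_i l i = 1 -> (forall i, conv s (p i)) ->
  conv s (\sum_i l i *: p i).
Proof.
move=> l0 l1 ps.
have s0 : s != [::].
  case: k l p l0 l1 ps => [l p _|k l p _ _ /(_ ord0)/conv_neq0 //].
  by rewrite big_ord0 => /esym/eqP; rewrite oner_eq0.
apply/convP => // u; rewrite dot_sumr -[leRHS]mul1r -l1 big_distrl.
by apply: ler_sum => i _; rewrite dotZr ler_wpM2l //; move: u; apply/convP.
Qed.

Definition supf P u : R := sup [set dot u x | x in P].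

Lemma supf_conv s : s != [::] -> supf (conv s) = hs s.
Proof.
move=> s0; apply: funext => u; apply/eqP; rewrite eq_le; apply/andP; split.
  apply: ge_sup.
    by have [a ai _] := hs_in u s0; exists (dot u a), a => //; apply: conv_mem.
  by move=> _ [x xs <-]; move: u; apply/convP.
have [a ai ->] := hs_in u s0; apply: ub_le_sup.
  by exists (hs s u) => _ [x xs <-]; move: u {a ai}; apply/convP.
by exists a => //; apply: conv_mem.
Qed.

Lemma conv_eq s t : s != [::] -> t != [::] -> hs s =1 hs t -> conv s = conv t.
Proof.
move=> s0 t0 e; apply/seteqP; split=> x /convP h; apply/convP => // u;
by [rewrite -e h | rewrite e h].
Qed.

Lemma polytope_supf P Q : polytope P -> polytope Q -> supf P =1 supf Q -> P = Q.
Proof. by move=> [s [s0 ->]] [t [t0 ->]]; rewrite !supf_conv //; apply: conv_eq. Qed.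

Lemma in_polytope P x : polytope P -> P x <-> forall u, dot u x <= supf P u.
Proof. by move=> [s [s0 ->]]; rewrite supf_conv //; apply: convP. Qed.

Lemma supf_ge P u x : polytope P -> P x -> dot u x <= supf P u.
Proof. by move=> Pp /(in_polytope _ Pp). Qed.

Lemma supf_in P u : polytope P -> exists2 x, P x & supf P u = dot u x.
Proof.
move=> [s [s0 ->]]; rewrite supf_conv //.
by have [a ai ->] := hs_in u s0; exists a => //; apply: conv_mem.
Qed.

Lemma supf_le P u M : polytope P -> (forall x, P x -> dot u x <= M) -> supf P u <= M.
Proof. by move=> Pp h; have [x /h + ->] := supf_in u Pp. Qed.

Lemma faceE u P : polytope P -> face u P = [set x | P x /\ dot u x = supf P u].
Proof.
move=> Pp; apply/seteqP; split=> x [Px h]; split=> //.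
  by apply/eqP; rewrite eq_le supf_ge //=; have [y /h + ->] := supf_in u Pp.
by move=> y Py; rewrite h supf_ge.
Qed.

Lemma germ_small (F phi : 'rV[R]_n -> R) x v : germ F x phi -> homog phi ->
  exists2 e0, 0 < e0 & forall e, 0 <= e <= e0 -> F (x + e *: v) = F x + e * phi v.
Proof.
move=> [r r0 hr] hom; have [c c0 bc] := box_ex v.
exists (r / c) => [|e /andP[e0 er]]; first exact: divr_gt0.
rewrite hr ?hom //; apply: box_le (boxZ e bc).
by rewrite ger0_norm // -ler_pdivlMr.
Qed.

Lemma germ_uniq (F phi psi : 'rV[R]_n -> R) x :
  germ F x phi -> germ F x psi -> homog phi -> homog psi -> phi =1 psi.
Proof.
move=> g1 g2 h1 h2 v.
have [e1 e10 E1] := germ_small v g1 h1; have [e2 e20 E2] := germ_small v g2 h2.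
pose e := Num.min e1 e2; have e_gt0 : 0 < e by rewrite lt_min e10.
have := E1 e; have := E2 e; rewrite ltW //= !ge_min !lexx orbT /=.
move=> /(_ isT) -> /(_ isT) /addrI /(mulfI _) -> //.
by rewrite gt_eqF.
Qed.

(** For the first inclusion [u] is perturbed to [u + d *: w]: to first order in [d] only the
    maximizers of [u] count, so a point of the face satisfies the inequality of their hull in
    direction [w]. *)
Lemma face_conv s u : s != [::] -> face u (conv s) = conv (argmax s u).
Proof.
move=> s0; have m0 := argmax_neq0 u s0; rewrite faceE; last by exists s.
rewrite supf_conv //; apply/seteqP; split=> x.
  move=> [/(convP _ s0) h e]; apply/convP => // w.
  have [d d0 hd] := germ_small w (germ_hs u s0) (homog_hs m0).
  have dd : 0 <= d <= d by rewrite lexx ltW.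
  have := h (u + d *: w); rewrite hd // dotDl dotZl e lerD2l.
  by rewrite ler_pM2l.
move=> /(convP _ m0) h; split.
  apply/convP => // w; apply: le_trans (h w) _; apply: hs_sub => // a.
  by rewrite mem_argmax => /andP[].
apply/eqP; rewrite eq_le; apply/andP; split.
  by apply: le_trans (h u) _; apply: hs_sub => // a; rewrite mem_argmax => /andP[].
have := h (- u); rewrite dotNl lerNl; apply: le_trans; rewrite lerNr.
by apply: hs_le => // a; rewrite mem_argmax dotNl => /andP[_ /eqP ->].
Qed.

Lemma dilate_conv c s : dilate c (conv s) = conv [seq c *: a | a <- s].
Proof.
rewrite -(conv_map (f := fun x => c *: x : 'rV_n)) // => k l p _.
by rewrite scaler_sumr; apply: eq_bigr => i _; rewrite !scalerA mulrC.
Qed.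

Lemma translate_conv v s :
  [set v + x | x in conv s] = conv [seq v + a | a <- s].
Proof.
rewrite -(conv_map (f := fun x => v + x : 'rV_n)) // => k l p l1.
rewrite -{1}[v]scale1r -l1 scaler_suml -big_split; apply: eq_bigr => i _ /=.
by rewrite -scalerDr.
Qed.

Lemma mink_conv s t : mink (conv s) (conv t) = conv [seq a + b | a <- s, b <- t].
Proof.
apply/seteqP; split=> z.
  move=> [x [y [xs yt ->]]].
  have s0 := conv_neq0 xs; have t0 := conv_neq0 yt.
  apply/convP => [|u]; first by case: (s) s0; case: (t) t0.
  have [a ai ha] := hs_in u s0; have [b bi hb] := hs_in u t0.
  rewrite dotDr (le_trans (y := dot u (a + b))) //; last first.
    by rewrite hs_ge //; apply/allpairsP; exists (a, b).
  by rewrite dotDr -ha -hb lerD //; [move: u {a ai b bi ha hb}|move: u {a ai b bi ha hb}];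
     apply/convP.
move=> /conv_idx[l [l0 l1 ->]].
set w := [seq _ | a <- s, b <- t] in l0 l1 *.
have /choice[p hp] : forall i : 'I_(size w), exists p : 'rV[R]_n * 'rV[R]_n,
    [/\ p.1 \in s, p.2 \in t & w`_i = p.1 + p.2].
  move=> i; have /allpairsP[p [ps pt e]] : w`_i \in w by rewrite mem_nth.
  by exists p.
exists (\sum_(i < size w) l i *: (p i).1), (\sum_(i < size w) l i *: (p i).2); split.
- by apply: conv_comb => // i; apply: conv_mem; case: (hp i).
- by apply: conv_comb => // i; apply: conv_mem; case: (hp i).
- rewrite -big_split; apply: eq_bigr => i _ /=; rewrite -scalerDr.
  by congr (_ *: _); case: (hp i).
Qed.

Lemma polytope_conv s : s != [::] -> polytope (conv s).
Proof. by exists s. Qed.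

Lemma polytope_mink P Q : polytope P -> polytope Q -> polytope (mink P Q).
Proof.
move=> [s [s0 ->]] [t [t0 ->]]; rewrite mink_conv; apply: polytope_conv.
by case: (s) s0; case: (t) t0.
Qed.

Lemma polytope_dilate c P : polytope P -> polytope (dilate c P).
Proof.
by move=> [s [s0 ->]]; rewrite dilate_conv; apply: polytope_conv; case: (s) s0.
Qed.

Lemma polytope_translate v P : polytope P -> polytope [set v + x | x in P].
Proof.
by move=> [s [s0 ->]]; rewrite translate_conv; apply: polytope_conv; case: (s) s0.
Qed.

Lemma polytope_face u P : polytope P -> polytope (face u P).
Proof.
by move=> [s [s0 ->]]; rewrite face_conv //; apply/polytope_conv/argmax_neq0.
Qed.

Lemma set1_conv x : [set x] = conv [:: x].
Proof.
apply/seteqP; split=> y; first by move=> ->; apply: conv_mem; rewrite mem_head.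
by move=> [l []]; rewrite !big_ord1 => _ -> ->; rewrite scale1r.
Qed.

Lemma polytope_set1 x : polytope [set x].
Proof. by rewrite set1_conv; apply: polytope_conv. Qed.

Lemma supf_set1 x u : supf [set x] u = dot u x.
Proof.
apply/eqP; rewrite eq_le; apply/andP; split.
  by apply: supf_le => [|y ->]; first exact: polytope_set1.
by apply: supf_ge; first exact: polytope_set1.
Qed.

Lemma supf_mink P Q u : polytope P -> polytope Q ->
  supf (mink P Q) u = supf P u + supf Q u.
Proof.
move=> Pp Qp; have PQ := polytope_mink Pp Qp.
apply/eqP; rewrite eq_le; apply/andP; split.
  apply: supf_le => // _ [x [y [Px Qy ->]]].
  by rewrite dotDr lerD // supf_ge.
have [x Px ->] := supf_in u Pp; have [y Qy ->] := supf_in u Qp.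
by rewrite -dotDr supf_ge //; exists x, y.
Qed.

Lemma supf_dilate c P u : polytope P -> 0 <= c -> supf (dilate c P) u = c * supf P u.
Proof.
move=> Pp c0; have cP := polytope_dilate c Pp.
apply/eqP; rewrite eq_le; apply/andP; split.
  by apply: supf_le => // _ [x Px <-]; rewrite dotZr ler_wpM2l ?supf_ge.
by have [x Px ->] := supf_in u Pp; rewrite -dotZr supf_ge //; exists x.
Qed.

Lemma supf_translate v P u : polytope P ->
  supf [set v + x | x in P] u = supf P u + dot v u.
Proof.
move=> Pp; have vP := polytope_translate v Pp; rewrite addrC (dotC v).
apply/eqP; rewrite eq_le; apply/andP; split.
  by apply: supf_le => // _ [x Px <-]; rewrite dotDr lerD2l supf_ge.
by have [x Px ->] := supf_in u Pp; rewrite -dotDr supf_ge //; exists x.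
Qed.

Lemma supfZ P c u : polytope P -> 0 <= c -> supf P (c *: u) = c * supf P u.
Proof. by move=> [s [s0 ->]] c0; rewrite supf_conv // hsZ. Qed.

Lemma supf0 P : polytope P -> supf P 0 = 0.
Proof. by move=> Pp; rewrite -(scale0r 0) supfZ // mul0r. Qed.

Lemma supfD P u v : polytope P -> supf P (u + v) <= supf P u + supf P v.
Proof. by move=> [s [s0 ->]]; rewrite supf_conv // hsD. Qed.

Lemma homog_supf P : polytope P -> homog (supf P).
Proof. by move=> Pp c u c0; rewrite supfZ. Qed.

Lemma germ_supf P u : polytope P -> germ (supf P) u (supf (face u P)).
Proof.
move=> [s [s0 ->]]; rewrite face_conv // !supf_conv ?argmax_neq0 //.
exact: germ_hs.
Qed.

Lemma face_sub u P : face u P `<=` P.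
Proof. by move=> x []. Qed.

Lemma lattice_polytopeW P : lattice_polytope P -> polytope P.
Proof.
by move=> [s [s0 ->]]; apply: polytope_conv; case: (s) s0.
Qed.

Lemma map_emb_neq0 (s : seq 'rV[int]_n) : s != [::] -> [seq emb R m | m <- s] != [::].
Proof. by case: s. Qed.

Lemma argmax_emb (s : seq 'rV[int]_n) u :
  argmax [seq emb R m | m <- s] u =
  [seq emb R m | m <- s & dot u (emb R m) == hs [seq emb R m | m <- s] u].
Proof. by rewrite /argmax filter_map. Qed.

Lemma lattice_face u P : lattice_polytope P -> lattice_polytope (face u P).
Proof.
move=> [s [s0 ->]]; have m0 := argmax_neq0 u (map_emb_neq0 s0).
rewrite face_conv ?map_emb_neq0 //.
move: m0; rewrite argmax_emb => m0.
by eexists; split; last reflexivity; case: filter m0.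
Qed.

Lemma lattice_mink P Q : lattice_polytope P -> lattice_polytope Q ->
  lattice_polytope (mink P Q).
Proof.
move=> [s [s0 ->]] [t [t0 ->]]; exists [seq m + k | m <- s, k <- t].
split; first by case: (s) s0; case: (t) t0.
rewrite mink_conv; congr conv; rewrite map_allpairs allpairs_mapl allpairs_mapr.
by apply: eq_allpairs => a b; rewrite embD.
Qed.

Lemma lattice_dilate (c : nat) P : lattice_polytope P -> lattice_polytope (dilate c%:R P).
Proof.
move=> [s [s0 ->]]; exists [seq c%:Z *: m | m <- s]; split; first by case: (s) s0.
by rewrite dilate_conv -!map_comp; congr conv; apply: eq_map => a /=; rewrite embMz.
Qed.

Lemma lattice_set1 (v : 'rV[int]_n) : lattice_polytope [set emb R v].
Proof. by exists [:: v]; split=> //; rewrite set1_conv. Qed.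

Lemma lattice_point x : lattice_polytope [set x] -> exists m, x = emb R m.
Proof.
move=> [[|v s] [s0 e]]; first by rewrite eqxx in s0.
exists v; apply/esym.
have : conv [seq emb R m | m <- v :: s] (emb R v) by apply: conv_mem; rewrite mem_head.
by rewrite -e.
Qed.

(** For a polytope it vanishes exactly in the directions that are constant on [P], those in which
    [P] is its own face. *)
Definition width P u := supf P u + supf P (- u).

Lemma width_ge0 P u : polytope P -> 0 <= width P u.
Proof. by move=> Pp; rewrite -(supf0 Pp) -(subrr u) supfD. Qed.

Lemma widthP P u : polytope P ->
  width P u = 0 <-> forall x y, P x -> P y -> dot u x = dot u y.
Proof.
move=> Pp; split=> [w0 x y Px Py|h].
  have := supf_ge u Pp Px; have := supf_ge u Pp Py.
  have := supf_ge (- u) Pp Px; have := supf_ge (- u) Pp Py.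
  by move: w0; rewrite /width !dotNl; lra.
rewrite /width; have [x Px ->] := supf_in u Pp; have [y Py ->] := supf_in (- u) Pp.
by rewrite dotNl (h x y) // subrr.
Qed.

Lemma face_full P u : polytope P -> face u P = P <-> width P u = 0.
Proof.
move=> Pp; split=> [e|].
  apply/widthP => // x y; rewrite -e => -[Px hx] [Py hy].
  by apply/eqP; rewrite eq_le hx ?hy.
move=> /(widthP _ Pp) h; apply/seteqP; split=> x; first by case.
by move=> Px; split=> // y Py; rewrite (h x y).
Qed.

Lemma supf_width0 P u v : polytope P -> width P u = 0 ->
  supf P (v - u) = supf P v - supf P u.
Proof.
move=> Pp w0; apply/eqP; rewrite eq_le; apply/andP; split.
  have := supfD v (- u) Pp; move: w0; rewrite /width; lra.
by have := supfD (v - u) u Pp; rewrite subrK lerBlDr.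
Qed.

Lemma widthB P u v : polytope P -> width P u = 0 -> width P v = 0 -> width P (u - v) = 0.
Proof.
move=> Pp u0 v0; have vu0 : width P (- v) = 0 by rewrite /width opprK addrC.
rewrite /width opprB !supf_width0 //; by ring.
Qed.

Lemma widthN P u : width P (- u) = width P u.
Proof. by rewrite /width opprK addrC. Qed.

Lemma face_ext P u v : polytope P -> width P (u - v) = 0 -> face u P = face v P.
Proof.
move=> Pp /(widthP _ Pp) h.
have d x y : P x -> P y -> (dot u y <= dot u x) = (dot v y <= dot v x).
  move=> Px Py; have := h x y Px Py; rewrite !dotBl => e.
  by rewrite -[LHS]subr_ge0 -[RHS]subr_ge0; congr (_ <= _); lra.
by apply/seteqP; split=> x [Px hx]; split=> // y Py; [rewrite -d ?hx|rewrite d ?hx].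
Qed.

Lemma set1_width P : polytope P -> (forall u, width P u = 0) -> exists x, P = [set x].
Proof.
move=> Pp h; have [x Px _] := supf_in 0 Pp; exists x; apply/seteqP; split=> y //=.
  by move=> Py; apply: dot_inj => u; exact: (proj1 (widthP u Pp) (h u)).
by move=> ->.
Qed.

End Conv.

(** * Germs and cells of tropical polynomials *)

Section Germs.
Variables (R : realType) (n : nat).
Implicit Types (u v x y z : 'rV[R]_n) (F G phi psi : 'rV[R]_n -> R).

Lemma germ_eq F G phi psi x : F =1 G -> phi =1 psi -> germ F x phi -> germ G x psi.
Proof. by move=> e1 e2 [r r0 h]; exists r => // v bv; rewrite -!e1 -e2 h. Qed.

Lemma germD F G phi psi x : germ F x phi -> germ G x psi ->
  germ (fun y => F y + G y) x (fun v => phi v + psi v).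
Proof.
move=> [r r0 h] [r' r'0 h']; exists (Num.min r r'); first by rewrite lt_min r0.
move=> v bv; rewrite h ?h' 1?addrACA //;
by apply: box_le bv; rewrite ge_min lexx ?orbT.
Qed.

Lemma germZ F phi x c : germ F x phi -> germ (fun y => c * F y) x (fun v => c * phi v).
Proof. by move=> [r r0 h]; exists r => // v /h ->; rewrite mulrDr. Qed.

Lemma germ_affine x v (c : R) : germ (fun y => c + dot v y) x (dot v).
Proof. by exists 1 => // w _; rewrite dotDr addrA. Qed.

Lemma germ_sum (I : eqType) (r : seq I) (F phi : I -> 'rV[R]_n -> R) x :
  (forall i, i \in r -> germ (F i) x (phi i)) ->
  germ (fun y => \sum_(i <- r) F i y) x (fun v => \sum_(i <- r) phi i v).
Proof.
elim: r => [|i r IH] h.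
  by exists 1 => // v _; rewrite !big_nil addr0.
have hi := h i (mem_head _ _); have {}IH := IH (fun j jr => h j (mem_behead (s := i :: r) jr)).
by apply: germ_eq (germD hi IH) => y; rewrite big_cons.
Qed.

Lemma germ_shift F phi x z : germ F (x - z) phi -> germ (fun y => F (y - z)) x phi.
Proof. by move=> [r r0 h]; exists r => // v bv; rewrite addrAC h. Qed.

(** By homogeneity [phi] near [e *: u] is a rescaling of [phi] near [u]. A small move from [x] in
    direction [u] thus replaces a cell by its face, and this makes sense for nonconvex functions
    too. *)
Lemma germ_germ F phi psi x u : germ F x phi -> homog phi ->
  germ phi u psi -> homog psi ->
  exists2 e0, 0 < e0 & forall e, 0 < e <= e0 -> germ F (x + e *: u) psi.
Proof.
move=> [r r0 hF] hphi [r' r'0 hp] hpsi; have [c c0 bc] := box_ex u.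
exists (r / 2 / c) => [|e /andP[e0 er]]; first by rewrite !divr_gt0.
(* The bound [e * r'] becomes [r'] after division by [e]. *)
exists (Num.min (r / 2) (e * r')) => [|v bv]; first by rewrite lt_min divr_gt0 // mulr_gt0.
have bu : box (r / 2) (e *: u).
  apply: box_le (boxZ e bc); rewrite gtr0_norm //.
  by rewrite -ler_pdivlMr.
have bv1 : box (r / 2) v by apply: box_le bv; rewrite ge_min lexx.
have bv' : box (e * r') v by apply: box_le bv; rewrite ge_min lexx orbT.
have bv2 : box r' (e^-1 *: v).
  apply: box_le (boxZ e^-1 bv').
  by rewrite gtr0_norm ?invr_gt0 // mulKf ?gt_eqF.
have hv w : box (r / 2) w -> box (r / 2) v -> box r (w + v).
  by move=> h k; have := boxD h k; rewrite -splitr.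
have hu : box r (e *: u) by apply: box_le bu; rewrite ler_pdivrMr //; lra.
rewrite -addrA (hF _ (hv _ bu bv1)) (hF _ hu).
rewrite -addrA; congr (_ + _).
have -> : e *: u + v = e *: (u + e^-1 *: v).
  by rewrite scalerDr scalerA divff ?gt_eqF // scale1r.
rewrite !hphi ?ltW // hp // mulrDr; congr (_ + _).
by rewrite hpsi ?invr_ge0 ?ltW // mulVKf ?gt_eqF.
Qed.

Lemma homogD phi psi : homog phi -> homog psi -> homog (fun v => phi v + psi v).
Proof. by move=> h k c u c0; rewrite h // k // mulrDr. Qed.

Lemma homogZ phi c : homog phi -> homog (fun v => c * phi v).
Proof. by move=> h d u d0; rewrite h // mulrCA. Qed.

Lemma homog_dot v : homog (dot v).
Proof. by move=> c u _; rewrite dotZr. Qed.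

Lemma homog_sum (I : eqType) (r : seq I) (phi : I -> 'rV[R]_n -> R) :
  (forall i, i \in r -> homog (phi i)) -> homog (fun v => \sum_(i <- r) phi i v).
Proof.
move=> h c u c0; rewrite mulr_sumr; apply: eq_big_seq => i ir; exact: h.
Qed.

End Germs.

Section Tequiv.
Variables (R : realType) (n : nat).
Implicit Types (F G H : 'rV[R]_n -> R).

Lemma tequiv_eq F G : F =1 G -> tequiv F G.
Proof. by move=> e; exists 0, 0 => x; rewrite e emb0 dot0l !addr0. Qed.

Lemma tequiv_sym F G : tequiv F G -> tequiv G F.
Proof.
move=> [a [v h]]; exists (- a), (- v) => x; rewrite h embN dotNl; ring.
Qed.

Lemma tequiv_trans F G H : tequiv F G -> tequiv G H -> tequiv F H.
Proof.
move=> [a [v h]] [b [w k]]; exists (a + b), (v + w) => x.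
by rewrite h k embD dotDl; ring.
Qed.

Lemma tequivD F F' G G' : tequiv F F' -> tequiv G G' ->
  tequiv (fun x => F x + G x) (fun x => F' x + G' x).
Proof.
move=> [a [v h]] [b [w k]]; exists (a + b), (v + w) => x.
by rewrite h k embD dotDl; ring.
Qed.

Lemma tequiv_sum (I : eqType) (r : seq I) (F G : I -> 'rV[R]_n -> R) :
  (forall i, i \in r -> tequiv (F i) (G i)) ->
  tequiv (fun x => \sum_(i <- r) F i x) (fun x => \sum_(i <- r) G i x).
Proof.
elim: r => [|i r IH] h; first by apply: tequiv_eq => x; rewrite !big_nil.
have hi := h i (mem_head _ _).
have {}IH := IH (fun j jr => h j (mem_behead (s := i :: r) jr)).
apply: tequiv_trans (tequiv_trans (tequivD hi IH) _); apply: tequiv_eq => x;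
by rewrite big_cons.
Qed.

End Tequiv.

(** * Cells as germs; units as shifted support functions *)

Section Cells.
Variables (R : realType) (n : nat).
Implicit Types (f g : tpoly R n) (u v x y z : 'rV[R]_n) (P C : set 'rV[R]_n).

Definition tlist f := [seq (tcoef f a, emb R a) | a <- tsupp f].

Lemma tlist_neq0 f : tlist f != [::].
Proof. by rewrite /tlist; case: (tsupp f) (tsupp_neq0 f). Qed.

Lemma tevalE f : teval f = maff (tlist f).
Proof.
apply: funext => x; rewrite /teval /maff /tlist big_map.
by case: (tsupp f) (tsupp_neq0 f).
Qed.

Definition cell f x : set 'rV[R]_n := conv (active (tlist f) x).

Lemma polytope_cell f x : polytope (cell f x).
Proof. by apply/polytope_conv/active_neq0/tlist_neq0. Qed.

Lemma germ_cell f x : germ f x (supf (cell f x)).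
Proof.
rewrite tevalE supf_conv ?active_neq0 ?tlist_neq0 //.
exact/germ_maff/tlist_neq0.
Qed.

Lemma lattice_cell f x : lattice_polytope (cell f x).
Proof.
exists [seq a <- tsupp f | aterm (tcoef f a, emb R a) x == maff (tlist f) x].
have e : active (tlist f) x = [seq emb R a |
    a <- tsupp f & aterm (tcoef f a, emb R a) x == maff (tlist f) x].
  by rewrite /active {1}/tlist filter_map -map_comp.
split; last by rewrite /cell e.
by have := active_neq0 x (tlist_neq0 f); rewrite e; case: filter.
Qed.

(** A lower normal scaled to last entry -1 has the form (x, -1), and on the lifted exponent [a] it
    takes the value of the term of [a] at [x]. Lower faces are therefore the cells dual to
    points. *)
Lemma subdivisionP f C : subdivision f C <-> exists x, C = cell f x.
Proof.
have slope (w : 'rV[R]_(n + 1)) : w ord0 (rshift n ord0) < 0 ->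
    lsubmx @` face w (tlift f) =
    cell f ((- w ord0 (rshift n ord0))^-1 *: lsubmx w).
  set k := - _ => w0; have k0 : 0 < k by rewrite oppr_gt0.
  pose up (a : 'rV[int]_n) := row_mx (emb R a) (- tcoef f a)%:M : 'rV[R]_(n + 1).
  have s0 : [seq up a | a <- tsupp f] != [::] by case: (tsupp f) (tsupp_neq0 f).
  rewrite /tlift face_conv // (conv_map (f := @lsubmx R 1 n 1)); last first.
    by move=> m l p _; rewrite linear_sum; apply: eq_bigr => i _; rewrite linearZ.
  have e a : dot w (up a) = k * aterm (tcoef f a, emb R a) (k^-1 *: lsubmx w).
    rewrite dot_row_mx /aterm /= dotZr mulrDr mulVKf ?gt_eqF // (dotC _ (emb R a)).
    by rewrite mulrN -mulNr addrC.
  have eh : hs [seq up a | a <- tsupp f] w = k * maff (tlist f) (k^-1 *: lsubmx w).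
    apply/eqP; rewrite eq_le; apply/andP; split.
      apply: hs_le => // _ /mapP[a ai ->]; rewrite e ler_pM2l // maff_ge //.
      exact: map_f.
    have [_ /mapP[a ai ->] ->] := maff_in (k^-1 *: lsubmx w) (tlist_neq0 f).
    by rewrite -e hs_ge // map_f.
  rewrite /cell; congr conv; rewrite /argmax /active {2}/tlist !filter_map -!map_comp.
  have -> : [seq a <- tsupp f | preim up (fun b => dot w b ==
     hs [seq row_mx (emb R b) (- tcoef f b)%:M | b <- tsupp f] w) a] =
    [seq a <- tsupp f | aterm (tcoef f a, emb R a) (k^-1 *: lsubmx w)
       == maff (tlist f) (k^-1 *: lsubmx w)].
    by apply: eq_filter => a /=; rewrite eh e (inj_eq (mulfI (lt0r_neq0 k0))).
  by apply: eq_map => a /=; rewrite row_mxKl.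
split=> [[w [w0 ->]]|[x ->]]; first by eexists; exact: slope.
exists (row_mx x (- 1)%:M); rewrite row_mxEr mxE eqxx mulr1n; split.
  by rewrite oppr_lt0.
by rewrite slope row_mxEr ?row_mxKl mxE eqxx mulr1n ?opprK ?invr1 ?scale1r // oppr_lt0.
Qed.

Lemma cell_germ f x C : polytope C -> germ f x (supf C) -> cell f x = C.
Proof.
move=> Cp gC; apply: polytope_supf => //; first exact: polytope_cell.
exact: germ_uniq (germ_cell f x) gC (homog_supf (polytope_cell f x)) (homog_supf Cp).
Qed.

Lemma face_cell f x u : exists y, face u (cell f x) = cell f y.
Proof.
have Cp := polytope_cell f x; have Fp := polytope_face u Cp.
have [e e0 he] := germ_germ (germ_cell f x) (homog_supf Cp) (germ_supf u Cp) (homog_supf Fp).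
exists (x + e *: u); apply/esym/cell_germ => //.
by apply: he; rewrite e0 lexx.
Qed.

Lemma polytope_Newt f : polytope (Newt f).
Proof. exact/polytope_conv/map_emb_neq0/tsupp_neq0. Qed.

(** If the subdivision is trivial, the Newton polytope is the cell of some [z]. All its vertices are
    active at [z], so [f] is its support function centred at [z]. *)
Lemma unit_form f : is_unit f ->
  exists z, forall x, f x = f z + supf (Newt f) (x - z).
Proof.
move=> fu; have : subdivision f (Newt f).
  rewrite fu; exists 0; apply/esym/face_full; first exact: polytope_Newt.
  by rewrite /width oppr0 supf0 ?addr0 //; apply: polytope_Newt.
move=> /subdivisionP[z ez]; exists z => x.
have l0 := tlist_neq0 f; have Np := polytope_Newt f.
rewrite tevalE; apply/eqP; rewrite eq_le; apply/andP; split.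
  apply: maff_le => // p pl; rewrite /aterm -{1}(subrK z x) addrC dotDr -addrA addrC.
  rewrite [_ + p.1]addrC lerD ?maff_ge // dotC supf_ge //.
  move: pl => /mapP[a ai ->]; apply: conv_mem; exact: map_f.
rewrite {1}ez supf_conv ?active_neq0 //.
have [a] := hs_in (x - z) (active_neq0 z l0).
move=> /mapP[p]; rewrite mem_filter => /andP[/eqP pz pl] -> ->.
rewrite -pz (dotC (x - z)); apply: le_trans (maff_ge x pl).
by rewrite /aterm dotBr; lra.
Qed.

Lemma unit_exists P z : lattice_polytope P ->
  exists f, [/\ is_unit f, Newt f = P & forall x, f x = supf P (x - z)].
Proof.
move=> PL; have Pp := lattice_polytopeW PL; case: PL => s [s0 eP].
(* With these coefficients all terms vanish at [z]. *)
pose f := TPoly (fun a => - dot (emb R a) z) s0.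
have fE x : f x = supf P (x - z).
  rewrite tevalE eP supf_conv ?map_emb_neq0 //.
  apply/eqP; rewrite eq_le; apply/andP; split.
    apply: maff_le; first exact: tlist_neq0.
    move=> _ /mapP[a ai ->]; rewrite /aterm /= addrC -dotBr dotC.
    by apply: hs_ge; apply: map_f.
  have [_ /mapP[a ai ->] ->] := hs_in (x - z) (map_emb_neq0 R s0).
  rewrite dotC dotBr addrC; apply: (@maff_ge _ _ _ _ (- dot (emb R a) z, emb R a)).
  by apply/mapP; exists a.
have cE x : cell f x = face (x - z) P.
  apply: cell_germ; first exact: polytope_face.
  apply: (@germ_eq _ _ (fun y => supf P (y - z)) _ (supf (face (x - z) P))) => //.
  by apply: germ_shift; apply: germ_supf.
exists f; split=> //; apply/seteqP; split=> C /=.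
  by move=> /subdivisionP[x ->]; rewrite cE /Newt /= -eP; exists (x - z).
rewrite /Newt /= -eP => -[u ->]; apply/subdivisionP.
by exists (u + z); rewrite cE addrK.
Qed.

Lemma tpoly_of_list (L : seq (R * 'rV[int]_n)) : L != [::] ->
  exists h : tpoly R n, h =1 maff [seq (p.1, emb R p.2) | p <- L].
Proof.
move=> L0; have s0 : [seq p.2 | p <- L] != [::] by case: (L) L0.
(* An exponent may occur several times in [L] but has one coefficient: the maximum of those listed,
   written as a maximum of constant affine functions. *)
pose lc e := [seq (p.1, 0 : 'rV[R]_n) | p <- L & p.2 == e].
pose h := TPoly (fun e => maff (lc e) 0) s0.
have L0' : [seq (p.1, emb R p.2) | p <- L] != [::] by case: (L) L0.
exists h => x; rewrite tevalE; apply/eqP; rewrite eq_le; apply/andP; split.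
  apply: maff_le; first exact: tlist_neq0.
  move=> _ /mapP[e /mapP[q qL ->] ->]; rewrite /aterm /=.
  have lc0 : lc q.2 != [::].
    rewrite -size_eq0 size_map size_eq0 -has_filter; apply/hasP.
    by exists q => /=.
  have [_ /mapP[p + ->] ->] := maff_in 0 lc0; rewrite mem_filter => /andP[/eqP <- pL].
  rewrite /aterm /= dot0l addr0.
  by apply: (@maff_ge _ _ _ _ (p.1, emb R p.2)); apply: map_f.
apply: maff_le => // _ /mapP[p pL ->].
apply: le_trans (maff_ge (l := tlist h) x (p := (maff (lc p.2) 0, emb R p.2)) _).
  rewrite /aterm /= lerD2r -[leLHS]addr0 -(dot0l (0 : 'rV[R]_n)).
  apply: (@maff_ge _ _ _ _ (p.1, 0)); apply: map_f.
  by rewrite mem_filter eqxx.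
by apply/mapP; exists p.2; rewrite //= map_f.
Qed.

(** Cofactors are required to be tropical polynomials, so a sum of units has to be realized by one
    ([ksum_tpoly]). *)
Lemma tpoly_add f g : exists h : tpoly R n, h =1 f \+ g.
Proof.
pose L := [seq (tcoef f a + tcoef g b, a + b) | a <- tsupp f, b <- tsupp g].
have L0 : L != [::].
  by rewrite /L; case: (tsupp f) (tsupp_neq0 f) => // a s _; case: (tsupp g) (tsupp_neq0 g).
have [h hE] := tpoly_of_list L0; exists h => x; rewrite hE /= !tevalE.
have aE (a b : 'rV[int]_n) : aterm (tcoef f a + tcoef g b, emb R (a + b)) x =
    aterm (tcoef f a, emb R a) x + aterm (tcoef g b, emb R b) x.
  by rewrite /aterm /= embD dotDl; ring.
apply/eqP; rewrite eq_le; apply/andP; split.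
  apply: maff_le; first by case: (L) L0.
  move=> _ /mapP[_ /allpairsP[[a b] [/= ai bi ->]] ->].
  by rewrite aE lerD // maff_ge //; apply: map_f.
have [_ /mapP[a ai ->] ->] := maff_in x (tlist_neq0 f).
have [_ /mapP[b bi ->] ->] := maff_in x (tlist_neq0 g).
rewrite -aE; apply: maff_ge; apply/mapP.
exists (tcoef f a + tcoef g b, a + b) => //.
by apply/allpairsP; exists (a, b).
Qed.

Lemma tpoly_cst0 : exists h : tpoly R n, forall x, h x = 0.
Proof.
have [//|h hE] := @tpoly_of_list [:: (0, 0)]; exists h => x.
have [//|p] := @maff_in _ _ [seq (p.1, emb R p.2) | p <- [:: (0, 0 : 'rV[int]_n)]] x.
by rewrite inE hE => /eqP -> ->; rewrite /aterm /= emb0 dot0l addr0.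
Qed.

End Cells.

Lemma ltn_count (T : eqType) (p q : pred T) (s : seq T) x : subpred p q ->
  x \in s -> q x -> ~~ p x -> (count p s < count q s)%N.
Proof.
move=> pq + qx px; elim: s => //= y s IH; rewrite inE => /predU1P[<-|/IH h].
  by rewrite qx (negbTE px) add0n add1n ltnS sub_count.
by rewrite -addnS leq_add //; case: (boolP (p y)) => // /pq ->.
Qed.

(** * Induction and local constancy on the real line *)

Section RealInduction.
Variable R : realType.

(** If [B] failed somewhere, the supremum of the initial segments on which it holds would satisfy
    [B] by the closing step and be passed by the opening step. *)
Lemma real_ind (B : R -> Prop) a : B a ->
  (forall s, a <= s -> B s -> exists2 e, 0 < e & forall d, 0 < d <= e -> B (s + d)) ->
  (forall s, a < s -> (forall r, a <= r < s -> B r) -> B s) ->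
  forall s, a <= s -> B s.
Proof.
move=> Ba Bopen Bclosed b ab; apply: contrapT => nB.
pose E := [set s | a <= s /\ forall r, a <= r <= s -> B r].
have Ea : E a by split=> // r; rewrite -eq_le => /eqP <-.
have ubE : ubound E b.
  move=> s [as_ h]; rewrite leNgt; apply/negP => bs; apply: nB.
  by apply: h; rewrite ab ltW.
have supE : has_sup E by split; [exists a | exists b].
have ac : a <= sup E by apply: sup_upper_bound.
have below r : a <= r < sup E -> B r.
  move=> /andP[ar rc]; have rc0 : 0 < sup E - r by rewrite subr_gt0.
  have [s [_ h]] := sup_adherent rc0 supE; rewrite opprB addrCA subrr addr0 => rs.
  by apply: h; rewrite ar ltW.
have Bc : B (sup E).
  by move: ac; rewrite le_eqVlt => /predU1P[<-//|ac]; apply: Bclosed.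
have [e e0 he] := Bopen _ ac Bc.
have : E (sup E + e).
  split=> [|r /andP[ar re]]; first by rewrite (le_trans ac) // lerDl ltW.
  have [rc|cr|->//] := ltgtP r (sup E); first by apply: below; rewrite ar.
  have -> : r = sup E + (r - sup E) by rewrite addrCA subrr addr0.
  by apply: he; rewrite subr_gt0 cr lerBlDl.
by move=> /(sup_upper_bound supE); rewrite gerDl leNgt e0.
Qed.

(** Connectedness of the line for values in a bare type; it is applied to integer coefficients and
    gradients along lines. *)
Lemma locally_constant (T : Type) (phi : R -> T) :
  (forall s, exists2 e, 0 < e & forall d, `|d| <= e -> phi (s + d) = phi s) ->
  forall s, phi s = phi 0.
Proof.
have pos (psi : R -> T) :
    (forall s, exists2 e, 0 < e & forall d, `|d| <= e -> psi (s + d) = psi s) ->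
    forall s, 0 <= s -> psi s = psi 0.
  move=> h; apply: real_ind => // [s _ <-|s s0 hs].
    have [e e0 he] := h s; exists e => // d /andP[d0 de].
    by rewrite he // gtr0_norm.
  have [e e0 he] := h s.
  have m0 : 0 < Num.min e s by rewrite lt_min e0.
  rewrite -(he (- Num.min e s)); first by apply: hs; rewrite subr_ge0 ge_min lexx orbT /=; lra.
  by rewrite normrN gtr0_norm // ge_min lexx.
move=> h s; have [s0|s0] := leP 0 s; first exact: pos.
have := pos (fun s => phi (- s)) _ (- s); rewrite opprK oppr0; apply; last by lra.
move=> r; have [e e0 he] := h (- r); exists e => // d de.
by rewrite opprD he // normrN.
Qed.

End RealInduction.

(** * Finiteness of piecewise linear functions *)

Section Tame.
Variables (R : realType) (n : nat).
Implicit Types (u v x y z : 'rV[R]_n) (F G phi psi : 'rV[R]_n -> R).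

(* lab x records the cell containing x of a polyhedral complex adapted to the
   piecewise linear function F; cells are convex, and germs are constant on them. *)
Definition tame F := exists (K : finType) (lab : 'rV[R]_n -> K)
    (G : 'rV[R]_n -> 'rV[R]_n -> R),
  [/\ forall x, germ F x (G x), forall x, homog (G x) &
      forall x y s, lab x = lab y -> 0 <= s <= 1 -> G (x + s *: (y - x)) =1 G x].

Lemma tame_eq F F' : F =1 F' -> tame F -> tame F'.
Proof.
move=> e [K [lab [G [h1 h2 h3]]]]; exists K, lab, G; split=> // x.
exact: germ_eq (h1 x).
Qed.

Lemma tameD F F' : tame F -> tame F' -> tame (fun x => F x + F' x).
Proof.
move=> [K [lab [G [h1 h2 h3]]]] [K' [lab' [G' [h1' h2' h3']]]].
exists (K * K')%type, (fun x => (lab x, lab' x)), (fun x u => G x u + G' x u).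
split=> [x|x|x y s [e e'] s01 u]; [exact: germD | exact: homogD |].
by rewrite h3 ?h3'.
Qed.

Lemma tameZ F c : tame F -> tame (fun x => c * F x).
Proof.
move=> [K [lab [G [h1 h2 h3]]]]; exists K, lab, (fun x u => c * G x u).
split=> [x|x|x y s e s01 u]; [exact: germZ | exact: homogZ |].
by rewrite h3.
Qed.

Lemma tame0 : tame (fun=> 0).
Proof.
exists unit, (fun=> tt), (fun _ _ => 0); split=> // [x|x c u _].
  by exists 1 => // v _; rewrite addr0.
by rewrite mulr0.
Qed.

Lemma tame_sum (I : eqType) (r : seq I) (F : I -> 'rV[R]_n -> R) :
  (forall i, i \in r -> tame (F i)) -> tame (fun x => \sum_(i <- r) F i x).
Proof.
elim: r => [|i r IH] h.
  by apply: tame_eq tame0 => x; rewrite big_nil.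
have hi := h i (mem_head _ _).
have {}IH := IH (fun j jr => h j (mem_behead (s := i :: r) jr)).
by apply: tame_eq (tameD hi IH) => x; rewrite big_cons.
Qed.

Lemma aterm_seg p x y s :
  aterm p (x + s *: (y - x)) = (1 - s) * aterm p x + s * aterm p y :> R.
Proof. by rewrite /aterm dotDr dotZr dotBr; ring. Qed.

(** The label is the set of active terms. If it is the same at [x] and [y], a common active term
    gives the maximum along the segment, and a term inactive at both ends stays strictly below
    it. *)
Lemma tame_maff (l : seq (R * 'rV[R]_n)) : l != [::] -> tame (maff l).
Proof.
move=> l0; exists {ffun 'I_(size l) -> bool}.
exists (fun x => [ffun i : 'I__ => aterm (nth (0, 0) l i) x == maff l x]).
exists (fun x => hs (active l x)); split=> [x|x|x y s e /andP[s0 s1] u].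
- exact: germ_maff.
- exact/homog_hs/active_neq0.
have {}e p : p \in l -> (aterm p x == maff l x) = (aterm p y == maff l y).
  move=> pl; have pi : (index p l < size l)%N by rewrite index_mem.
  by have /ffunP/(_ (Ordinal pi)) := e; rewrite !ffunE /= nth_index.
suff -> : active l (x + s *: (y - x)) = active l x by [].
have [p pl px] := maff_in x l0.
have py : maff l y = aterm p y by apply/esym/eqP; rewrite -e // px.
have mE : maff l (x + s *: (y - x)) = (1 - s) * maff l x + s * maff l y.
  apply/eqP; rewrite eq_le px py -aterm_seg maff_ge // andbT aterm_seg.
  apply: maff_le => // q ql; rewrite aterm_seg -px -py.
  by rewrite lerD // ler_wpM2l ?subr_ge0 // maff_ge.
congr map; apply: eq_in_filter => q ql; rewrite mE aterm_seg.
have [qx|qx] := eqVneq (aterm q x) (maff l x).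
  by have /eqP qy : aterm q y == maff l y; [rewrite -e // qx|rewrite qx qy eqxx].
have qy : aterm q y < maff l y by rewrite lt_neqAle -e // qx maff_ge.
have {}qx : aterm q x < maff l x by rewrite lt_neqAle qx maff_ge.
apply/negbTE; rewrite lt_eqF //.
have [->|s_neq0] := eqVneq s 0; first by rewrite subr0 !mul1r !mul0r !addr0.
apply: ler_ltD; first by rewrite ler_wpM2l ?subr_ge0 // ltW.
by rewrite ltr_pM2l // lt_neqAle eq_sym s_neq0.
Qed.

Lemma tame_tpoly (f : tpoly R n) : tame f.
Proof. by rewrite tevalE; apply/tame_maff/tlist_neq0. Qed.

End Tame.

(** * Expansions in the Minkowski group of S *)

Section Expansions.
Variables (R : realType) (n : nat) (S : {fset set 'rV[R]_n}).
Hypothesis S_lattice : forall P, P \in S -> lattice_polytope P.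
Implicit Types (u v x z : 'rV[R]_n) (P Q C : set 'rV[R]_n) (phi psi : 'rV[R]_n -> R).
Implicit Types (y : set 'rV[R]_n -> int).

Let S_polytope P : P \in S -> polytope P.
Proof. by move=> /S_lattice/lattice_polytopeW. Qed.

(** A relation on functions rather than polytopes, so that it covers differences and germs of
    nonconvex functions. Only the values of [y] on [S] matter. *)
Definition expands phi y := exists t : 'rV[int]_n, forall u,
  phi u = \sum_(P <- S) (y P)%:~R * supf P u + dot (emb R t) u.

Lemma expands_eq phi psi y y' : phi =1 psi -> (forall P, P \in S -> y P = y' P) ->
  expands phi y -> expands psi y'.
Proof.
move=> e e' [t h]; exists t => u; rewrite -e h; congr (_ + _).
by apply: eq_big_seq => P PS; rewrite e'.
Qed.

Lemma expandsD phi psi y y' : expands phi y -> expands psi y' ->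
  expands (fun u => phi u + psi u) (fun P => y P + y' P).
Proof.
move=> [t h] [t' h']; exists (t + t') => u; rewrite h h' embD dotDl addrACA.
by congr (_ + _); rewrite -big_split; apply: eq_bigr => P _; rewrite intrD mulrDl.
Qed.

Lemma expandsZ phi y (c : int) : expands phi y ->
  expands (fun u => c%:~R * phi u) (fun P => c * y P).
Proof.
move=> [t h]; exists (c *: t) => u; rewrite h embMz dotZl mulrDr; congr (_ + _).
by rewrite mulr_sumr; apply: eq_bigr => P _; rewrite intrM mulrA.
Qed.

Lemma expands_dot (t : 'rV[int]_n) : expands (dot (emb R t)) (fun=> 0).
Proof. by exists t => u; rewrite big1 ?add0r // => P _; rewrite mul0r. Qed.

Lemma expands0 : expands (fun=> 0) (fun=> 0).
Proof.
by apply: expands_eq (expands_dot 0) => // u; rewrite emb0 dot0l.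
Qed.

Lemma expandsB phi psi y y' : expands phi y -> expands psi y' ->
  expands (fun u => phi u - psi u) (fun P => y P - y' P).
Proof.
move=> h /(expandsZ (-1)) /(expandsD h); apply: expands_eq => [u|P _].
  by rewrite mulN1r.
by rewrite mulN1r.
Qed.

Lemma expands_sum (I : eqType) (r : seq I) (c : I -> int)
    (phi : I -> 'rV[R]_n -> R) (y : I -> set 'rV[R]_n -> int) :
  (forall i, i \in r -> expands (phi i) (y i)) ->
  expands (fun u => \sum_(i <- r) (c i)%:~R * phi i u)
          (fun P => \sum_(i <- r) c i * y i P).
Proof.
elim: r => [|i r IH] h.
  by apply: expands_eq expands0 => [u|P _]; rewrite big_nil.
have hi := h i (mem_head _ _).
have {}IH := IH (fun j jr => h j (mem_behead (s := i :: r) jr)).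
by apply: expands_eq (expandsD (expandsZ (c i) hi) IH) => [u|P _]; rewrite big_cons.
Qed.

Lemma sum_delta (V : pzRingType) (F : set 'rV[R]_n -> V) P : P \in S ->
  \sum_(Q <- S) (Q == P)%:R * F Q = F P.
Proof.
move=> PS; rewrite (bigD1_seq P) ?fset_uniq //= eqxx mul1r big1 ?addr0 //.
by move=> Q /negbTE ->; rewrite mul0r.
Qed.

Lemma expands_supf P : P \in S -> expands (supf P) (fun Q => (Q == P)%:Z).
Proof.
move=> PS; exists 0 => u; rewrite emb0 dot0l addr0 -[LHS](sum_delta (fun Q => supf Q u) PS).
by apply: eq_bigr => Q _; rewrite -pmulrn.
Qed.

Lemma supf_big_mink (I : eqType) (r : seq I) (D : I -> set 'rV[R]_n) :
  (forall i, i \in r -> polytope (D i)) ->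
  polytope (\big[@mink R n/[set 0]]_(i <- r) D i) /\
  forall u, supf (\big[@mink R n/[set 0]]_(i <- r) D i) u = \sum_(i <- r) supf (D i) u.
Proof.
elim: r => [|i r IH] h.
  rewrite big_nil; split; first exact: polytope_set1.
  by move=> u; rewrite big_nil supf_set1 dot0r.
have hi := h i (mem_head _ _).
have {IH}[Cp IH] := IH (fun j jr => h j (mem_behead (s := i :: r) jr)).
rewrite big_cons; split; first exact: polytope_mink.
by move=> u; rewrite supf_mink // IH big_cons.
Qed.

Lemma lattice_big_mink (I : eqType) (r : seq I) (D : I -> set 'rV[R]_n) :
  (forall i, i \in r -> lattice_polytope (D i)) ->
  lattice_polytope (\big[@mink R n/[set 0]]_(i <- r) D i).
Proof.
elim: r => [|i r IH] h; first by rewrite big_nil -(emb0 R n); apply: lattice_set1.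
have hi := h i (mem_head _ _).
have {}IH := IH (fun j jr => h j (mem_behead (s := i :: r) jr)).
by rewrite big_cons; apply: lattice_mink.
Qed.

Lemma lattice_msum (k : set 'rV[R]_n -> nat) : lattice_polytope (msum S k).
Proof. by apply: lattice_big_mink => P PS; apply/lattice_dilate/S_lattice. Qed.

Lemma supf_msum (k : set 'rV[R]_n -> nat) u :
  supf (msum S k) u = \sum_(P <- S) (k P)%:R * supf P u.
Proof.
have [|_ ->] := @supf_big_mink _ (enum_fset S) (fun P => dilate (k P)%:R P).
  by move=> P PS; apply/polytope_dilate/S_polytope.
by apply: eq_big_seq => P PS; rewrite supf_dilate //; apply: S_polytope.
Qed.

Lemma polytope_Stotal : polytope (Stotal S).
Proof. exact: (proj1 (supf_big_mink (D := id) S_polytope)). Qed.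

Lemma supf_Stotal u : supf (Stotal S) u = \sum_(P <- S) supf P u.
Proof. exact: (proj2 (supf_big_mink (D := id) S_polytope)). Qed.

Lemma lattice_Stotal : lattice_polytope (Stotal S).
Proof. exact: (lattice_big_mink (D := id)). Qed.

Lemma NS_expands C : NS S C -> exists k : set 'rV[R]_n -> nat, expands (supf C) (fun P => (k P)%:Z).
Proof.
move=> [CL [k [t ->]]]; exists k, t => u.
by rewrite supf_translate ?supf_msum //; apply/lattice_polytopeW/lattice_msum.
Qed.

Lemma expands_NS C (k : set 'rV[R]_n -> nat) : lattice_polytope C ->
  expands (supf C) (fun P => (k P)%:Z) -> NS S C.
Proof.
move=> CL [t h]; split=> //; exists k, t.
have Mp := lattice_polytopeW (lattice_msum k).
apply: polytope_supf; [exact: lattice_polytopeW | exact: polytope_translate |].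
by move=> u; rewrite supf_translate // supf_msum h.
Qed.

Lemma ZS_expands C : ZS S C -> exists y, expands (supf C) y.
Proof.
move=> [CL [G [GN CGN]]]; have [k hk] := NS_expands GN.
have [k' hk'] := NS_expands CGN; exists (fun P => (k' P)%:Z - (k P)%:Z).
apply: expands_eq (expandsB hk' hk) => // u; rewrite supf_mink ?addrK //.
  exact: lattice_polytopeW.
by case: GN => /lattice_polytopeW.
Qed.

(** The negative part of [y], moved to the other side, is the cofactor; [Negz m] stands for -(m +
    1). *)
Lemma expands_ZS C y : lattice_polytope C -> expands (supf C) y -> ZS S C.
Proof.
move=> CL h; split=> //.
pose k P := if y P is Negz m then m.+1 else 0%N.
pose k' P := if y P is Posz m then m else 0%N.
have GL := lattice_msum k; exists (msum S k).
have Gx : expands (supf (msum S k)) (fun P => (k P)%:Z).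
  by exists 0 => u; rewrite supf_msum emb0 dot0l addr0.
split; first exact: expands_NS Gx.
apply: (expands_NS (k := k')); first exact: lattice_mink.
apply: expands_eq (expandsD h Gx) => [u|P _].
  by rewrite supf_mink //; apply: lattice_polytopeW.
by rewrite /k /k'; case: (y P) => m; rewrite ?addr0 // NegzE addNr.
Qed.

End Expansions.

(** * Minkowski summands *)

Section Summands.
Variables (R : realType) (n : nat).
Implicit Types (a b d u v w x y z : 'rV[R]_n) (P E : set 'rV[R]_n).
Implicit Types (g h phi psi : 'rV[R]_n -> R).

Lemma small_neq0 (p q : R) : p != 0 ->
  exists2 e, 0 < e & forall t, 0 < t <= e -> p + t * q != 0.
Proof.
move=> p0; exists (`|p| / (`|q| + 1)); first by rewrite divr_gt0 ?normr_gt0 // ltr_wpDl.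
move=> t /andP[t0]; rewrite ler_pdivlMr ?ltr_wpDl // => tp; apply/eqP => e.
have : `|p| = t * `|q| by rewrite -(gtr0_norm t0) -normrM -normrN; congr `|_|; lra.
by lra.
Qed.

(** A direction good for the tail stays good after a small move along [d], which repairs it if it
    was orthogonal to [d]. *)
Lemma generic_dot (D : seq 'rV[R]_n) : 0 \notin D ->
  exists u, forall d, d \in D -> dot u d != 0.
Proof.
elim: D => [|d D IH]; first by exists 0.
rewrite inE negb_or eq_sym => /andP[d0 /IH[u hu]].
have [||e e0 he] := @minr_seq R _ D
  (fun e d' => forall t, 0 < t <= e -> dot u d' + t * dot d d' != 0).
- move=> d' e e' h /andP[_ ee] t /andP[t0 te]; apply: h; rewrite t0.
  exact: le_trans ee.
- by move=> d' /hu/(small_neq0 (dot d d')).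
have [ud|ud] := eqVneq (dot u d) 0; last first.
  by exists u => d'; rewrite inE => /predU1P[->|/hu].
exists (u + e *: d) => d'; rewrite inE dotDl dotZl => /predU1P[->|/he]; last first.
  by apply; rewrite e0 lexx.
by rewrite ud add0r mulf_neq0 ?gt_eqF // dot_gt0.
Qed.

Definition subadd g := forall x y, g (x + y) <= g x + g y.

Lemma subadd_dot a : subadd (dot a).
Proof. by move=> x y; rewrite dotDr. Qed.

Lemma subaddD g h : subadd g -> subadd h -> subadd (fun x => g x + h x).
Proof. by move=> gs hs x y; have := gs x y; have := hs x y; lra. Qed.

Lemma subaddZ g (c : R) : 0 <= c -> subadd g -> subadd (fun x => c * g x).
Proof. by move=> c0 gs x y; rewrite -mulrDr ler_wpM2l. Qed.

Lemma subadd_eq g h : g =1 h -> subadd g -> subadd h.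
Proof. by move=> e gs x y; rewrite -!e. Qed.

Lemma subadd_sum (I : eqType) (r : seq I) (f : I -> 'rV[R]_n -> R) :
  (forall i, i \in r -> subadd (f i)) -> subadd (fun x => \sum_(i <- r) f i x).
Proof.
move=> h x y /=; rewrite -big_split big_seq [leRHS]big_seq; apply: ler_sum => i ir.
exact: h.
Qed.

Lemma subadd_supf P : polytope P -> subadd (supf P).
Proof. by move=> Pp x y; apply: supfD. Qed.

Lemma germ_eps g phi x (c : R) v : germ g x phi -> homog phi -> 0 < c ->
  exists2 e, 0 < e <= c & forall t, 0 <= t <= e -> g (x + t *: v) = g x + t * phi v.
Proof.
move=> gg gh c0; have [e e0 he] := germ_small v gg gh.
exists (Num.min e c); first by rewrite lt_min e0 c0 ge_min lexx orbT.
by move=> t /andP[t0]; rewrite le_min => /andP[te _]; rewrite he ?t0.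
Qed.

(** This is subadditivity of [g] at [x + e *: v] and [x + e *: w], divided by [e]; homogeneity
    absorbs the factor 2 of the midpoint. *)
Lemma subadd_germ g x psi : subadd g -> homog g -> germ g x psi -> homog psi -> subadd psi.
Proof.
move=> gs gh gg ph v w.
have [e1 /andP[e10 _] E1] := germ_eps v gg ph ltr01.
have [e2 /andP[e20 e21] E2] := germ_eps w gg ph e10.
have [e /andP[e0 e32] E3] := germ_eps (v + w) gg ph e20.
have ee : 0 <= e <= e by rewrite lexx ltW.
have := gs (x + e *: v) (x + e *: w).
rewrite E1 ?(ltW e0) ?(le_trans e32 e21) // E2 ?(ltW e0) //.
have -> : x + e *: v + (x + e *: w) = 2 *: (x + (e / 2) *: (v + w)).
  have ee2 : 2 * (e / 2) = e by lra.
  by rewrite !scalerDr !scalerA ee2 addrACA scaler_nat mulr2n.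
rewrite gh // E3; last by apply/andP; split; lra.
move=> h; rewrite -(ler_pM2l e0); lra.
Qed.

Lemma hs_const s a : s != [::] -> (forall b, b \in s -> b = a) -> hs s =1 dot a.
Proof. by move=> s0 h u; have [b bs ->] := hs_in u s0; rewrite (h b bs) dotC. Qed.

(* Near a generic u both functions are linear, which exhibits the difference as
   the support function of the set of its gradients. *)
Lemma subadd_hsB s1 s2 : s1 != [::] -> s2 != [::] -> subadd (fun u => hs s1 u - hs s2 u) ->
  exists s3, [/\ s3 != [::], {subset s3 <= [seq a - b | a <- s1, b <- s2]} &
    forall u, hs s1 u = hs s2 u + hs s3 u].
Proof.
set g := fun u => _; move=> s10 s20 gs.
have gh : homog g by move=> c u c0; rewrite /g !hsZ // mulrBr.
pose L := [seq a - b | a <- s1, b <- s2].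
pose s3 := [seq d <- L | `[< forall u, dot u d <= g u >]].
(* Avoiding the nonzero differences, [u] takes distinct values on distinct points of [s1] and of
   [s2], so maximizing in direction [x] and then in direction [u] leaves a single point. *)
pose D s := [seq d <- [seq a - b | a <- s, b <- s] | d != 0].
have [|u hu] := @generic_dot (D s1 ++ D s2).
  by rewrite mem_cat !mem_filter eqxx.
have single s x : s != [::] -> {subset D s <= D s1 ++ D s2} ->
    exists a, [/\ a \in s, dot x a = hs s x & hs (argmax (argmax s x) u) =1 dot a].
  move=> s0 sub; have T0 := argmax_neq0 x s0; have U0 := argmax_neq0 u T0.
  have [a aU _] := hs_in x U0; exists a; move: (aU); rewrite !mem_argmax.
  move=> /andP[/andP[ai /eqP ax] /eqP au]; split=> //.
  apply: hs_const => // b; rewrite !mem_argmax => /andP[/andP[bi _] /eqP bu].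
  apply/eqP; rewrite -subr_eq0; apply/negP => /negP ab.
  have /sub/hu : b - a \in D s.
    by rewrite mem_filter ab; apply/allpairsP; exists (b, a).
  by rewrite dotBr bu au subrr eqxx.
have D1 : {subset D s1 <= D s1 ++ D s2} by move=> d dD; rewrite mem_cat dD.
have D2 : {subset D s2 <= D s1 ++ D s2} by move=> d dD; rewrite mem_cat dD orbT.
(* The gradient [a - b] of [g] just off [x] in direction [u] bounds [g] from below everywhere, by
   subadditivity, and agrees with [g] at [x]. *)
have claim x : exists2 d, d \in s3 & dot x d = g x.
  have [a [ai ax aE]] := single s1 x s10 D1.
  have [b [bi bx bE]] := single s2 x s20 D2.
  exists (a - b); last by rewrite dotBr ax bx.
  rewrite mem_filter; apply/andP; split; last by apply/allpairsP; exists (a, b).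
  apply/asboolP => y.
  have germ_ab s c : s != [::] -> hs (argmax (argmax s x) u) =1 dot c ->
      exists2 e0, 0 < e0 & forall e, 0 < e <= e0 -> germ (hs s) (x + e *: u) (dot c).
    move=> s0 cE; have T0 := argmax_neq0 x s0.
    apply: germ_germ (germ_hs x s0) (homog_hs T0) _ (homog_dot c).
    by apply: germ_eq (germ_hs u T0).
  have [e1 e10 h1] := germ_ab _ _ s10 aE; have [e2 e20 h2] := germ_ab _ _ s20 bE.
  pose e := Num.min e1 e2; have e_gt0 : 0 < e by rewrite lt_min e10.
  have gg : germ g (x + e *: u) (dot (a - b)).
    apply: germ_eq (germD (h1 e _) (germZ (-1) (h2 e _))).
    - by move=> z; rewrite mulN1r.
    - by move=> z; rewrite dotBl mulN1r.
    - by rewrite e_gt0 ge_min lexx.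
    - by rewrite e_gt0 ge_min lexx orbT.
  have [t /andP[t0 _] ht] := germ_eps y gg (homog_dot (a - b)) ltr01.
  have := gs (x + e *: u) (t *: y); rewrite ht ?(ltW t0) ?lexx // gh ?(ltW t0) //.
  by rewrite lerD2l ler_pM2l // dotC.
have s30 : s3 != [::] by have [d + _] := claim 0; case: (s3).
exists s3; split=> // [d|x]; first by rewrite mem_filter => /andP[].
apply/eqP; rewrite -subr_eq0 opprD addrA subr_eq0; apply/eqP; apply/eqP.
rewrite eq_le; apply/andP; split; last first.
  by apply: hs_le => // d; rewrite mem_filter => /andP[/asboolP + _]; apply.
by have [d ds dE] := claim x; rewrite -/(g x) -dE hs_ge.
Qed.

(** Local convexity makes the slope in direction [v] nondecreasing along the segment, so it never
    drops below [psi0 v]. Real induction carries the bound on the value together with the bound on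
    the slope. *)
Lemma supporting_ray g m v : (forall s : R, 0 <= s <= 1 ->
    exists psi, [/\ germ g (m + s *: v) psi, homog psi & subadd psi]) ->
  forall psi, germ g m psi -> homog psi -> g m + psi v <= g (m + v).
Proof.
move=> H psi0 g0 ph0.
pose B (s : R) := s <= 1 -> g m + s * psi0 v <= g (m + s *: v) /\
  forall psi, germ g (m + s *: v) psi -> homog psi -> psi0 v <= psi v.
suff : forall s, 0 <= s -> B s.
  by move=> /(_ 1 ler01 (lexx _))[]; rewrite scale1r mul1r.
apply: real_ind.
- move=> _; rewrite scale0r addr0 mul0r addr0; split=> // psi gg ph.
  by rewrite (germ_uniq gg g0).
- move=> s s0 Bs; have [s1|s1] := leP s 1; last first.
    by exists 1 => // d /andP[d0 _]; rewrite /B => h; exfalso; lra.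
  have s01 : 0 <= s <= 1 by rewrite s0.
  have [psi [gg ph ps]] := H s s01.
  have [Bs1 /(_ psi gg ph) Bs2] := Bs s1.
  have [e /andP[e0 _] he] := germ_eps v gg ph ltr01.
  exists (e / 2) => [|d /andP[d0 de] sd]; first by rewrite divr_gt0.
  have gd : g (m + (s + d) *: v) = g (m + s *: v) + d * psi v.
    by rewrite scalerDl addrA he //; apply/andP; split; lra.
  split; first by rewrite gd; have := ler_wpM2l (ltW d0) Bs2; lra.
  move=> psi' gg' ph'.
  have e2 : 0 < e / 2 by rewrite divr_gt0.
  have [e' /andP[e'0 e'e] he'] := germ_eps v gg' ph' e2.
  have := he' e'; rewrite lexx ltW // => /(_ isT); rewrite gd.
  have -> : m + (s + d) *: v + e' *: v = m + s *: v + (d + e') *: v.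
    by rewrite !scalerDl !addrA.
  rewrite he; last by apply/andP; split; lra.
  by move=> E; rewrite -(ler_pM2l e'0); have := ler_wpM2l (ltW e'0) Bs2; lra.
move=> s s0 hB s1.
have s01 : 0 <= s <= 1 by rewrite ltW.
have [psi [gg ph ps]] := H s s01.
have [e /andP[e0 es] he] := germ_eps (- v) gg ph s0.
have [||Be1 Be2] := hB (s - e) _ _.
- by apply/andP; split; lra.
- by lra.
have he' t : 0 <= t <= e -> g (m + (s - t) *: v) = g (m + s *: v) + t * psi (- v).
  by move=> /he <-; rewrite scalerBl scalerN addrA.
have [|psi' [gg' ph' _]] := H (s - e) _; first by apply/andP; split; lra.
have [e' /andP[e'0 e'e] k] := germ_eps v gg' ph' e0.
(* The slope at [s - e] is read off the germ at [s] backwards; subadditivity of [psi] then bounds it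
   by [psi v]. *)
have psiE : psi' v = - psi (- v).
  have := k e'; rewrite lexx ltW // => /(_ isT).
  have -> : m + (s - e) *: v + e' *: v = m + (s - (e - e')) *: v.
    by rewrite -addrA -scalerDl; congr (_ + _ *: _); ring.
  rewrite !he'; [|by apply/andP; split; lra ..] => E.
  by apply: (mulfI (lt0r_neq0 e'0)); lra.
have := Be2 psi' gg' ph'; rewrite psiE => h1.
have h2 : - psi (- v) <= psi v.
  by have := ps v (- v); rewrite subrr -(scale0r 0) ph // mul0r; lra.
have := he' e; rewrite lexx ltW // => /(_ isT) E.
split; last first.
  by move=> psi2 gg2 ph2; rewrite (germ_uniq gg2 gg) //; apply: le_trans h2.
by have := ler_wpM2l (ltW e0) h1; lra.
Qed.

Lemma midpoint_le g m v : (forall s : R, -1 <= s <= 1 ->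
    exists psi, [/\ germ g (m + s *: v) psi, homog psi & subadd psi]) ->
  2 * g m <= g (m + v) + g (m - v).
Proof.
move=> H; have [|psi [gg ph ps]] := H 0; first by apply/andP; split; lra.
rewrite scale0r addr0 in gg.
have h1 := @supporting_ray g m v _ psi gg ph.
have h2 := @supporting_ray g m (- v) _ psi gg ph.
have {}h1 : g m + psi v <= g (m + v).
  by apply: h1 => s /andP[s0 s1]; apply: H; apply/andP; split; lra.
have {}h2 : g m + psi (- v) <= g (m - v).
  apply: h2 => s /andP[s0 s1]; rewrite scalerN -scaleNr; apply: H.
  by apply/andP; split; lra.
by have := ps v (- v); rewrite subrr -(scale0r 0) ph // mul0r; lra.
Qed.

Lemma limit_le (p q p' q' : R) : (exists2 e, 0 < e &
  forall t, 0 < t <= e -> p + t * q <= p' + t * q') -> p <= p'.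
Proof.
move=> [e e0 h]; rewrite leNgt; apply/negP => pp.
pose k := Num.min e ((p - p') / (2 * (`|q' - q| + 1))).
have c0 : 0 < 2 * (`|q' - q| + 1) by rewrite mulr_gt0 // ltr_wpDl.
have k0 : 0 < k by rewrite lt_min e0 divr_gt0 // subr_gt0.
have /h : 0 < k <= e by rewrite k0 ge_min lexx.
have : k * (2 * (`|q' - q| + 1)) <= p - p'.
  by rewrite -ler_pdivlMr // ge_min lexx orbT.
have := ler_wpM2l (ltW k0) (ler_norm (q' - q)); lra.
Qed.

(** The determinant [det] is zero where both products are and does not change along [v], so it is
    enough to make it nonzero by moving along [z]. If [v] is orthogonal to [d1] and [d2], it is
    identically zero and a move along [d1] serves instead. *)
Lemma line_off_codim2 d1 d2 m v :
  (forall p q : R, p *: d1 + q *: d2 = 0 -> p = 0 /\ q = 0) ->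
  exists z, exists2 e, 0 < e & forall t, 0 < t <= e -> forall s : R,
    (dot (m + t *: z + s *: v) d1 != 0) || (dot (m + t *: z + s *: v) d2 != 0).
Proof.
move=> indep.
have d10 : d1 != 0.
  apply/eqP => d10; have [] := indep 1 0; last by move/eqP; rewrite oner_eq0.
  by rewrite d10 scaler0 scale0r addr0.
have small (p q : R) : q != 0 -> exists2 e, 0 < e & forall t, 0 < t <= e -> p + t * q != 0.
  move=> q0; have [->|] := eqVneq p 0; last exact: small_neq0.
  by exists 1 => // t /andP[t0 _]; rewrite add0r mulf_neq0 // lt0r_neq0.
have [/andP[/eqP v1 /eqP v2]|v12] := boolP ((dot v d1 == 0) && (dot v d2 == 0)).
  have [|e e0 he] := small (dot m d1) (dot d1 d1); first by rewrite gt_eqF // dot_gt0.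
  exists d1, e => // t /he te s; apply/orP; left.
  by rewrite !dotDl !dotZl v1 mulr0 addr0 te.
pose det w := dot w d1 * dot v d2 - dot w d2 * dot v d1.
have [z z0 detE] : exists2 z, z != 0 & forall w, det w = dot w z.
  exists (dot v d2 *: d1 - dot v d1 *: d2); last first.
    by move=> w; rewrite /det dotBr !dotZr; ring.
  apply/eqP => zE; have [|h1 h2] := indep (dot v d2) (- dot v d1).
    by rewrite scaleNr.
  by move: v12; rewrite -(oppr_eq0 (dot v d1)) h1 h2 eqxx.
have [|e e0 he] := small (det m) (det z); first by rewrite detE gt_eqF // dot_gt0.
exists z, e => // t /he te s; rewrite -negb_and; apply: contra te => /andP[/eqP h1 /eqP h2].
have -> : det m + t * det z = det (m + t *: z + s *: v).
  by rewrite /det !dotDl !dotZl; ring.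
by rewrite /det h1 h2 !mul0r subrr.
Qed.

(* A line can be moved off a subspace of codimension two, so local convexity
   outside of this subspace is enough. *)
Lemma subadd_off_codim2 g d1 d2 : homog g ->
  (forall p q : R, p *: d1 + q *: d2 = 0 -> p = 0 /\ q = 0) ->
  (forall x, exists psi, germ g x psi /\ homog psi) ->
  (forall x, (dot x d1 != 0) || (dot x d2 != 0) ->
     exists psi, [/\ germ g x psi, homog psi & subadd psi]) ->
  subadd g.
Proof.
move=> gh indep gg H x y.
pose m := 2^-1 *: (x + y); pose v := 2^-1 *: (x - y).
have mv : m + v = x by apply/rowP => i; rewrite !mxE; lra.
have mv' : m - v = y by apply/rowP => i; rewrite !mxE; lra.
have [z [e e0 hz]] := line_off_codim2 m v indep.
have mE : g m = 2^-1 * g (x + y) by rewrite gh ?invr_ge0.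
have [pm [gm hm]] := gg m; have [px [gx hx]] := gg x; have [py [gy hy]] := gg y.
have [em /andP[em0 eme] Em] := germ_eps z gm hm e0.
have [ex /andP[ex0 exm] Ex] := germ_eps z gx hx em0.
have [ey /andP[ey0 eyx] Ey] := germ_eps z gy hy ex0.
have : 2 * g m <= g x + g y; last by rewrite mE; lra.
(* Convexity holds on the line through [x] and [y] moved by [t *: z], which avoids the subspace;
   then [t] tends to 0. *)
apply: (@limit_le _ (2 * pm z) _ (px z + py z)); exists ey => // t /andP[t0 te].
have := @midpoint_le g (m + t *: z) v; rewrite addrAC mv addrAC mv'.
rewrite Em ?Ex ?Ey ?(ltW t0) //; try lra.
move=> h; suff : 2 * (g m + t * pm z) <= g x + t * px z + (g y + t * py z) by lra.
apply: h => s _; apply: H; apply: hz; apply/andP; split=> //.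
by lra.
Qed.

Definition collinear E := exists a b, [/\ E a, E b, a != b &
  forall c, E c -> exists l : R, c = a + l *: (b - a)].

Lemma face_face P u w : polytope P -> exists y, face w (face u P) = face y P.
Proof.
move=> Pp; have Fp := polytope_face u Pp; have FFp := polytope_face w Fp.
have [e e0 he] := germ_germ (germ_supf u Pp) (homog_supf Fp) (germ_supf w Fp) (homog_supf FFp).
exists (u + e *: w); apply: polytope_supf => //; first exact: polytope_face.
apply: (germ_uniq (x := u + e *: w) _ (germ_supf _ Pp)).
- by apply: he; rewrite e0 lexx.
- exact: homog_supf.
- exact/homog_supf/polytope_face.
Qed.

Lemma conv_line s a d : s != [::] ->
  (forall c, c \in s -> c - a = (dot (c - a) d / dot d d) *: d) ->
  forall x, conv s x -> x - a = (dot (x - a) d / dot d d) *: d.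
Proof.
move=> s0 h x /(convP _ s0) xs; apply: dot_inj => u.
pose u' := u - (dot u d / dot d d) *: d.
have hu' c : dot u' (c - a) = dot u (c - a) - dot u ((dot (c - a) d / dot d d) *: d).
  by rewrite /u' dotBl dotZl dotZr (dotC d); ring.
have cs c : c \in s -> dot u' c = dot u' a.
  by move=> /h e; apply/eqP; rewrite -subr_eq0 -dotBr hu' -e subrr.
have h1 : dot u' x <= dot u' a.
  by apply: le_trans (xs u') _; apply: hs_le => // c /cs ->.
have h2 : dot (- u') x <= dot (- u') a.
  by apply: le_trans (xs (- u')) _; apply: hs_le => // c /cs e; rewrite !dotNl e.
apply/eqP; rewrite -subr_eq0 -hu' dotBr subr_eq0 eq_le h1.
by rewrite !dotNl lerN2 in h2.
Qed.

Lemma nat_seq (I : eqType) (r : seq I) (Q : nat -> I -> Prop) :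
  (forall i m m', (m <= m')%N -> Q m i -> Q m' i) ->
  (forall i, i \in r -> exists m, Q m i) -> exists m, forall i, i \in r -> Q m i.
Proof.
move=> mono; elim: r => [|i r IH] h; first by exists 0%N.
have [|m hm] := IH; first by move=> j jr; apply: h; rewrite inE jr orbT.
have [m' hm'] := h i (mem_head _ _).
exists (maxn m m') => j; rewrite inE => /predU1P[->|/hm].
  exact: mono (leq_maxr _ _) hm'.
exact: mono (leq_maxl _ _).
Qed.

(** Induction on the number of generators. If they are not collinear, two independent differences
    cut out a subspace of codimension two. Any [x] off it is maximal on fewer generators only, and
    near [x] the support function is that of their hull, to which the induction hypothesis
    applies. *)
Lemma subadd_from_edges h P : subadd h -> homog h ->
  (forall x, exists psi, germ h x psi /\ homog psi) -> polytope P ->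
  (forall y, collinear (face y P) ->
     exists k : nat, subadd (fun u => k%:R * h u - supf (face y P) u)) ->
  exists k : nat, subadd (fun u => k%:R * h u - supf P u).
Proof.
move=> hs_ hh hg [s [s0 ->]]; have [m] := ubnP (size s).
elim: m => // m IH in s s0 * => sm edges.
have sp := polytope_conv s0.
have [/hasP[a ai /hasP[b bi ab]]|const] :=
  boolP (has (fun a => has (fun b => a != b) s) s); last first.
  exists 0%N => x y; rewrite !mul0r !sub0r -opprD lerN2.
  have [a ai _] := hs_in 0 s0.
  have h0 : hs s =1 dot a.
    apply: hs_const => // b bi; apply/eqP; apply: contraR const => ba.
    by apply/hasP; exists b => //; apply/hasP; exists a.
  by rewrite supf_conv // !h0 dotDr.
pose d := b - a; have d0 : d != 0 by rewrite subr_eq0 eq_sym.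
have [/allP line|] := boolP (all (fun c => c - a == (dot (c - a) d / dot d d) *: d) s).
  have e0 : face 0 (conv s) = conv s.
    by apply/face_full => //; rewrite /width oppr0 !supf0 // addr0.
  have := edges 0; rewrite e0; apply; exists a, b; split=> //; try exact: conv_mem.
  move=> c cs; exists (dot (c - a) d / dot d d).
  rewrite -/d -(conv_line (s := s)) //; first by rewrite addrC subrK.
  by move=> c' /line/eqP.
move=> /allPn[c ci ncol].
(* All sublists of [s]: the lists [argmax s x] are among these finitely many, so one [k] serves
   every [x]. *)
pose X := [seq mask (val mk) s | mk <- enum {: (size s).-tuple bool}].
pose Q k (T : seq 'rV[R]_n) := (exists2 x, T = argmax s x & (size T < size s)%N) ->
  subadd (fun u => k%:R * h u - hs T u).
have [||k hk] := @nat_seq _ X Q.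
- move=> T k k' kk hT /hT; rewrite -(subnK kk) => sT.
  apply: subadd_eq (subaddD (subaddZ (ler0n R (k' - k)) hs_) sT) => u.
  by rewrite natrD; ring.
- move=> T _.
  have [[x TE Ts]|nT] := pselect (exists2 x, T = argmax s x & (size T < size s)%N);
    last by exists 0%N => /nT.
  have T0 : T != [::] by rewrite TE; apply: argmax_neq0.
  have [||k hk] := IH T T0.
  + exact: leq_trans Ts _.
  + have TF : conv T = face x (conv s) by rewrite TE face_conv.
    by move=> y; rewrite TF; have [z ->] := face_face x y sp; apply: edges.
  by exists k => _; apply: subadd_eq hk => u; rewrite supf_conv.
exists k; apply: (@subadd_off_codim2 _ d (c - a)).
- by move=> e u e0; rewrite hh // supfZ // mulrBr; congr (_ - _); rewrite mulrCA.
- move=> p q e; have q0 : q = 0.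
    apply/eqP; apply: contraNT ncol => q0.
    have cE : c - a = (- (p / q)) *: d.
      apply: (scalerI q0); rewrite scalerA mulrN mulrCA divff // mulr1 scaleNr.
      by apply/eqP; rewrite -addr_eq0 addrC e.
    by rewrite cE dotZl mulfK ?eqxx // gt_eqF // dot_gt0.
  split=> //; move: e; rewrite q0 scale0r addr0 => /eqP; rewrite scaler_eq0.
  by rewrite (negbTE d0) orbF => /eqP.
- move=> x; have [psi [gp hp]] := hg x.
  exists (fun u => k%:R * psi u + (-1) * supf (face x (conv s)) u); split.
    apply: germ_eq (germD (germZ k%:R gp) (germZ (-1) (germ_supf x sp))) => // u.
    by rewrite mulN1r.
  by apply: homogD; apply: homogZ => //; apply/homog_supf/polytope_face.
move=> x xd; have [psi [gp hp]] := hg x.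
pose T := argmax s x; have T0 : T != [::] by apply: argmax_neq0.
have Tp := polytope_conv T0.
have Ts : (size T < size s)%N.
  rewrite /T /argmax size_filter ltn_neqAle count_size andbT -all_count.
  apply/negP => /allP al; move: xd; rewrite /d !dotBr.
  by rewrite !(eqP (al _ _)) // subrr eqxx.
have TX : T \in X.
  have st : size (map (fun a => dot x a == hs s x) s) == size s by rewrite size_map.
  apply/mapP; exists (Tuple st); first by rewrite mem_enum.
  by rewrite /T /argmax filter_mask.
have Tsub : subadd (fun u => k%:R * h u + (-1) * supf (conv T) u).
  apply: subadd_eq (hk T TX _) => [u|]; last by exists x.
  by rewrite supf_conv // mulN1r.
have TE : conv T = face x (conv s) by rewrite face_conv.
pose phi u := k%:R * psi u + (-1) * supf (conv T) u.
have phih : homog phi by apply: homogD; apply: homogZ => //; apply: homog_supf.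
exists phi; split=> //.
  rewrite /phi TE.
  apply: germ_eq (germD (germZ k%:R gp) (germZ (-1) (germ_supf x sp))) => // u.
  by rewrite mulN1r.
apply: (subadd_germ Tsub (x := x) _ _ phih).
  by apply: homogD; apply: homogZ => //; apply: homog_supf.
apply: germD (germZ k%:R gp) (germZ (-1) _).
(* All of [T] is maximal in direction [x], so [supf (conv T)] is its own germ at [x]. *)
have := germ_supf x Tp; suff -> : face x (conv T) = conv T by [].
apply/face_full => //; rewrite TE; apply/widthP; first exact: polytope_face.
by move=> y z [Py hy] [Pz hz]; apply/eqP; rewrite eq_le hy ?hz.
Qed.

End Summands.

(** * Segments and edge vectors *)

Section Segments.
Variables (R : realType) (n : nat).
Implicit Types (u v w x p : 'rV[R]_n) (E P : set 'rV[R]_n).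

Lemma polytope_segment x u : polytope (conv [:: x; x + u]).
Proof. exact: polytope_conv. Qed.

Lemma edge_vectorN E u : edge_vector E u -> edge_vector E (- u).
Proof.
move=> [u0 [x ->]]; split; first by rewrite oppr_eq0.
exists (x + u); rewrite addrK; apply: conv_eq => // v; apply/eqP; rewrite eq_le.
by apply/andP; split; apply: hs_sub => // c; rewrite !inE orbC.
Qed.

Lemma supf_segment x u v : supf (conv [:: x; x + u]) v = dot x v + Num.max 0 (dot u v).
Proof.
rewrite supf_conv //; have hx := hs_ge v (mem_head x [:: x + u]).
have hu : dot v (x + u) <= hs [:: x; x + u] v by apply: hs_ge; rewrite !inE eqxx orbT.
apply/eqP; rewrite eq_le; apply/andP; split.
  apply: hs_le => // a; rewrite !inE !(dotC _ v) => /orP[]/eqP ->.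
    by rewrite lerDl le_max lexx.
  by rewrite dotDr lerD2l le_max lexx orbT.
by rewrite dotDr in hu; rewrite !(dotC _ v); have [_|_] := leP 0 (dot v u); rewrite ?addr0.
Qed.

Lemma width_segment x u v : width (conv [:: x; x + u]) v = `|dot u v|.
Proof.
rewrite /width !supf_segment !dotNr; have [h|h] := leP 0 (dot u v).
  by rewrite max_l ?oppr_le0 // ger0_norm //; ring.
by rewrite max_r ?oppr_ge0 ?(ltW h) // ltr0_norm //; ring.
Qed.

Lemma collinear_edge E : polytope E -> collinear E -> exists u, edge_vector E u.
Proof.
move=> Ep [a [b [Ea Eb ab line]]]; pose d := b - a.
have d0 : 0 < dot d d by rewrite dot_gt0 // subr_eq0 eq_sym.
have [c1 E1 e1] := supf_in d Ep; have [c0 E0 e0] := supf_in (- d) Ep.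
have top c : E c -> dot d c <= dot d c1 by rewrite -e1; apply: supf_ge.
have bot c : E c -> dot d c0 <= dot d c.
  by move=> Ec; have := supf_ge (- d) Ep Ec; rewrite e0 !dotNl lerN2.
have lt_c : dot d c0 < dot d c1.
  apply: le_lt_trans (bot a Ea) _; apply: lt_le_trans (top b Eb).
  by rewrite -subr_gt0 -dotBr.
have cE : c0 + (c1 - c0) = c1 by rewrite addrC subrK.
exists (c1 - c0); split.
  by apply: contraTneq lt_c => /eqP; rewrite subr_eq0 => /eqP ->; rewrite ltxx.
exists c0; apply: polytope_supf => //; first exact: polytope_segment.
move=> v; rewrite supf_conv ?cE //.
apply/eqP; rewrite eq_le; apply/andP; split; last first.
  apply: hs_le => // c; rewrite !inE => /orP[]/eqP ->; exact: supf_ge.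
have h0 : dot v c0 <= hs [:: c0; c1] v by apply: hs_ge; rewrite mem_head.
have h1 : dot v c1 <= hs [:: c0; c1] v by apply: hs_ge; rewrite !inE eqxx orbT.
apply: supf_le => // c Ec; have [l cl] := line c Ec.
have [l0 cl0] := line c0 E0; have [l1 cl1] := line c1 E1.
have l0l : l0 <= l.
  by have := bot c Ec; rewrite cl cl0 !dotDr !dotZr -/d lerD2l ler_pM2r.
have ll1 : l <= l1.
  by have := top c Ec; rewrite cl cl1 !dotDr !dotZr -/d lerD2l ler_pM2r.
have [vd|vd] := leP 0 (dot v d).
  apply: le_trans h1; rewrite cl cl1 -/d !dotDr !dotZr lerD2l; exact: ler_wpM2r.
apply: le_trans h0; rewrite cl cl0 -/d !dotDr !dotZr lerD2l.
by rewrite ler_wnM2r // ltW.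
Qed.

(** Each endpoint is a face, in the direction of the segment or its opposite, and faces inherit
    integrality. *)
Lemma segment_lattice x u : u != 0 -> lattice_polytope (conv [:: x; x + u]) ->
  exists a b : 'rV[int]_n, x = emb R a /\ u = emb R b.
Proof.
move=> u0 L; have uu := dot_gt0 u0.
have top (y z : 'rV[R]_n) : lattice_polytope (conv [:: y; z]) -> y != z ->
    exists a, z = emb R a.
  move=> yzL yz; have := lattice_face (z - y) yzL.
  have zy : 0 < dot (z - y) (z - y) by rewrite dot_gt0 // subr_eq0 eq_sym.
  have lt_yz : dot (z - y) y < dot (z - y) z by rewrite -subr_gt0 -dotBr.
  have hE : hs [:: y; z] (z - y) = dot (z - y) z.
    apply/eqP; rewrite eq_le hs_ge ?inE ?eqxx ?orbT // andbT.
    by apply: hs_le => // a; rewrite !inE => /orP[]/eqP -> //; apply: ltW.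
  rewrite face_conv // /argmax hE /= eqxx lt_eqF // -set1_conv.
  exact: lattice_point.
have xu : x != x + u by rewrite -subr_eq0 opprD addrA subrr sub0r oppr_eq0.
have [b bE] := top _ _ L xu.
have [||a aE] := top (x + u) x _ _; last 2 first.
- by rewrite eq_sym.
- by exists a, (b - a); rewrite embB -bE -aE addrC addKr.
suff <- : conv [:: x; x + u] = conv [:: x + u; x] by [].
apply: conv_eq => // v; apply/eqP; rewrite eq_le.
by apply/andP; split; apply: hs_sub => // c; rewrite !inE orbC.
Qed.

Lemma subadd_max u : subadd (fun v => Num.max 0 (dot u v)).
Proof.
apply: subadd_eq (subadd_supf (polytope_segment 0 u)) => v.
by rewrite supf_segment dot0l add0r.
Qed.

(** For [l < 0] the identity max(0, l t) = - l max(0, t) + l t shows that reversing a segment only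
    translates it, so any [k] at least the absolute value of [l] works in both cases; [q] collects
    the translations. *)
Lemma subadd_parallel_segments x u p w (l : R) : u = l *: w ->
  exists k : nat,
    subadd (fun v => k%:R * supf (conv [:: p; p + w]) v - supf (conv [:: x; x + u]) v).
Proof.
move=> ul; pose k := Num.bound `|l|; exists k.
have kl : `|l| <= k%:R by rewrite ltW // archi_boundP.
have kl0 : 0 <= k%:R - `|l| by rewrite subr_ge0.
pose q := k%:R *: p - x + (if 0 <= l then 0 else `|l| *: w).
apply: subadd_eq (subaddD (subaddZ kl0 (subadd_max w)) (subadd_dot q)) => v.
rewrite !supf_segment ul dotZl /q !dotDl dotNl dotZl.
have [l0|l0] := leP 0 l.
  have -> : Num.max 0 (l * dot w v) = l * Num.max 0 (dot w v) by rewrite maxr_pMr // mulr0.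
  by rewrite ger0_norm // dot0l; ring.
rewrite ltr0_norm // dotZl.
have -> : Num.max 0 (l * dot w v) = - l * Num.max 0 (dot w v) + l * dot w v.
  have [h|h] := leP 0 (dot w v).
    by rewrite max_l ?nmulr_rle0 //; ring.
  by rewrite max_r ?mulr0 ?add0r // ltW // nmulr_rgt0.
by ring.
Qed.

End Segments.

(** * Facet normals *)

Section IntegerVectors.
Variable n : nat.
Implicit Types (u v w a b : 'rV[int]_n).

Definition idot u v : int := \sum_i u ord0 i * v ord0 i.

Lemma dot_emb (R : realType) u v : dot (emb R u) (emb R v) = (idot u v)%:~R.
Proof.
by rewrite /idot rmorph_sum /=; apply: eq_bigr => i _; rewrite !mxE rmorphM.
Qed.

Lemma idotDl u v w : idot (u + v) w = idot u w + idot v w.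
Proof. by rewrite -big_split; apply: eq_bigr => i _; rewrite mxE mulrDl. Qed.

Lemma idotZl (c : int) u w : idot (c *: u) w = c * idot u w.
Proof. by rewrite big_distrr; apply: eq_bigr => i _ /=; rewrite mxE mulrA. Qed.

Lemma idotNl u w : idot (- u) w = - idot u w.
Proof. by rewrite -scaleN1r idotZl mulN1r. Qed.

Lemma idotBr u v w : idot w (u - v) = idot w u - idot w v.
Proof. by rewrite -sumrB; apply: eq_bigr => i _; rewrite !mxE mulrBr. Qed.

Lemma idotC u v : idot u v = idot v u.
Proof. by apply: eq_bigr => i _; rewrite mulrC. Qed.

(** A large multiple of [u] is rounded down. Rounding changes the product with [d] by at most the
    sum of the absolute values of its entries, and [N] is chosen to beat this for all [d] in [D]. *)
Lemma integral_direction (R : realType) (u : 'rV[R]_n) (D : seq 'rV[R]_n) :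
  (forall d, d \in D -> 0 < dot u d) ->
  exists w : 'rV[int]_n, forall d, d \in D -> 0 < dot (emb R w) d.
Proof.
move=> uD; have [||N hN] := @nat_seq _ D (fun N d => \sum_i `|d ord0 i| < N%:R * dot u d).
- move=> d m m' mm; have [ud|ud] := leP 0 (dot u d).
    by move=> h; apply: lt_le_trans h _; rewrite ler_wpM2r // ler_nat.
  move=> h; have : 0 <= \sum_i `|d ord0 i| by apply: sumr_ge0.
  by have := ler_wpM2l (ler0n R m) (ltW ud); rewrite mulr0; lra.
- move=> d dD; have d0 := uD d dD.
  exists (Num.bound (\sum_i `|d ord0 i| / dot u d)); rewrite -ltr_pdivrMr // mulr_suml.
  by apply: archi_boundP; apply: sumr_ge0 => i _; rewrite divr_ge0 // ltW.
exists (\row_i Num.floor (N%:R * u ord0 i)) => d dD.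
suff : N%:R * dot u d - \sum_i `|d ord0 i| <=
    dot (emb R (\row_i Num.floor (N%:R * u ord0 i))) d.
  by have := hN d dD; lra.
rewrite mulr_sumr -sumrB; apply: ler_sum => i _; rewrite !mxE mulrA.
have /andP[f1 f2] := floor_itv (N%:R * u ord0 i); rewrite intrD in f2.
set f := (Num.floor _)%:~R in f1 f2 *; set p := _ * u ord0 i in f1 f2 *.
rewrite lerBlDl -lerBlDr -mulrBl; apply: le_trans (ler_norm _) _.
rewrite normrM -[leRHS]mul1r ler_wpM2r // ger0_norm ?subr_ge0 //.
by rewrite lerBlDl ltW // addrC.
Qed.

Lemma primitive_part v : v != 0 ->
  exists (g : nat) v', [/\ (0 < g)%N, v = g%:Z *: v' & primitive v'].
Proof.
move=> v0; pose g := \big[gcdn/0%N]_i `|v ord0 i|%N; exists g.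
have gd i : (g %| `|v ord0 i|)%N by apply: (biggcdn_inf i).
have g0 : (0 < g)%N.
  rewrite lt0n; apply: contra v0 => /eqP g0; apply/eqP/rowP => i.
  by have := gd i; rewrite g0 dvd0n absz_eq0 mxE => /eqP.
have vE i : v ord0 i = g%:Z * (sgz (v ord0 i) * (`|v ord0 i| %/ g)%N%:Z).
  by rewrite mulrCA -PoszM mulnC divnK // -intEsg.
exists (\row_i (sgz (v ord0 i) * (`|v ord0 i| %/ g)%N%:Z)); split=> //.
  by apply/rowP => i; rewrite !mxE.
rewrite /primitive; apply/eqP; rewrite -(eqn_pmul2l g0) muln1.
rewrite (big_morph (muln g) (muln_gcdr g) (muln0 g)); apply/eqP.
apply: eq_bigr => i _; rewrite mxE.
by rewrite [RHS](congr1 absz (vE i)) !abszM.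
Qed.

Lemma clear_denominators (x : 'rV[rat]_n) : exists (N : int) w,
  0 < N /\ forall i, (w ord0 i)%:~R = N%:~R * x ord0 i :> rat.
Proof.
exists (\prod_j denq (x ord0 j)).
exists (\row_i (numq (x ord0 i) * \prod_(j | j != i) denq (x ord0 j))).
split; first by apply: prodr_gt0 => i _; apply: denq_gt0.
move=> i; rewrite mxE [X in _ = X%:~R * _](bigD1 i) //= !intrM.
rewrite -{3}(divq_num_den (x ord0 i)); have d0 : (denq (x ord0 i))%:~R != 0 :> rat.
  by rewrite intr_eq0 denq_neq0.
by field.
Qed.

End IntegerVectors.

(** * Dimension of a lattice polytope as the rank of a rational matrix *)

Section AffineRank.
Variables (R : realType) (n : nat).
Implicit Types (s : seq 'rV[int]_n) (a b : 'rV[int]_n).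

(** The entries are rational so that a functional vanishing on the row space can be scaled to an
    integral one; the rank is the same over [R]. *)
Definition dmx s a : 'M[rat]_(size s, n) := \matrix_(i, j) (s`_i ord0 j - a ord0 j)%:~R.

Lemma row_dmx s a i : row i (dmx s a) = map_mx intr (s`_i - a).
Proof. by apply/rowP => j; rewrite !mxE. Qed.

Lemma emb_dmx s a (i : 'I_(size s)) :
  emb R s`_i - emb R a = row i (map_mx ratr (dmx s a)).
Proof. by apply/rowP => j; rewrite !mxE ratr_int intrB. Qed.

(** Differences of points of the hull lie in the row space, which bounds the number of affinely
    independent points; a maximal free set of rows, together with [a], attains the bound. *)
Lemma pdim_conv s a : a \in s -> pdim (conv [seq emb R b | b <- s]) = \rank (dmx s a).
Proof.
move=> as_; set A := dmx s a; have rA : \rank (map_mx ratr A : 'M[R]_(_, _)) = \rank A.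
  exact: mxrank_map.
apply/eqP; rewrite eqn_leq; apply/andP; split.
  apply/bigmax_leqP => k /asboolP[p [pP]]; rewrite -rA => /eqP <-.
  apply: mxrankS; apply/row_subP => i.
  have sub (x : 'rV[R]_n) : conv [seq emb R b | b <- s] x ->
      (x - emb R a <= (map_mx ratr A : 'M[R]_(_, _)))%MS.
    move=> /conv_idx[l]; rewrite size_map => -[l0 l1 ->].
    rewrite -[emb R a]scale1r -l1 scaler_suml -sumrB; apply: summx_sub => j _.
    rewrite (nth_map 0) // -scalerBr emb_dmx; apply: scalemx_sub; exact: row_sub.
  have -> : row i (\matrix_(i < k) (p (fintype.lift ord0 i) - p ord0)) =
      (p (fintype.lift ord0 i) - emb R a) - (p ord0 - emb R a).
    by rewrite rowK opprB addrA subrK.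
  by apply: addmx_sub; rewrite ?eqmx_opp; apply: sub.
have rn : (\rank A < n.+1)%N by rewrite ltnS rank_leq_col.
pose f := maxrankfun A.
pose p (j : 'I_(\rank A).+1) := if unlift ord0 j is Some i then emb R s`_(f i) else emb R a.
apply: (@leq_bigmax_cond _ _ (fun k : 'I_n.+1 => k : nat) (Ordinal rn)).
apply/asboolP; exists p; split=> [j|] /=.
  rewrite /p; case: unlift => [i|]; apply: conv_mem; apply: map_f => //.
  exact: mem_nth.
have -> : \matrix_(i < \rank A) (p (fintype.lift ord0 i) - p ord0) =
    map_mx ratr (rowsub f A).
  apply/row_matrixP => i; rewrite rowK /p liftK unlift_none emb_dmx.
  by apply/rowP => j; rewrite !mxE.
by rewrite row_free_map maxrowsub_free.
Qed.

End AffineRank.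

(** * Turning integral directions into facet normals *)

Section Facets.
Variables (R : realType) (n : nat) (s : seq 'rV[int]_n).
Hypothesis s_neq0 : s != [::].
Implicit Types (u v w : 'rV[int]_n) (a b c : 'rV[int]_n).

Let M := conv [seq emb R a | a <- s].

Let Mp : polytope M.
Proof. exact/polytope_conv/map_emb_neq0. Qed.

Definition act u a := (a \in s) && all (fun b => idot u b <= idot u a) s.

Definition flat u := all (act u) s.

(** The dimension condition of [Hrows] alone; primitivity is restored at the end of
    [facet_separates]. *)
Definition facet u := (pdim (face (emb R u) M)).+1 = pdim M.

Lemma actP u a : reflect (a \in s /\ forall b, b \in s -> idot u b <= idot u a) (act u a).
Proof. by apply: (iffP andP) => -[h /allP k]. Qed.

Lemma act_eq u a b : act u a -> act u b -> idot u a = idot u b.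
Proof.
by move=> /actP[ai ha] /actP[bi hb]; apply/eqP; rewrite eq_le hb // ha.
Qed.

Lemma act_supf u a : act u a -> supf M (emb R u) = (idot u a)%:~R.
Proof.
move=> /actP[ai ha]; rewrite supf_conv ?map_emb_neq0 //; apply/eqP.
rewrite eq_le -dot_emb hs_ge ?map_f // andbT.
apply: hs_le; first exact: map_emb_neq0.
by move=> _ /mapP[b bi ->]; rewrite !dot_emb ler_int ha.
Qed.

Lemma face_act u : face (emb R u) M = conv [seq emb R a | a <- filter (act u) s].
Proof.
rewrite face_conv ?map_emb_neq0 // argmax_emb; congr (conv (map _ _)).
apply: eq_in_filter => a ai; rewrite -supf_conv ?map_emb_neq0 //.
apply/eqP/idP => [e|/act_supf ->]; last by rewrite dot_emb.
apply/actP; split=> // b bi; rewrite -(ler_int R) -!dot_emb e.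
by apply: supf_ge => //; apply: conv_mem; apply: map_f.
Qed.

Lemma act_ex u : exists a, act u a.
Proof.
have [a ai aE] := hs_in (emb R u) (map_emb_neq0 R s_neq0).
move: ai aE => /mapP[b bi ->] e; exists b; apply/actP; split=> // c ci.
by rewrite -(ler_int R) -!dot_emb -e hs_ge // map_f.
Qed.

Lemma flat_width u : flat u <-> width M (emb R u) = 0.
Proof.
rewrite -(face_full _ Mp) face_act; split=> [fu|e].
  by rewrite (eq_in_filter (a2 := predT)) ?filter_predT // => a /(allP fu).
apply/allP => a ai; apply/actP; split=> // b bi.
have : (face (emb R u) M) (emb R a).
  by rewrite face_act e; apply: conv_mem; apply: map_f.
by move=> [_ /(_ (emb R b))]; rewrite !dot_emb ler_int; apply; apply: conv_mem; apply: map_f.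
Qed.

(** Turning [u] towards [w] until a new point becomes maximal. A ratio test picks [c] minimizing the
    loss under [u] per gain under [w]; the coefficients [om c] and [gap c] put [c] level with the
    old maximizers. *)
Lemma push u w a0 : act u a0 -> (forall a, act u a -> idot w a = idot w a0) ->
  (exists2 b, b \in s & idot w a0 < idot w b) ->
  exists p q c, [/\ 0 < p, 0 < q, forall a, act u a -> act (p *: u + q *: w) a,
     act (p *: u + q *: w) c & ~~ act u c].
Proof.
move=> ua0 wE [b0 b0s b0w].
pose gap a := idot u a0 - idot u a; pose om a := idot w a - idot w a0.
(* Negated, because [bigmax_in] finds a maximum. *)
pose F a : R := - ((gap a)%:~R / (om a)%:~R).
pose r := [seq a <- s | 0 < om a].
have b0r : b0 \in r by rewrite mem_filter subr_gt0 b0w.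
have [c cr cE] := bigmax_in F b0r.
have {cE} cmin a : a \in r -> gap c * om a <= gap a * om c.
  move=> ar; have := bigmax_ge F (F b0) ar; rewrite cE /F lerN2.
  move: ar cr; rewrite !mem_filter => /andP[oma _] /andP[omc _].
  rewrite ler_pdivrMr ?ltr0z // mulrAC ler_pdivlMr ?ltr0z //.
  by rewrite -!intrM ler_int.
have [cs c0] : c \in s /\ 0 < om c by move: cr; rewrite mem_filter => /andP[].
have nc : ~~ act u c.
  by apply/negP => /wE e; move: c0; rewrite /om e subrr ltxx.
have gap_ge0 a : a \in s -> 0 <= gap a.
  by move=> ai; rewrite subr_ge0; case/actP: ua0 => _; apply.
have gap_c : 0 < gap c.
  rewrite lt_neqAle gap_ge0 // andbT eq_sym subr_eq0; apply: contra nc => /eqP e.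
  by apply/actP; split=> // b bi; rewrite -e; case/actP: ua0 => _; apply.
have uE a : idot (om c *: u + gap c *: w) a =
    idot (om c *: u + gap c *: w) a0 - (om c * gap a - gap c * om a).
  by rewrite !idotDl !idotZl /om /gap; ring.
have top a : a \in s -> om c * gap a = gap c * om a -> act (om c *: u + gap c *: w) a.
  move=> ai e; apply/actP; split=> // b bi; rewrite (uE a) (uE b) e subrr subr0.
  rewrite gerBl subr_ge0.
  have [b_pos|b_neg] := ltP 0 (om b).
    by rewrite [leRHS]mulrC cmin // mem_filter b_pos.
  by apply: le_trans (mulr_ge0_le0 (ltW gap_c) b_neg) _; rewrite mulr_ge0 ?gap_ge0 // ltW.
exists (om c), (gap c), c; split=> //; last by apply: top => //; rewrite mulrC.
move=> a au; apply: top; first by case/actP: au.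
by rewrite /om /gap (wE a) // (act_eq au ua0) !subrr !mulr0.
Qed.

Definition splits u := exists N p q u1 u2,
  [/\ [/\ 0 < N, 0 < p, 0 < q & N *: u = p *: u1 + q *: u2],
   forall a, act u a -> act u1 a && act u2 a,
   exists2 c, act u1 c & ~~ act u c & exists2 c, act u2 c & ~~ act u c].

(** If [w] takes values on both sides of its value on the face, pushing [u] along [w] and along
    [- w] gives two directions that combine to a multiple of [u]. Otherwise [- w] is itself maximal
    on the face, and also at [k], so its face is larger. *)
Lemma split_along u w a0 k : act u a0 -> (forall a, act u a -> idot w a = idot w a0) ->
  k \in s -> ~~ act u k -> idot w k = idot w a0 ->
  (exists2 b, b \in s & idot w a0 < idot w b) -> splits u.
Proof.
move=> ua0 wE ks nk wk hb; have [p [q [c [p0 q0 sub1 c1 nc1]]]] := push ua0 wE hb.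
have [/hasP[b bs bw]|/hasPn low] := boolP (has (fun b => idot w b < idot w a0) s).
  have [||p' [q' [c' [p'0 q'0 sub2 c2 nc2]]]] := push (w := - w) ua0 _ _.
  - by move=> a /wE e; rewrite !idotNl e.
  - by exists b; rewrite // !idotNl ltrN2.
  exists (q' * p + q * p'), q', q, (p *: u + q *: w), (p' *: u + q' *: - w).
  split; [split=> //|by move=> a au; rewrite sub1 ?sub2|by exists c|by exists c'].
    by rewrite addr_gt0 // mulr_gt0.
  by apply/rowP => i; rewrite !mxE; ring.
exists p, 1, q, (p *: u + q *: w), (- w); split.
- by split=> //; apply/rowP => i; rewrite !mxE; ring.
- move=> a au; rewrite sub1 //=; case/actP: (au) => ai _; apply/actP; split=> // b bi.
  by rewrite !idotNl lerN2 (wE a) // leNgt low.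
- by exists c.
exists k => //; apply/actP; split=> // b bi.
by rewrite !idotNl lerN2 wk leNgt low.
Qed.

(** If the directions of the face together with [k - a0] span all directions of [s], the face has
    codimension one. If not, some integral [w] vanishes on the former but not on all of [s], and [u]
    splits along it. *)
Lemma facet_or_splits u : ~~ flat u -> facet u \/ splits u.
Proof.
move=> /allPn[k ks nk]; have [a0 ua0] := act_ex u.
pose T := filter (act u) s.
have a0s : a0 \in s by case/actP: ua0.
have a0T : a0 \in T by rewrite mem_filter ua0.
pose q d : 'rV[rat]_n := map_mx intr d.
pose A := dmx T a0; pose B := dmx s a0.
have inB a : a \in s -> (q (a - a0) <= B)%MS.
  move=> ai; have ia : (index a s < size s)%N by rewrite index_mem.
  by rewrite (_ : q _ = row (Ordinal ia) B) ?row_sub // row_dmx /= nth_index.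
have AB : (A <= B)%MS.
  apply/row_subP => i; rewrite row_dmx; apply: inB.
  by have : T`_i \in T by [rewrite mem_nth]; rewrite mem_filter => /andP[].
have qM d (C : 'cV[rat]_n) (e : 'rV[int]_n) : C = (q e)^T ->
    (q d *m C) = ((idot d e)%:~R)%:M.
  move=> ->; apply/matrixP => i j; rewrite !ord1 !mxE eqxx mulr1n /idot rmorph_sum /=.
  by apply: eq_bigr => l _; rewrite !mxE rmorphM.
have ltAB : (\rank A < \rank B)%N.
  rewrite (ltn_leqif (mxrank_leqif_sup AB)); apply: contra nk => BA.
  have Au : A *m (q u)^T = 0.
    apply/row_matrixP => i; rewrite row_mul row_dmx (qM _ _ u) // row0 idotC.
    have : T`_i \in T by rewrite mem_nth.
    rewrite mem_filter => /andP[iu _].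
    by rewrite idotBr (act_eq iu ua0) subrr -scalemx1 scale0r.
  have : q (k - a0) *m (q u)^T = 0.
    have /submxP[D ->] := submx_trans (inB k ks) BA.
    by rewrite -mulmxA Au mulmx0.
  rewrite (qM _ _ u) // idotC idotBr => /matrixP/(_ ord0 ord0).
  rewrite !mxE eqxx mulr1n => /eqP; rewrite intr_eq0 subr_eq0 => /eqP e.
  by apply/actP; split=> // b bi; rewrite e; case/actP: ua0 => _; apply.
pose C := (A + q (k - a0))%MS.
have [BC|/row_subPn[i]] := boolP (B <= C)%MS.
  left; rewrite /facet face_act (pdim_conv R a0T) (pdim_conv R a0s).
  apply/eqP; rewrite eqn_leq ltAB /=; apply: leq_trans (mxrankS BC) _.
  apply: leq_trans (mxrank_adds_leqif A (q (k - a0))).1 _.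
  by apply: leq_trans (leq_add (leqnn _) (rank_leq_row _)) _; rewrite addn1.
rewrite submxE row_dmx => nz; right.
have [j nzj] : exists j, (map_mx intr (s`_i - a0) *m cokermx C) ord0 j != 0.
  apply/existsP; apply: contraNT nz; rewrite negb_exists => /forallP h.
  by apply/eqP/rowP => j; rewrite [RHS]mxE; apply/eqP; rewrite -[_ == _]negbK.
(* A column of the cokernel of [C] is a functional vanishing on [C]; column [j] is nonzero on the
   [i]th difference. *)
have [N [w [N0 wE]]] := clear_denominators (col j (cokermx C))^T.
have wd d : (idot w d)%:~R = N%:~R * (q d *m cokermx C) ord0 j.
  rewrite /idot rmorph_sum mxE mulr_sumr; apply: eq_bigr => l _.
  by rewrite /= rmorphM /= wE !mxE /=; ring.
have wC a : (q (a - a0) <= C)%MS -> idot w a = idot w a0.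
  rewrite submxE => /eqP e; apply/eqP; rewrite -subr_eq0 -idotBr -(intr_eq0 rat).
  by rewrite wd e mxE mulr0.
have wT a : act u a -> idot w a = idot w a0.
  move=> au; have aT : a \in T by rewrite mem_filter au; case/actP: au.
  have ia : (index a T < size T)%N by rewrite index_mem.
  apply: wC.
  have -> : q (a - a0) = row (Ordinal ia) A by rewrite row_dmx /= nth_index.
  exact: submx_trans (row_sub _ _) (addsmxSl _ _).
have wk : idot w k = idot w a0 by apply: wC; apply: addsmxSr.
have wi : idot w s`_i != idot w a0.
  rewrite -subr_eq0 -idotBr -(intr_eq0 rat) wd mulf_neq0 //.
  by rewrite intr_eq0 gt_eqF.
have [lt_w|lt_w|e] := ltgtP (idot w s`_i) (idot w a0); last by rewrite e eqxx in wi.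
  apply: (split_along (w := - w) ua0 _ ks nk).
  - by move=> a /wT e; rewrite !idotNl e.
  - by rewrite !idotNl wk.
  - by exists s`_i; rewrite ?mem_nth // !idotNl ltrN2.
by apply: (split_along ua0 wT ks nk wk); exists s`_i; rewrite ?mem_nth.
Qed.

(** Every split enlarges the active set, so following the part that inherits [Pr] must stop. The
    common maximizer passed to the hypothesis records that [supf M] is additive on the two parts. *)
Lemma facet_ind (Pr : 'rV[int]_n -> Prop) :
  (forall N p q u u1 u2, 0 < N -> 0 < p -> 0 < q -> N *: u = p *: u1 + q *: u2 ->
     (exists2 a, act u1 a & act u2 a) -> Pr u -> Pr u1 \/ Pr u2) ->
  forall u, Pr u -> exists2 v, Pr v & facet v \/ flat v.
Proof.
move=> split_Pr u; have [m] := ubnP (size s - count (act u) s).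
elim: m => // m IH in u * => um Pu.
have [fu|nfu] := boolP (flat u); first by exists u => //; right.
have [fu|] := facet_or_splits nfu; first by exists u => //; left.
move=> [N [p [q [u1 [u2 [[N0 p0 q0 E] sub [c1 c1a c1n] [c2 c2a c2n]]]]]]].
have [a ua] := act_ex u; have /andP[ua1 ua2] := sub a ua.
have lt_m v c : (forall a, act u a -> act v a) -> act v c -> ~~ act u c ->
    (size s - count (act v) s < m)%N.
  move=> sv vc nc; apply: leq_trans (_ : (size s - count (act u) s <= m)%N); last first.
    by rewrite -ltnS.
  have cs : c \in s by case/actP: vc.
  have lt_c := @ltn_count _ (act u) (act v) s c sv cs vc nc.
  by rewrite ltn_sub2l // (leq_trans lt_c) // count_size.
have [P1|P2] := split_Pr _ _ _ _ _ _ N0 p0 q0 E (ex_intro2 _ _ a ua1 ua2) Pu.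
  by apply: (IH u1) => //; apply: (lt_m _ c1) => // b /sub/andP[].
by apply: (IH u2) => //; apply: (lt_m _ c2) => // b /sub/andP[].
Qed.

Lemma facet_exists : (exists u, ~~ flat u) -> exists v, facet v.
Proof.
move=> [u nu]; have [|v nv [fv|fv]] := @facet_ind (fun u => ~~ flat u) _ u nu.
- move=> N p q w u1 u2 N0 _ _ E _; have [f1|] := boolP (flat u1); last by left.
  have [f2|] := boolP (flat u2); last by right.
  move=> /negP[]; apply/allP => a ai; apply/actP; split=> // b bi.
  rewrite -(ler_pM2l N0) -!idotZl E !idotDl !idotZl.
  rewrite (act_eq (allP f1 _ ai) (allP f1 _ bi)).
  by rewrite (act_eq (allP f2 _ ai) (allP f2 _ bi)).
- by exists v.
- by rewrite fv in nv.
Qed.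

Section Separation.
Variables (P T : set 'rV[R]_n) (k : R) (x : 'rV[R]_n).
Hypothesis Pp : polytope P.
Hypothesis Tp : polytope T.
Hypothesis PT : forall y, supf P y + supf T y = k * supf M y.

Let sep u := supf P (emb R u) < dot (emb R u) x.

(** On directions with a common maximizer [supf M] is additive and [supf T] subadditive, so [supf P]
    is superadditive. If neither part of a split separated [x] from [P], their combination would not
    either. *)
Lemma facet_separates : (exists u, ~~ flat u) -> ~ P x -> exists v : Hrows M,
  supf P (emb R (val v)) < dot (emb R (val v)) x.
Proof.
move=> nf nPx.
have [u0 u0x] : exists y, supf P y < dot y x.
  apply: contrapT => h; apply: nPx; apply/(in_polytope _ Pp) => y.
  by rewrite leNgt; apply/negP => yx; apply: h; exists y.
have [u su] : exists u, sep u.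
  have [r [r0 rE]] := Pp; move: u0x; rewrite /sep rE supf_conv // => u0x.
  have [|u hu] := @integral_direction _ R u0 [seq x - y | y <- r].
    by move=> _ /mapP[a ar ->]; rewrite dotBr subr_gt0 (le_lt_trans _ u0x) // hs_ge.
  exists u; have [a ar ->] := hs_in (emb R u) r0.
  by rewrite -subr_gt0 -dotBr; apply/hu/map_f.
have [|v sv fv] := @facet_ind sep _ u su.
  move=> N p q w u1 u2 N0 p0 q0 E [a a1 a2] sw.
  have aw : act w a.
    case/actP: a1 a2 => ai h1 /actP[_ h2]; apply/actP; split=> // b bi.
    rewrite -(ler_pM2l N0) -!idotZl E !idotDl !idotZl.
    by rewrite lerD // ler_pM2l // ?h1 ?h2.
  have N0R : 0 < N%:~R :> R by rewrite ltr0z.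
  have p0R : 0 < p%:~R :> R by rewrite ltr0z.
  have q0R : 0 < q%:~R :> R by rewrite ltr0z.
  have ER : N%:~R *: emb R w = p%:~R *: emb R u1 + q%:~R *: emb R u2.
    by rewrite -!embMz -embD E.
  have ME : N%:~R * supf M (emb R w) =
      p%:~R * supf M (emb R u1) + q%:~R * supf M (emb R u2).
    rewrite (act_supf aw) (act_supf a1) (act_supf a2).
    by rewrite -!rmorphM -rmorphD /= -!idotZl E idotDl.
  have sub Q : polytope Q -> N%:~R * supf Q (emb R w) <=
      p%:~R * supf Q (emb R u1) + q%:~R * supf Q (emb R u2).
    by move=> Qp; rewrite -!supfZ ?(ltW N0R) ?(ltW p0R) ?(ltW q0R) // ER; apply: supfD.
  have hT := sub T Tp.
  have [s1|n1] := ltP (supf P (emb R u1)) (dot (emb R u1) x); first by left.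
  have [s2|n2] := ltP (supf P (emb R u2)) (dot (emb R u2) x); first by right.
  exfalso; have := congr1 (fun y => dot y x) ER; rewrite /= dotDl !dotZl => Ex.
  have h0 : N%:~R * supf P (emb R w) < N%:~R * dot (emb R w) x by rewrite ltr_pM2l.
  have h1 := ler_wpM2l (ltW p0R) n1; have h2 := ler_wpM2l (ltW q0R) n2.
  have := congr1 ( *%R k) ME; rewrite mulrDr ![k * (_ * _)]mulrCA -!PT !mulrDr.
  lra.
have [v' [fv' sv']] : exists v', facet v' /\ sep v'.
  case: fv => [fv|fv]; first by exists v.
  (* A separating direction constant on [M] is not a row of H, but a large multiple of it added to a
     facet normal keeps the facet and makes the sum separate. *)
  have [v0 fv0] := facet_exists nf.
  have d0 : 0 < dot (emb R v) x - supf P (emb R v) by rewrite subr_gt0.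
  pose K := Num.bound (`|supf P (emb R v0) - dot (emb R v0) x| /
    (dot (emb R v) x - supf P (emb R v))).
  have EK : emb R (v0 + K%:Z *: v) = emb R v0 + K%:R *: emb R v by rewrite embD embMz.
  exists (v0 + K%:Z *: v); split.
    rewrite /facet (_ : face _ M = face (emb R v0) M) //; apply: face_ext => //.
    rewrite EK [X in X - _]addrC addrK /width -scalerN !supfZ // -mulrDr.
    by move/flat_width: fv; rewrite /width => ->; rewrite mulr0.
  rewrite /sep EK; apply: le_lt_trans (supfD _ _ Pp) _.
  rewrite supfZ // dotDl dotZl -subr_gt0.
  have : `|supf P (emb R v0) - dot (emb R v0) x| < K%:R * (dot (emb R v) x - supf P (emb R v)).
    by rewrite -ltr_pdivrMr // archi_boundP // divr_ge0 // ltW.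
  by have := ler_norm (supf P (emb R v0) - dot (emb R v0) x); lra.
have v'0 : v' != 0.
  apply/eqP => v'0; move: fv'; rewrite /facet v'0 emb0.
  have /face_full -> // : width M 0 = 0 by rewrite /width oppr0 supf0 // addr0.
  by move=> /esym /n_Sn.
have [g [v1 [g0 vE v1prim]]] := primitive_part v'0.
have g0R : 0 < g%:R :> R by rewrite ltr0n.
have EE : emb R v' = g%:R *: emb R v1 by rewrite vE embMz.
have H1 : Hrows M v1.
  split=> //; move: fv'; rewrite /facet EE.
  suff -> : face (g%:R *: emb R v1) M = face (emb R v1) M by [].
  apply/seteqP; split=> y [My hy]; split=> // z Mz; have := hy z Mz;
  by rewrite !dotZl ler_pM2l.
exists (SigSub (mem_set H1)) => /=.
by move: sv'; rewrite /sep EE supfZ ?ltW // dotZl ltr_pM2l.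
Qed.

End Separation.
End Facets.

(** * Factorization over S *)

Section RightHandSides.
Variables (R : realType) (n : nat).
Implicit Types (M P : set 'rV[R]_n).

(** The values of the support function are below any right-hand side describing [P] and describe [P]
    as well, so minimality forces them. *)
Lemma is_bHE M P (b : Hrows M -> R) : polytope P -> @is_bH R n M P b ->
  forall v, b v = supf P (emb R (val v)).
Proof.
move=> Pp [eP bmin] v; have le_b w : supf P (emb R (val w)) <= b w.
  by apply: supf_le => // x; rewrite {1}eP; apply.
apply/eqP; rewrite eq_le le_b andbT.
apply: (bmin (fun w => supf P (emb R (val w)))); apply/seteqP; split=> x.
  by move=> Px w; apply: supf_ge.
by move=> h; rewrite eP => w; apply: le_trans (h w) (le_b w).
Qed.

Lemma bH_cases M P : @is_bH R n M P (bH M P) \/ forall v, bH M P v = 0.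
Proof. by rewrite /bH; case: xgetP => [b _ h|_]; [left | right]. Qed.

End RightHandSides.

Section Hierarchy.
Variables (R : realType) (n : nat) (S : {fset set 'rV[R]_n}).
Hypothesis S_lattice : forall P, P \in S -> lattice_polytope P.
Hypothesis S_basis : basis S.
Hypothesis S_hier : hierarchical S.
Implicit Types (u v x z : 'rV[R]_n) (P Q C : set 'rV[R]_n) (phi psi : 'rV[R]_n -> R).
Implicit Types (y : set 'rV[R]_n -> int).

Let S_polytope P : P \in S -> polytope P.
Proof. by move=> /S_lattice/lattice_polytopeW. Qed.

(** The junk value would be the zero vector, which cannot belong to a basis. *)
Lemma bH_S P (w : Hrows (Stotal S)) : P \in S ->
  bH (Stotal S) P w = supf P (emb R (val w)).
Proof.
move=> PS; have [/is_bHE|junk] := bH_cases (Stotal S) P.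
  by move=> /(_ (S_polytope PS)).
have [/(_ (fun Q => (Q == P)%:Z)) h _] := S_basis.
have /(_ P PS) : forall Q, Q \in S -> (Q == P)%:Z = 0 :> int; last by rewrite eqxx.
apply: h; exists 0 => w'; rewrite emb0 dot0r add0r.
rewrite (eq_bigr (fun Q => (Q == P)%:R * bH (Stotal S) Q w')) => [|Q _].
  by rewrite (sum_delta (fun Q => bH (Stotal S) Q w')).
by rewrite -pmulrn.
Qed.

(** At the rows of H the difference of two expansions is a relation between the b^H modulo a lattice
    translation, so freeness makes its coefficients zero. *)
Lemma expands_uniq phi y y' P : expands S phi y -> expands S phi y' ->
  P \in S -> y P = y' P.
Proof.
move=> [t h] [t' h'] PS; apply/eqP; rewrite -subr_eq0; apply/eqP; move: P PS.
have [+ _] := S_basis; apply; exists (t' - t) => v; rewrite add0r.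
have := h (emb R (val v)); rewrite h' embB dotBr -!(dotC (emb R (val v))) => e.
have -> : \sum_(P <- S) (y P - y' P)%:~R * bH (Stotal S) P v =
    \sum_(P <- S) (y P)%:~R * supf P (emb R (val v)) -
    \sum_(P <- S) (y' P)%:~R * supf P (emb R (val v)).
  rewrite -sumrB; apply: eq_big_seq => P PS; rewrite bH_S // intrB mulrBl.
  by [].
lra.
Qed.

Lemma face_expands P u : P \in S ->
  exists k : set 'rV[R]_n -> nat, expands S (supf (face u P)) (fun Q => (k Q)%:Z).
Proof.
move=> PS; have [->|nP] := pselect (face u P = P).
  by exists (fun Q => (Q == P)); apply: expands_supf.
have [[x e]|npt] := pselect (exists x, face u P = [set x]).
  have := lattice_face u (S_lattice PS); rewrite e => /lattice_point[t ->].
  exists (fun=> 0%N); apply: expands_eq (expands_dot S t) => // w.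
  by rewrite supf_set1 dotC.
apply: (NS_expands S_lattice); apply: (S_hier PS); split=> //.
by exists u.
Qed.

(** By [expands_uniq] the values on [S] do not depend on the choice. That they are natural numbers
    rules out cancellation of widths in [width_summand]. *)
Definition fcoef P u : set 'rV[R]_n -> nat :=
  xget (fun=> 0%N) [set k | expands S (supf (face u P)) (fun Q => (k Q)%:Z)].

Lemma expands_face P u : P \in S ->
  expands S (supf (face u P)) (fun Q => (fcoef P u Q)%:Z).
Proof. by move=> /(face_expands u); apply: xgetPex. Qed.

Lemma fcoef_full P u Q : P \in S -> Q \in S -> width P u = 0 ->
  fcoef P u Q = (Q == P).
Proof.
move=> PS QS /(face_full _ (S_polytope PS)) e; apply/eqP; rewrite -eqz_nat.
apply/eqP; apply: (@expands_uniq (supf P) (fun Q => (fcoef P u Q)%:Z)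
  (fun Q => (Q == P)%:Z) Q) => //.
  by rewrite -{1}e; apply: expands_face.
exact: expands_supf.
Qed.

(* Inclusion of the spaces on which the support functions are linear, in place
   of a comparison of dimensions. *)
Definition above P Q := (forall u, width P u = 0 -> width Q u = 0) /\
  exists2 u, width Q u = 0 & width P u <> 0.

(** Counts the members of [S] whose space of zero width is strictly contained in that of [P], so it
    grows when passing to summands of proper faces. *)
Definition rk P := count (fun Q => `[< above Q P >]) (enum_fset S).

Lemma above_rk P Q : P \in S -> above P Q -> (rk P < rk Q)%N.
Proof.
move=> PS PQ; apply: (@ltn_count _ _ _ _ P) => //; last 2 first.
- exact/asboolP.
- by apply/asboolP => -[_ [u h]].
move=> T /asboolP TP; apply/asboolP; case: TP PQ => h [w w1 w2] [h' [u u1 u2]].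
by split=> [v /h/h' //|]; exists w => //; exact: h'.
Qed.

Lemma width_sum C (k : set 'rV[R]_n -> nat) u :
  expands S (supf C) (fun P => (k P)%:Z) ->
  width C u = \sum_(P <- S) (k P)%:R * width P u.
Proof.
move=> [t h]; rewrite /width !h dotNr addrACA addrN addr0 -big_split.
by apply: eq_bigr => P _ /=; rewrite -mulrDr -pmulrn.
Qed.

Lemma width_summand C (k : set 'rV[R]_n -> nat) u P :
  expands S (supf C) (fun P => (k P)%:Z) -> P \in S -> k P != 0%N ->
  width C u = 0 -> width P u = 0.
Proof.
move=> /(width_sum u) -> PS kP; rewrite big_seq => /eqP; rewrite psumr_eq0 => [/allP|Q QS].
  move=> /(_ P PS); rewrite PS mulf_eq0 pnatr_eq0 (negbTE kP) => /eqP; exact.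
by rewrite mulr_ge0 //; apply/width_ge0/S_polytope.
Qed.

(** A summand of the face has zero width wherever [P] has, and moreover in direction [u], where [P]
    has not. *)
Lemma fcoef_lt P Q u : P \in S -> Q \in S -> width P u <> 0 ->
  fcoef P u Q != 0%N -> (rk P < rk Q)%N.
Proof.
move=> PS QS Pu kQ; apply: above_rk => //; have Pp := S_polytope PS.
have Fp := polytope_face u Pp.
have FQ v : width (face u P) v = 0 -> width Q v = 0.
  exact: (width_summand (expands_face u PS)).
split=> [v /(widthP _ Pp) h|].
  by apply/FQ/widthP => // x z /face_sub Px /face_sub Pz; apply: h.
exists u => //; apply/FQ/widthP => // x z [Px hx] [Pz hz].
by apply/eqP; rewrite eq_le hx ?hz.
Qed.

(** A representative of the coset of [z] modulo the directions of zero width; equal cosets are equal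
    sets and yield the same choice. *)
Definition canon P z := xget 0 [set z' | width P (z' - z) = 0].

Lemma canonP P z : polytope P -> width P (canon P z - z) = 0.
Proof.
move=> Pp; apply: (@xgetPex _ 0 [set z' | width P (z' - z) = 0]).
by exists z; rewrite /= subrr /width oppr0 supf0 // addr0.
Qed.

Lemma canon_eq P z z' : polytope P -> width P (z - z') = 0 -> canon P z = canon P z'.
Proof.
move=> Pp e; rewrite /canon; congr xget; apply/seteqP; split=> w /= h.
  by have := widthB Pp h (etrans (widthN _ _) e); rewrite opprK addrA subrK.
by have := widthB Pp h e; rewrite opprB addrA subrK.
Qed.

Definition key := (set 'rV[R]_n * 'rV[R]_n)%type.

(** A key encodes a unit. With a canonical second component, equivalent units have equal keys, so
    products can be compared as multisets of keys. *)
Definition good (k : key) := k.1 \in S /\ canon k.1 k.2 = k.2.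

Definition kterm (k : key) x := supf k.1 (x - k.2).

Definition ksum (A : seq key) x := \sum_(k <- A) kterm k x.

Lemma kterm_canon P z : polytope P -> tequiv (kterm (P, z)) (kterm (P, canon P z)).
Proof.
move=> Pp; exists (supf P (canon P z - z)), 0 => x; rewrite emb0 dot0l addr0.
have -> : kterm (P, canon P z) x = supf P (x - z - (canon P z - z)).
  by rewrite opprB addrA subrK.
by rewrite supf_width0 // ?subrK //; apply: canonP.
Qed.

Lemma good_canon P z : P \in S -> good (P, canon P z).
Proof.
move=> PS; split; first exact: PS.
by apply: canon_eq (canonP z _); exact: S_polytope.
Qed.

Lemma S_unit_key f : S_unit S f -> exists k, good k /\ tequiv f (kterm k).
Proof.
move=> [fu [P PS [t e]]]; have Pp := S_polytope PS; have [z fE] := unit_form fu.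
exists (P, canon P z); split; first exact: good_canon.
apply: tequiv_trans (kterm_canon z Pp); exists (f z - dot (emb R t) z), t => x.
by rewrite fE e supf_translate // /kterm /= dotBr; ring.
Qed.

Lemma key_S_unit (k : key) : k.1 \in S -> exists f, S_unit S f /\ f =1 kterm k.
Proof.
move=> kS; have [f [fu fN fE]] := unit_exists k.2 (S_lattice kS).
exists f; split=> //; split=> //; exists k.1 => //; exists 0; rewrite fN emb0.
apply/seteqP; split=> x; first by exists x; rewrite ?add0r.
by move=> [z + <-]; rewrite add0r.
Qed.

Lemma units_keys m (u : 'I_m -> tpoly R n) : (forall i, S_unit S (u i)) ->
  exists k : 'I_m -> key, forall i, good (k i) /\ tequiv (u i) (kterm (k i)).
Proof.
move=> h; have /choice[k hk] := fun i => S_unit_key (h i).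
by exists k.
Qed.

Lemma keys_units (A : seq key) : (forall k, k \in A -> k.1 \in S) ->
  exists u : 'I_(size A) -> tpoly R n, forall i, S_unit S (u i) /\
    u i =1 kterm (nth (set0, 0) A i).
Proof.
move=> h; have /choice[u hu] (i : 'I_(size A)) :=
  key_S_unit (h _ (mem_nth (set0, 0) (ltn_ord i))).
by exists u.
Qed.

Lemma ksum_cat A B x : ksum (A ++ B) x = ksum A x + ksum B x.
Proof. by rewrite /ksum big_cat. Qed.

Lemma ksum_perm A B : perm_eq A B -> ksum A =1 ksum B.
Proof. by move=> AB x; apply: perm_big. Qed.

Lemma ksum_nth A x : ksum A x = \sum_(i < size A) kterm (nth (set0, 0) A i) x.
Proof. by rewrite /ksum (big_nth (set0, 0)) big_mkord. Qed.

Lemma Npoly_keys h : Npoly S h ->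
  exists A, (forall k, k \in A -> good k) /\ tequiv h (ksum A).
Proof.
move=> [m [u [uS hu]]]; have [k hk] := units_keys uS.
exists [seq k i | i <- enum 'I_m]; split.
  by move=> _ /mapP[i _ ->]; case: (hk i).
apply: tequiv_trans hu _.
apply: tequiv_trans (tequiv_sum (r := index_enum 'I_m) (fun i _ => proj2 (hk i))) _.
by apply: tequiv_eq => x; rewrite /ksum big_map big_enum.
Qed.

Lemma keys_Npoly h A : (forall k, k \in A -> k.1 \in S) -> tequiv h (ksum A) -> Npoly S h.
Proof.
move=> AS hA; have [u hu] := keys_units AS; exists (size A), u; split.
  by move=> i; case: (hu i).
apply: tequiv_trans hA _; apply: tequiv_eq => x; rewrite ksum_nth.
by apply: eq_bigr => i _; case: (hu i) => _ ->.
Qed.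

Lemma germ_ksum (A : seq key) x : (forall k, k \in A -> k.1 \in S) ->
  [/\ germ (ksum A) x (fun u => \sum_(k <- A) supf (face (x - k.2) k.1) u),
      homog (fun u => \sum_(k <- A) supf (face (x - k.2) k.1) u) &
      expands S (fun u => \sum_(k <- A) supf (face (x - k.2) k.1) u)
        (fun Q => (\sum_(k <- A) fcoef k.1 (x - k.2) Q)%N%:Z)].
Proof.
move=> AS; split.
- apply: germ_sum => k /AS/S_polytope kp.
  by apply: germ_shift; apply: germ_supf.
- by apply: homog_sum => k /AS/S_polytope kp; apply/homog_supf/polytope_face.
have := expands_sum (fun=> 1) (fun k kA => expands_face (x - k.2) (AS k kA)).
apply: expands_eq => [u|Q _]; first by apply: eq_bigr => k _; rewrite mul1r.
by rewrite (big_morph Posz PoszD (erefl _)); apply: eq_bigr => k _; rewrite mul1r.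
Qed.

Lemma germ_tequiv F G psi x : tequiv F G -> germ G x psi ->
  exists t : 'rV[int]_n, germ F x (fun u => psi u + dot (emb R t) u).
Proof.
move=> [a [v h]] g; exists v.
by apply: germ_eq (germD g (germ_affine x (emb R v) a)) => // u; rewrite h.
Qed.


Lemma rk_le P : (rk P <= size (enum_fset S))%N.
Proof. exact: count_size. Qed.

Lemma ksum_fcoef A B Q x : (forall k, k \in A -> k.1 \in S) ->
  (forall k, k \in B -> k.1 \in S) -> Q \in S -> tequiv (ksum A) (ksum B) ->
  (\sum_(k <- A) fcoef k.1 (x - k.2) Q = \sum_(k <- B) fcoef k.1 (x - k.2) Q)%N.
Proof.
move=> AS BS QS e; have [gA hA eA] := germ_ksum x AS; have [gB hB eB] := germ_ksum x BS.
have [t gB'] := germ_tequiv e gB.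
have eqAB := germ_uniq gA gB' hA (homogD hB (homog_dot _)).
apply/eqP; rewrite -eqz_nat; apply/eqP.
have e1 := expands_eq eqAB (fun P _ => erefl _) eA.
exact: etrans (expands_uniq e1 (expandsD eB (expands_dot S t)) QS) (addr0 _).
Qed.

(* At the point k.2 the key k contributes its own polytope, and the other keys of
   larger or equal rank contribute nothing to it. *)
Lemma fcoef_key (k k' : key) : good k -> good k' ->
  fcoef k'.1 (k.2 - k'.2) k.1 = ((k' == k) +
    if rk k'.1 < rk k.1 then fcoef k'.1 (k.2 - k'.2) k.1 else 0)%N.
Proof.
case: k k' => [P z] [P' z'] [/= PS zP] [/= P'S z'P'].
have P'p := S_polytope P'S.
have [w0|w0] := pselect (width P' (z - z') = 0).
  rewrite fcoef_full // xpair_eqE eq_sym; have [eP|_] := eqVneq P' P.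
    by rewrite -{}eP ltnn in zP *; rewrite -z'P' -zP -(canon_eq P'p w0) eqxx.
  by case: ifP.
have -> : ((P', z') == (P, z)) = false.
  apply/eqP => -[eP ez]; apply: w0; rewrite ez subrr /width oppr0 supf0 ?addr0 //.
rewrite add0n; case: ifP => // /negP lt_rk; apply/eqP/negP => /negP nz.
by apply: lt_rk; apply: fcoef_lt nz.
Qed.

(** Multiplicities are compared by increasing rank: at the point [k.2] the coefficient of [k.1] in
    the germ is the multiplicity of [k] plus contributions of keys of smaller rank, which agree by
    induction. *)
Lemma ksum_inj A B : (forall k, k \in A -> good k) -> (forall k, k \in B -> good k) ->
  tequiv (ksum A) (ksum B) -> perm_eq A B.
Proof.
move=> Ag Bg e.
have AS k : k \in A -> k.1 \in S by case/Ag.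
have BS k : k \in B -> k.1 \in S by case/Bg.
pose lt m (k : key) := (rk k.1 < m)%N.
suff main m : perm_eq (filter (lt m) A) (filter (lt m) B).
  have := main (size (enum_fset S)).+1.
  by rewrite !(@eq_filter _ (lt _) predT) ?filter_predT // => k; rewrite /lt ltnS rk_le.
elim: m => [|m IH].
  by rewrite !(@eq_filter _ (lt _) pred0) ?filter_pred0.
apply/allP => k; rewrite mem_cat !mem_filter -andb_orr => /andP[km kAB].
have kg : good k by case/orP: kAB => [/Ag|/Bg].
rewrite /= !count_filter.
have cE D : count (predI (pred1 k) (lt m.+1)) D = count_mem k D.
  by apply: eq_count => k' /=; case: eqP => // ->.
rewrite !cE; move: km; rewrite /lt ltnS leq_eqVlt => /orP[/eqP km|km]; last first.
  have /permP/(_ (pred1 k)) := IH; rewrite !count_filter.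
  have cE' D : count (predI (pred1 k) (lt m)) D = count_mem k D.
    by apply: eq_count => k' /=; case: eqP => // ->.
  by rewrite !cE' => ->.
have split D : (forall k', k' \in D -> good k') ->
    (\sum_(k' <- D) fcoef k'.1 (k.2 - k'.2) k.1 = count_mem k D +
     \sum_(k' <- filter (lt m) D) fcoef k'.1 (k.2 - k'.2) k.1)%N.
  move=> Dg; rewrite big_filter (big_mkcond (lt m)) -sum1_count (big_mkcond (pred1 k)).
  rewrite -big_split; apply: eq_big_seq => k' k'D /=.
  rewrite {1}(fcoef_key kg (Dg _ k'D)) km /lt; by case: eqP.
apply/eqP/(@addIn (\sum_(k' <- filter (lt m) A) fcoef k'.1 (k.2 - k'.2) k.1)%N).
rewrite -split // [in RHS](perm_big _ IH) -split //.
apply: ksum_fcoef => //; by case: kg.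
Qed.

Lemma reduce_keys F A B : (forall k, k \in A -> good k) -> (forall k, k \in B -> good k) ->
  tequiv (fun x => F x + ksum A x) (ksum B) ->
  exists A' B', [/\ forall k, k \in A' -> good k, forall k, k \in B' -> good k,
    forall k, k \in A' -> k \notin B' & tequiv (fun x => F x + ksum A' x) (ksum B')].
Proof.
have [m] := ubnP (size A); elim: m => // m IH in A B * => Am Ag Bg e.
have [/hasP[k kA kB]|/hasPn h] := boolP (has (mem B) A); last first.
  by exists A, B; split.
have pA := perm_to_rem kA; have pB := perm_to_rem kB.
apply: (IH (rem k A) (rem k B)).
- by have := perm_size pA; rewrite /= => eA; rewrite eA ltnS in Am.
- by move=> k' /mem_rem/Ag.
- by move=> k' /mem_rem/Bg.
have [a [v h]] := e; exists a, v => x; have := h x.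
by rewrite (ksum_perm pA) (ksum_perm pB) /ksum !big_cons; lra.
Qed.

(** By [ksum_inj] the multisets [A ++ B'] and [A' ++ B] coincide, and [A] is disjoint from [B], so
    [A] is contained in [A']. *)
Lemma reduced_le F A B A' B' : (forall k, k \in A -> good k) ->
  (forall k, k \in B -> good k) -> (forall k, k \in A -> k \notin B) ->
  (forall k, k \in A' -> good k) -> (forall k, k \in B' -> good k) ->
  tequiv (fun x => F x + ksum A x) (ksum B) ->
  tequiv (fun x => F x + ksum A' x) (ksum B') ->
  forall k, (count_mem k A <= count_mem k A')%N.
Proof.
move=> Ag Bg AB Ag' Bg' e e' k.
have : tequiv (ksum (A ++ B')) (ksum (A' ++ B)).
  have [a [v h]] := e; have [b [w h']] := e'.
  exists (a - b), (v - w) => x; rewrite embB dotBl !ksum_cat.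
  by have := h x; have := h' x; lra.
move=> /ksum_inj pe; have {}pe : perm_eq (A ++ B') (A' ++ B).
  apply: pe => k'; rewrite mem_cat => /orP[].
  - exact: Ag.
  - exact: Bg'.
  - exact: Ag'.
  - exact: Bg.
have [kA|/count_memPn -> //] := boolP (k \in A).
have /permP/(_ (pred1 k)) := pe; rewrite !count_cat.
by have /count_memPn -> := AB _ kA; rewrite addn0 => <-; apply: leq_addr.
Qed.

Lemma ksum_map (I : Type) (k : I -> key) (r : seq I) x :
  ksum [seq k i | i <- r] x = \sum_(i <- r) kterm (k i) x.
Proof. by rewrite /ksum big_map. Qed.

Lemma ksum_tpoly A : (forall k, k \in A -> k.1 \in S) ->
  exists g : tpoly R n, g =1 ksum A.
Proof.
elim: A => [_|k A IH AS].
  by have [h hE] := tpoly_cst0 R n; exists h => x; rewrite hE /ksum big_nil.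
have [f [_ fE]] := key_S_unit (AS k (mem_head _ _)).
have [|g gE] := IH; first by move=> k' k'A; apply: AS; rewrite inE k'A orbT.
have [h hE] := tpoly_add f g; exists h => x.
by rewrite hE /= fE gE /ksum big_cons.
Qed.

Lemma unique_factorization_S : unique_factorization S.
Proof.
move=> f [g0 [g0N fg0N]].
have [A1 [A1g e1]] := Npoly_keys g0N; have [B1 [B1g e2]] := Npoly_keys fg0N.
have shift g A B : tequiv g (ksum A) -> tequiv (f \+ g) (ksum B) ->
    tequiv (fun x => f x + ksum A x) (ksum B).
  move=> e; apply: tequiv_trans.
  by apply: (tequivD (F := f) (G := ksum A)); [exact: tequiv_eq | exact: tequiv_sym].
have [A [B [Ag Bg AB e]]] := reduce_keys A1g B1g (shift _ _ _ e1 e2).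
have AS k : k \in A -> k.1 \in S by case/Ag.
have BS k : k \in B -> k.1 \in S by case/Bg.
have [g gE] := ksum_tpoly AS.
have ge : tequiv (f \+ g) (ksum B).
  by apply: tequiv_trans e; apply: tequiv_eq => x /=; rewrite gE.
have minA : minimal_cofactor S f g.
  split; [exact: keys_Npoly (tequiv_eq gE) | exact: keys_Npoly ge|].
  move=> g' g'N fg'N m u uS g'E; have [k hk] := units_keys uS.
  have [B' [B'g e']] := Npoly_keys fg'N.
  pose A' := [seq k i | i <- enum 'I_m].
  have A'E : tequiv g' (ksum A').
    apply: tequiv_trans g'E _.
    apply: tequiv_trans (tequiv_sum (r := index_enum 'I_m) (fun i _ => proj2 (hk i))) _.
    by apply: tequiv_eq => x; rewrite ksum_map big_enum.
  have A'g k' : k' \in A' -> good k' by move=> /mapP[i _ ->]; case: (hk i).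
  (* Containment of multisets becomes a set of indices by masking the enumeration of the given
     factors. *)
  have /count_subseqP[s] := reduced_le Ag Bg AB A'g B'g e (shift _ _ _ A'E e').
  move=> /subseqP[b _ ->]; rewrite /A' -map_mask; set r := mask b _ => pA.
  have r_uniq : uniq r by rewrite mask_uniq // enum_uniq.
  exists [set i in r]; apply: tequiv_trans (tequiv_eq gE) _.
  apply: tequiv_trans (tequiv_eq (ksum_perm pA)) _.
  apply: (tequiv_trans (G := fun x => \sum_(i <- r) u i x)).
    apply: (tequiv_trans (tequiv_eq (ksum_map k r))); apply: tequiv_sum => i _.
    by apply: tequiv_sym; case: (hk i).
  apply: tequiv_eq => x; rewrite big_uniq //=.
  by apply: eq_bigl => i; rewrite inE.
exists g; split=> // g' [g'N fg'N g'min].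
(* Conversely, minimality of [g'] against the cofactor [g] bounds the size of [A'] by that of [A],
   while [A] is already contained in [A']. *)
have [AN fAN _] := minA.
have [A' [A'g e']] := Npoly_keys g'N; have [B' [B'g eB']] := Npoly_keys fg'N.
have le_AA' := reduced_le Ag Bg AB A'g B'g e (shift _ _ _ e' eB').
have [u hu] := keys_units AS.
have uS i : S_unit S (u i) by case: (hu i).
have AE : tequiv g (fun x => \sum_i u i x).
  apply: tequiv_eq => x; rewrite gE ksum_nth; apply: eq_bigr => i _.
  by case: (hu i) => _ ->.
have [J eJ] := g'min _ AN fAN _ u uS AE.
pose C := [seq nth (set0, 0) A (i : 'I__) | i <- enum J].
have Cg k : k \in C -> good k.
  by move=> /mapP[i _ ->]; apply/Ag/mem_nth.
have pC : perm_eq A' C.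
  apply: ksum_inj => //; apply: tequiv_trans (tequiv_sym e') (tequiv_trans eJ _).
  apply: tequiv_eq => x; rewrite ksum_map big_enum /=.
  by apply: eq_bigr => i _; case: (hu i) => _ ->.
have size_A' : (size A' <= size A)%N.
  rewrite (perm_size pC) size_map -cardE.
  by rewrite (leq_trans (max_card _)) // card_ord.
apply: tequiv_trans e' (tequiv_trans (tequiv_eq _) (tequiv_sym (tequiv_eq gE))).
apply: ksum_perm; rewrite perm_sym.
have /count_subseqP[s sA' pA] := le_AA'.
have /eqP <- // : s == A'.
by rewrite -(size_subseq_leqif sA') eqn_leq size_subseq // -(perm_size pA).
Qed.

(** The gradient [t] is locally constant along lines through the origin, hence constant; then [F]
    minus its linear part is locally constant along them as well. *)
Lemma locally_affine F : (forall x, exists t : 'rV[int]_n, germ F x (dot (emb R t))) ->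
  tequiv F (fun=> 0).
Proof.
move=> /choice[t ht].
have near x u : exists2 e, 0 < e & forall d, `|d| <= e ->
    F (x + d *: u) = F x + d * dot (emb R (t x)) u /\ t (x + d *: u) = t x.
  have [r r0 hr] := ht x; have [c c0 bc] := box_ex u.
  exists (r / 2 / c) => [|d de]; first by rewrite !divr_gt0.
  have bu : box (r / 2) (d *: u).
    by apply: box_le (boxZ d bc); rewrite -ler_pdivlMr.
  have bu' : box r (d *: u) by apply: box_le bu; lra.
  rewrite hr // dotZr; split=> //; apply: (@emb_inj R); apply: dot_inj => w.
  rewrite !(dotC w); apply: germ_uniq (ht _) _ (homog_dot _) (homog_dot _) w.
  exists (r / 2) => [|v bv]; first by rewrite divr_gt0.
  have buv : box r (d *: u + v) by rewrite [r]splitr; apply: boxD.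
  by rewrite -[x + d *: u + v]addrA !hr // dotDr addrA.
have tE x : t x = t 0.
  have := @locally_constant R _ (fun s => t (s *: x)) _ 1.
  rewrite scale1r scale0r; apply=> s; have [e e0 he] := near (s *: x) x.
  by exists e => // d /he[_]; rewrite -scalerDl.
exists (F 0), (t 0) => x; rewrite add0r.
have := @locally_constant R _ (fun s => F (s *: x) - s * dot (emb R (t 0)) x) _ 1.
rewrite scale1r scale0r mul1r mul0r subr0 => <-; first by rewrite subrK.
move=> s; have [e e0 he] := near (s *: x) x; exists e => // d /he[+ _].
by rewrite -scalerDl tE => ->; ring.
Qed.

Lemma ksum_nseq (m : key -> nat) (L : seq key) x :
  ksum (flatten [seq nseq (m k) k | k <- L]) x = \sum_(k <- L) (m k)%:R * kterm k x.
Proof.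
rewrite /ksum big_flatten big_map; apply: eq_bigr => k _.
by rewrite big_nseq mulr_natl; elim: (m k) => //= j ->; rewrite mulrS.
Qed.

(* Passing to a face keeps the polytopes of least rank which are constant in its
   direction; everything else contributes polytopes of larger rank only. *)
Lemma coef_face phi y r w : expands S phi y ->
  (forall Q, Q \in S -> y Q != 0 -> (r <= rk Q)%N) ->
  exists psi, exists y', [/\ homog psi, germ phi w psi, expands S psi y' &
    forall P, P \in S -> rk P = r -> y' P = y P * `[< width P w = 0 >]%:Z].
Proof.
move=> [t ht] y_rk.
exists (fun u => \sum_(Q <- S) (y Q)%:~R * supf (face w Q) u + dot (emb R t) u).
exists (fun P => \sum_(Q <- S) y Q * (fcoef Q w P)%:Z + 0); split.
- apply: homogD (homog_dot _); apply: homog_sum => Q QS; apply: homogZ.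
  exact/homog_supf/polytope_face/S_polytope.
- have g : germ (fun u => \sum_(Q <- S) (y Q)%:~R * supf Q u) w
      (fun u => \sum_(Q <- S) (y Q)%:~R * supf (face w Q) u).
    by apply: germ_sum => Q QS; apply/germZ/germ_supf/S_polytope.
  by apply: germ_eq (germD g (germ_affine w (emb R t) 0)) => // u; rewrite ht add0r.
- apply: expandsD (expands_dot _ _).
  by apply: expands_sum => Q QS; apply: expands_face.
move=> P PS rP; rewrite addr0 -(sum_delta (fun Q => y Q * `[< width P w = 0 >]%:Z) PS).
apply: eq_big_seq => Q QS; have [wQ|wQ] := pselect (width Q w = 0).
  rewrite fcoef_full // eq_sym; have [eQ|_] := eqVneq Q P; last by rewrite mulr0 mul0r.
  by rewrite -eQ asboolT // mul1r.
have [->|y0] := eqVneq (y Q) 0; first by rewrite !mul0r mulr0.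
have rQ := y_rk Q QS y0.
have -> : fcoef Q w P = 0%N.
  apply/eqP/negP => /negP /(fcoef_lt QS PS wQ); rewrite rP => /(leq_ltn_trans rQ).
  by rewrite ltnn.
have [eQ|_] := eqVneq Q P; last by rewrite mulr0 mul0r.
by rewrite -eQ asboolF // !mulr0.
Qed.

(** * Coefficients of least rank as functions of the point *)

Section Peel.
Variables (F : 'rV[R]_n -> R) (r : nat) (Y : 'rV[R]_n -> set 'rV[R]_n -> int).
Variable Phi : 'rV[R]_n -> 'rV[R]_n -> R.
Hypothesis F_germ : forall x, germ F x (Phi x).
Hypothesis Phi_homog : forall x, homog (Phi x).
Hypothesis Phi_expands : forall x, expands S (Phi x) (Y x).
Hypothesis Y_rk : forall x Q, Q \in S -> Y x Q != 0 -> (r <= rk Q)%N.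

Lemma coef_near x w : exists2 e0, 0 < e0 & forall e, 0 < e <= e0 -> forall P,
  P \in S -> rk P = r ->
  (width P w = 0 -> Y (x + e *: w) P = Y x P) /\
  (width P w <> 0 -> Y (x + e *: w) P = 0).
Proof.
have [psi [y [psi_hom psi_germ psi_exp yE]]] := coef_face w (Phi_expands x) (@Y_rk x).
have [e0 e0_gt0 he] := germ_germ (F_germ x) (Phi_homog x) psi_germ psi_hom.
exists e0 => // e /he ge P PS rP.
have -> : Y (x + e *: w) P = y P.
  apply: expands_uniq psi_exp PS; apply: expands_eq (Phi_expands (x + e *: w)) => //.
  exact: germ_uniq (F_germ _) ge (Phi_homog _) psi_hom.
rewrite (yE P PS rP); split=> wP; first by rewrite asboolT // mulr1.
by rewrite asboolF // mulr0.
Qed.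

Lemma coef_translate x u P : P \in S -> rk P = r -> width P u = 0 ->
  Y (x + u) P = Y x P.
Proof.
move=> PS rP wu.
have := @locally_constant R _ (fun s => Y (x + s *: u) P) _ 1.
rewrite scale1r scale0r addr0; apply=> s.
have [e1 e10 h1] := coef_near (x + s *: u) u.
have [e2 e20 h2] := coef_near (x + s *: u) (- u).
exists (Num.min e1 e2) => [|d]; first by rewrite lt_min e10.
rewrite le_min scalerDl addrA => /andP[d1 d2].
have [d0|d0|->] := ltgtP d 0; last by rewrite scale0r addr0.
  have [|+ _] := h2 (- d) _ P PS rP.
    by rewrite oppr_gt0 d0 -(ltr0_norm d0).
  by rewrite widthN scalerN scaleNr opprK; apply.
have [|+ _] := h1 d _ P PS rP; last by apply.
by rewrite d0 -(gtr0_norm d0).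
Qed.

(** Towards a point of the same label the germ stays constant, while in a direction of positive
    width a coefficient drops to 0 at once. So each label carries at most one coset with a nonzero
    coefficient of [P], and there are finitely many labels. *)
Lemma coef_support : tame F -> exists L : seq key,
  [/\ uniq L, forall k, k \in L -> good k /\ rk k.1 = r &
   forall x P, P \in S -> rk P = r -> Y x P != 0 -> (P, canon P x) \in L].
Proof.
move=> [K [lab [G [G_germ G_homog G_lab]]]].
have same x x' P : lab x = lab x' -> P \in S -> rk P = r -> Y x P != 0 ->
    width P (x' - x) = 0.
  move=> e PS rP Y0; apply: contrapT => w0.
  have [e0 e0_gt0 h] := coef_near x (x' - x).
  (* Capping at 1 keeps the point on the segment from [x] to [x']. *)
  have m0 : 0 < Num.min e0 1 by rewrite lt_min e0_gt0 ltr01.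
  have [|_ /(_ w0) YE] := h (Num.min e0 1) _ P PS rP.
    by rewrite m0 ge_min lexx.
  have GE : G (x + Num.min e0 1 *: (x' - x)) =1 G x.
    by apply: G_lab => //; rewrite ltW //= ge_min lexx orbT.
  suff eY : Y (x + Num.min e0 1 *: (x' - x)) P = Y x P by move: Y0; rewrite -eY YE.
  have GY z : expands S (G z) (Y z).
    apply: expands_eq (Phi_expands z) => //.
    exact: germ_uniq (F_germ z) (G_germ z) (Phi_homog z) (G_homog z).
  exact: expands_uniq (expands_eq GE (fun _ _ => erefl _) (GY _)) (GY x) PS.
pose rep P (k : K) := xget 0 [set x | lab x = k /\ Y x P != 0].
exists (undup [seq (P, canon P (rep P k)) |
    P <- [seq P <- enum_fset S | rk P == r], k <- enum K]).
split; first exact: undup_uniq.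
  move=> k; rewrite mem_undup => /allpairsP[[P j] /= [+ _ ->]] /=.
  rewrite mem_filter => /andP[/eqP rP PS].
  by split; [exact: good_canon | exact: rP].
move=> x P PS rP Y0; rewrite mem_undup; apply/allpairsP.
exists (P, lab x); rewrite /= mem_filter rP eqxx PS mem_enum.
split; [exact: erefl | exact: erefl |].
suff -> : canon P x = canon P (rep P (lab x)) by [].
apply: canon_eq; first exact: S_polytope.
have [e1 e2] : [set z | lab z = lab x /\ Y z P != 0] (rep P (lab x)).
  by apply: xgetPex; exists x.
exact: same e2.
Qed.

End Peel.

(** Subtracting, for every coset in the support, the corresponding unit times its coefficient
    cancels rank [r] at every point and disturbs larger ranks only. [F] is just a tame function
    because the subtraction destroys convexity. *)
Lemma local_keys F r : tame F ->
  (forall x, exists phi, exists y, [/\ germ F x phi, homog phi, expands S phi y &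
     forall Q, Q \in S -> y Q != 0 -> (r <= rk Q)%N]) ->
  exists A B, [/\ forall k, k \in A -> k.1 \in S, forall k, k \in B -> k.1 \in S &
    tequiv (fun x => F x + ksum A x) (ksum B)].
Proof.
have [m] := ubnP ((size (enum_fset S)).+1 - r); elim: m => // m IH in F r * => rm tF h.
have /choice[Phi /choice[Y hY]] := h.
have Fg x : germ F x (Phi x) by case: (hY x).
have Ph x : homog (Phi x) by case: (hY x).
have PY x : expands S (Phi x) (Y x) by case: (hY x).
have Yr x Q : Q \in S -> Y x Q != 0 -> (r <= rk Q)%N by case: (hY x) => _ _ _; apply.
(* No rank exceeds the size of [S], so in the first case all coefficients vanish. *)
have [r_big|r_le] := ltnP (size (enum_fset S)) r.
  exists [::], [::]; split=> //.
  suff /locally_affine [a [v e]] : forall x, exists t : 'rV[int]_n, germ F x (dot (emb R t)).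
    by exists a, v => x; rewrite /ksum !big_nil addr0 e.
  move=> x; have [t ht] := PY x; exists t; apply: germ_eq (Fg x) => // u.
  rewrite ht big_seq big1 ?add0r // => Q QS.
  suff -> : Y x Q = 0 by rewrite mul0r.
  apply/eqP/negP => /negP /(Yr _ _ QS) rQ.
  by have := leq_trans r_big (leq_trans rQ (rk_le Q)); rewrite ltnn.
have [L [L_uniq L_good L_supp]] := coef_support Fg Ph PY Yr tF.
have LS k : k \in L -> k.1 \in S by move=> /L_good[[]].
pose c (k : key) : int := Y k.2 k.1.
pose F' x := F x + \sum_(k <- L) (- c k)%:~R * kterm k x.
have [|||A [B [AS BS [a [v e]]]]] := IH F' r.+1.
- by rewrite subnS -ltnS prednK // ?subn_gt0 //; apply: leq_trans rm.
- apply: tameD => //; apply: tame_sum => k kL; apply: tameZ.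
  have [f [_ fE]] := key_S_unit (LS k kL).
  exact: tame_eq fE (tame_tpoly f).
- move=> x; exists (fun u => Phi x u +
    \sum_(k <- L) (- c k)%:~R * supf (face (x - k.2) k.1) u).
  exists (fun Q => Y x Q + \sum_(k <- L) - c k * (fcoef k.1 (x - k.2) Q)%:Z).
  split.
  + apply: germD => //; apply: germ_sum => k kL; apply: germZ.
    by apply: germ_shift; apply/germ_supf/S_polytope/LS.
  + apply: homogD => //; apply: homog_sum => k kL; apply: homogZ.
    exact/homog_supf/polytope_face/S_polytope/LS.
  + by apply: expandsD => //; apply: expands_sum => k kL; apply/expands_face/LS.
  move=> Q QS; apply: contraR; rewrite -leqNgt => rQ.
  (* For [Q] of rank at most [r], only the key of the coset of [x] can contribute to the coefficient
     at [x]. *)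
  have fE k : k \in L -> fcoef k.1 (x - k.2) Q = (k == (Q, canon Q x)) :> nat.
    case: k => P z kL; have [[/= PS zP] rP] := L_good _ kL; have Pp := S_polytope PS.
    have [w0|w0] := pselect (width P (x - z) = 0).
      rewrite fcoef_full // xpair_eqE eq_sym; have [<-|//] := eqVneq P Q.
      by rewrite -zP (canon_eq Pp w0) eqxx.
    have -> : ((P, z) == (Q, canon Q x)) = false.
      apply/eqP => -[eP ez]; apply: w0; rewrite -widthN opprB ez eP.
      by apply: canonP; rewrite -eP.
    apply/eqP/negP => /negP /(fcoef_lt PS QS w0); rewrite /= rP => /leq_trans/(_ rQ).
    by rewrite ltnn.
  rewrite (eq_big_seq (fun k => if k == (Q, canon Q x) then - c k else 0)); last first.
    by move=> k kL; rewrite fE //; case: eqP; rewrite ?mulr1 ?mulr0.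
  rewrite -big_mkcond /=.
  have [rQr|rQr] := eqVneq (rk Q) r; last first.
    have -> : Y x Q = 0.
      apply/eqP/negP => /negP /(Yr _ _ QS); rewrite leqNgt ltn_neqAle rQr rQ.
      by [].
    rewrite big_seq_cond big1 ?addr0 // => k /andP[/L_good[_ +] /eqP ke].
    by rewrite ke /= => e; rewrite e eqxx in rQr.
  have wx : width Q (canon Q x - x) = 0 by apply: canonP; apply: S_polytope.
  have YE : c (Q, canon Q x) = Y x Q.
    rewrite /c /= -(coef_translate Fg Ph PY Yr x QS rQr wx).
    by rewrite addrC subrK.
  have [inL|notL] := boolP ((Q, canon Q x) \in L).
    by rewrite -big_filter filter_pred1_uniq // big_seq1 YE addrN.
  have -> : Y x Q = 0.
    by apply/eqP/negP => /negP /(L_supp x Q QS rQr); apply/negP.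
  rewrite big_seq_cond big1 ?addr0 // => k /andP[kL /eqP ke].
  by rewrite ke (negbTE notL) in kL.
(* Multiplicities of keys are natural numbers, so the subtracted sum is distributed over the two
   sides according to sign. *)
pose neg (k : key) := if c k is Negz j then j.+1 else 0%N.
pose pos (k : key) := if c k is Posz j then j else 0%N.
have cE k : (- c k)%:~R = (neg k)%:R - (pos k)%:R :> R.
  rewrite /neg /pos; case: (c k) => j; first by rewrite sub0r mulrNz -pmulrn.
  by rewrite NegzE opprK subr0 -pmulrn.
exists (A ++ flatten [seq nseq (neg k) k | k <- L]).
exists (B ++ flatten [seq nseq (pos k) k | k <- L]).
have memL (g : key -> nat) k : k \in flatten [seq nseq (g k) k | k <- L] -> k.1 \in S.
  by move=> /flattenP[_ /mapP[k' k'L ->]]; rewrite mem_nseq => /andP[_ /eqP ->]; apply: LS.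
split.
- by move=> k; rewrite mem_cat => /orP[/AS|/memL].
- by move=> k; rewrite mem_cat => /orP[/BS|/memL].
exists a, v => x; have := e x; rewrite /F' !ksum_cat !ksum_nseq.
rewrite (eq_bigr (fun k => (neg k)%:R * kterm k x - (pos k)%:R * kterm k x)); last first.
  by move=> k _; rewrite cE mulrBl.
by rewrite sumrB; lra.
Qed.

Lemma local_factorization_S : local_factorization S.
Proof.
move=> f fZ; have [||A [B [AS BS e]]] := @local_keys f 0.
- exact: tame_tpoly.
- move=> x; have [|y hy] := @ZS_expands _ _ S S_lattice (cell f x).
    by apply/fZ/subdivisionP; exists x.
  exists (supf (cell f x)), y; split=> //; first exact: germ_cell.
  exact/homog_supf/polytope_cell.
have [g gE] := ksum_tpoly AS; exists g; split; first exact: keys_Npoly (tequiv_eq gE).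
apply: keys_Npoly BS _; apply: tequiv_trans e.
by apply: tequiv_eq => x /=; rewrite gE.
Qed.

(** * Summands of multiples of the sum, full bases and edges *)

Let M := Stotal S.

Let Mp : polytope M.
Proof. exact: polytope_Stotal. Qed.

Lemma subadd_Stotal_bound (c : set 'rV[R]_n -> nat) :
  exists k : nat, subadd (fun u => k%:R * supf M u - \sum_(P <- S) (c P)%:R * supf P u).
Proof.
have [||k hk] := @nat_seq _ (enum_fset S) (fun m P => (c P <= m)%N).
- by move=> P m m' mm /leq_trans; apply.
- by move=> P _; exists (c P).
exists k; apply: (@subadd_eq _ _ (fun u => \sum_(P <- S) (k - c P)%N%:R * supf P u)).
  move=> u; rewrite supf_Stotal // mulr_sumr -sumrB; apply: eq_big_seq => P PS.
  by rewrite natrB ?hk // mulrBl.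
by apply: subadd_sum => P PS; apply: subaddZ => //; apply/subadd_supf/S_polytope.
Qed.

Lemma subadd_expands phi (c : set 'rV[R]_n -> nat) : expands S phi (fun P => (c P)%:Z) ->
  exists k : nat, subadd (fun u => k%:R * supf M u - phi u).
Proof.
move=> [t h]; have [k hk] := subadd_Stotal_bound c; exists k.
apply: subadd_eq (subaddD hk (subadd_dot (- emb R t))) => u.
by rewrite h dotNl opprD addrA.
Qed.

Lemma subadd_mono phi (k k' : nat) : (k <= k')%N ->
  subadd (fun u => k%:R * supf M u - phi u) -> subadd (fun u => k'%:R * supf M u - phi u).
Proof.
move=> kk h; apply: subadd_eq (subaddD (subaddZ (ler0n R (k' - k)) (subadd_supf Mp)) h) => u.
by rewrite natrB //; ring.
Qed.

(** The gradients of the difference found by [subadd_hsB] span [T]; being differences of generators,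
    they are integral if [F] is a lattice polytope. *)
Lemma summand_exists F (k : nat) : polytope F ->
  subadd (fun u => k%:R * supf M u - supf F u) ->
  exists T, [/\ polytope T, forall u, supf F u + supf T u = k%:R * supf M u &
    lattice_polytope F -> lattice_polytope T].
Proof.
have kML : lattice_polytope (dilate k%:R M) by apply/lattice_dilate/lattice_Stotal.
have kMp := lattice_polytopeW kML; case: (kML) => s [s0 sE].
have sR : [seq emb R a | a <- s] != [::] by apply: map_emb_neq0.
have kME u : k%:R * supf M u = hs [seq emb R a | a <- s] u.
  by rewrite -supf_dilate // sE supf_conv.
have build t : t != [::] -> subadd (fun u => k%:R * supf M u - hs t u) ->
    exists s3, [/\ s3 != [::], {subset s3 <= [seq a - b | a <- [seq emb R a | a <- s],
        b <- t]} & forall u, hs t u + hs s3 u = k%:R * supf M u].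
  move=> t0 sub; have [|s3 [s30 s3s s3E]] := @subadd_hsB _ _ [seq emb R a | a <- s] t sR t0.
    by apply: subadd_eq sub => u; rewrite kME.
  by exists s3; split=> // u; rewrite kME s3E.
move=> Fp sub; have [FL|nFL] := pselect (lattice_polytope F); last first.
  case: Fp sub nFL => t [t0 ->]; rewrite supf_conv // => /(build t t0)[s3 [s30 _ E]] nFL.
  exists (conv s3); split=> //; first exact: polytope_conv.
  by move=> u; rewrite supf_conv // E.
case: (FL) sub => t [t0 ->]; have tR := map_emb_neq0 R t0; rewrite supf_conv //.
move=> /(build _ tR)[s3 [s30 s3s E]].
exists (conv s3); split; first exact: polytope_conv.
  by move=> u; rewrite supf_conv // E.
move=> _; have [r rE] : exists r : seq 'rV[int]_n, s3 = [seq emb R a | a <- r].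
  elim: (s3) s3s => [|z r IH] h; first by exists [::].
  have [|r' ->] := IH; first by move=> x xr; apply: h; rewrite inE xr orbT.
  have /allpairsP[[_ _] [/= /mapP[a _ ->] /mapP[b _ ->] ->]] := h z (mem_head _ _).
  by exists (a - b :: r'); rewrite /= embB.
exists r; split; last by rewrite rE.
by move: s30; rewrite rE; case: (r).
Qed.

Lemma H_representable_subadd F : H_representable M F -> polytope F ->
  exists k : nat, subadd (fun u => k%:R * supf M u - supf F u).
Proof.
move=> [k [_ [T [Tp e]]]] Fp; exists k; apply: subadd_eq (subadd_supf Tp) => u.
by rewrite -supf_dilate // e supf_mink // addrAC subrr add0r.
Qed.

Lemma subadd_H_representable F (k : nat) : polytope F ->
  subadd (fun u => k%:R * supf M u - supf F u) -> H_representable M F.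
Proof.
move=> Fp /(subadd_mono (leqnSn k)) sub; exists k.+1; split=> //.
have [T [Tp TE _]] := summand_exists Fp sub; exists T; split=> //.
apply: polytope_supf; [exact: polytope_dilate | exact: polytope_mink|] => u.
by rewrite supf_dilate // supf_mink // TE.
Qed.

(** A point outside [F] is cut off by a facet normal ([facet_separates]). If [M] were a point there
    would be no rows, and the right-hand side would be the whole space. *)
Lemma Hsystem_supf F (k : nat) : (exists u, width M u <> 0) -> polytope F ->
  subadd (fun u => k%:R * supf M u - supf F u) ->
  F = Hsystem (fun v : Hrows M => supf F (emb R (val v))).
Proof.
move=> [u0 wu0] Fp sub; have [T [Tp TE _]] := summand_exists Fp sub.
apply/seteqP; split=> x; first by move=> Fx v; apply: supf_ge.
move=> h; apply: contrapT => nFx; have [s [s0 sE]] := lattice_Stotal S_lattice.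
(* If all integral directions were constant on the generators, their own differences would be, and
   [M] would be a point. *)
have nf : exists e, ~~ flat s e.
  apply: contrapT => nf; apply: wu0.
  have [a as_ _] := hs_in 0 (map_emb_neq0 R s0); move: as_ => /mapP[a' a's _].
  have eq_a b : b \in s -> b = a'.
    move=> bs; have /allP fl : flat s (b - a').
      by apply: contrapT => /negP h'; apply: nf; exists (b - a').
    apply: (@emb_inj R); apply/eqP; rewrite -subr_eq0; apply/eqP/dot_eq0.
    by rewrite -embB dot_emb idotBr (act_eq (fl b bs) (fl a' a's)) subrr.
  have ME : supf M =1 dot (emb R a').
    rewrite /M sE supf_conv ?map_emb_neq0 //; apply: hs_const; first exact: map_emb_neq0.
    by move=> _ /mapP[b /eq_a -> ->].
  by rewrite /width !ME dotNr subrr.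
have [v vx] : exists v : Hrows M, supf F (emb R (val v)) < dot (emb R (val v)) x.
  rewrite /M sE; apply: (@facet_separates _ _ s s0 F T k%:R x) => // u.
  by rewrite -sE TE.
by have := h v; rewrite leNgt vx.
Qed.

(** The full basis gives an equation of right-hand sides only. With the negative part moved to the
    side of [F], both sides are polytopes cut out by rows of H, so they coincide. *)
Lemma full_ZS F (k : nat) : full_basis S -> lattice_polytope F ->
  subadd (fun u => k%:R * supf M u - supf F u) -> ZS S F.
Proof.
move=> [_ full] FL sub; have Fp := lattice_polytopeW FL.
(* If [M] is a point, H has no rows and gives no information, but then [F] is a lattice point. *)
have [wM0|nwM] := pselect (forall u, width M u = 0).
  have [T [Tp TE _]] := summand_exists Fp sub.
  have [x FE] : exists x, F = [set x].
    apply: set1_width => // u; have := width_ge0 u Fp; have := width_ge0 u Tp.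
    have : width F u + width T u = k%:R * width M u.
      by rewrite /width mulrDr -!TE; ring.
    by rewrite wM0 mulr0 => *; apply/eqP; rewrite eq_le; apply/andP; split; lra.
  move: FL; rewrite FE => FL; have [t xE] := lattice_point FL.
  apply: (expands_ZS S_lattice (y := fun=> 0) FL).
  by apply: expands_eq (expands_dot S t) => // u; rewrite supf_set1 xE dotC.
have {}nwM : exists u, width M u <> 0.
  by apply: contrapT => h; apply: nwM => u; apply: contrapT => hu; apply: h; exists u.
have bF (w : Hrows M) : bH M F w = supf F (emb R (val w)).
  apply: (is_bHE Fp); apply: (@xgetPex _ (fun=> 0) (@is_bH R n M F)).
  exists (fun w => supf F (emb R (val w))); split; first exact: Hsystem_supf sub.
  move=> b' Fb' w'; apply: supf_le => // x; rewrite Fb'; exact.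
have [y [t yE]] : exists y, eq_mod_translation (bH M F)
    (fun w => \sum_(P <- S) (y P)%:~R * bH (Stotal S) P w).
  apply/full; exists 1%N, (fun=> bH M F), (fun=> 1); split.
    by move=> _; exists F => //=; split=> //; apply: subadd_H_representable sub.
  by exists 0 => v; rewrite big_ord1 mul1r emb0 dot0r addr0.
pose neg P := if y P is Negz m then m.+1 else 0%N.
pose pos P := if y P is Posz m then m else 0%N.
have yD P : (y P)%:~R = (pos P)%:R - (neg P)%:R :> R.
  by rewrite /pos /neg; case: (y P) => m; rewrite ?subr0 // NegzE mulrNz sub0r.
pose A := mink F (msum S neg); pose B := [set emb R t + x | x in msum S pos].
have mp c : polytope (msum S c) by apply/lattice_polytopeW/lattice_msum.
have Ap : polytope A by apply: polytope_mink.
have Bp : polytope B by apply: polytope_translate.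
have AE u : supf A u = supf F u + \sum_(P <- S) (neg P)%:R * supf P u.
  by rewrite supf_mink // supf_msum.
have BE u : supf B u = \sum_(P <- S) (pos P)%:R * supf P u + dot (emb R t) u.
  by rewrite supf_translate // supf_msum.
have [k1 h1] := subadd_Stotal_bound neg; have [k2 h2] := subadd_Stotal_bound pos.
have AH : A = Hsystem (fun v : Hrows M => supf A (emb R (val v))).
  apply: (@Hsystem_supf A (k + k1)) => //.
  by apply: subadd_eq (subaddD sub h1) => u; rewrite AE natrD; ring.
have BH : B = Hsystem (fun v : Hrows M => supf B (emb R (val v))).
  apply: (@Hsystem_supf B k2) => //.
  apply: subadd_eq (subaddD h2 (subadd_dot (- emb R t))) => u.
  by rewrite BE dotNl; ring.
have AB : A = B.
  rewrite AH BH; congr Hsystem; apply: funext => v; rewrite AE BE.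
  have := yE v; rewrite bF => ->; rewrite -(dotC (emb R t)).
  rewrite [X in X + _ + _](eq_big_seq (fun P => (pos P)%:R * supf P (emb R (val v)) -
    (neg P)%:R * supf P (emb R (val v)))); last by move=> P PS; rewrite bH_S // yD mulrBl.
  by rewrite sumrB; ring.
apply: (expands_ZS S_lattice (y := y) FL); exists t => u.
have := BE u; rewrite -AB AE => E.
rewrite (eq_bigr (fun P => (pos P)%:R * supf P u - (neg P)%:R * supf P u)); last first.
  by move=> P _; rewrite yD mulrBl.
by rewrite sumrB; lra.
Qed.

Lemma Zpoly_expands f x : Zpoly S f -> exists y, expands S (supf (cell f x)) y.
Proof.
move=> [g [/Npoly_keys[A [Ag gA]] /Npoly_keys[B [Bg fB]]]].
have AS k : k \in A -> k.1 \in S by case/Ag.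
have BS k : k \in B -> k.1 \in S by case/Bg.
have [gA1 gA2 gA3] := germ_ksum x AS; have [gB1 gB2 gB3] := germ_ksum x BS.
have [t gt] := germ_tequiv gA gA1; have [t' ft] := germ_tequiv fB gB1.
have Cp := polytope_cell f x.
have gh := homogD gA2 (homog_dot (emb R t)); have fh := homogD gB2 (homog_dot (emb R t')).
have fg := germD (germ_cell f x) gt.
have E := germ_uniq fg ft (homogD (homog_supf Cp) gh) fh.
eexists; apply: expands_eq (expandsB (expandsD gB3 (expands_dot S t'))
  (expandsD gA3 (expands_dot S t))).
  by move=> u; have := E u; lra.
by move=> P PS; reflexivity.
Qed.

(** The cell of [f] and those of the units add up to the germ of a product of [S]-units, a summand
    of a multiple of [M] up to translation. So the cell of [f] is such a summand too, and the full
    basis puts it in [ZS]. *)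
Lemma Epoly_Zpoly f : full_basis S -> Epoly S f -> Zpoly S f.
Proof.
move=> full [g [[m [u [uU gE]]] /Npoly_keys[B [Bg fB]]]].
apply: local_factorization_S => _ /subdivisionP[x ->].
have BS k : k \in B -> k.1 \in S by case/Bg.
have [gB1 gB2 gB3] := germ_ksum x BS; have [t ft] := germ_tequiv fB gB1.
pose U v := \sum_(i <- index_enum 'I_m) supf (cell (u i) x) v.
have Ug : germ (fun z => \sum_(i <- index_enum 'I_m) u i z) x U.
  by apply: germ_sum => i _; apply: germ_cell.
have Uh : homog U by apply: homog_sum => i _; apply/homog_supf/polytope_cell.
have [t' gt] := germ_tequiv gE Ug.
have Cp := polytope_cell f x.
have E := germ_uniq (germD (germ_cell f x) gt) ft
  (homogD (homog_supf Cp) (homogD Uh (homog_dot _))) (homogD gB2 (homog_dot _)).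
have [k hk] := subadd_expands gB3.
apply: (full_ZS (k := k) full (lattice_cell f x)).
have Us : subadd U by apply: subadd_sum => i _; apply/subadd_supf/polytope_cell.
apply: subadd_eq (subaddD hk (subaddD Us (subadd_dot (emb R t' - emb R t)))) => v.
by have := E v; rewrite dotBl; lra.
Qed.

Lemma Zpoly_Epoly f : Zpoly S f -> Epoly S f.
Proof.
move=> [g [[m [u [uS gE]]] fg]]; exists g; split=> //; exists m, u; split=> // i.
by case: (uS i).
Qed.

(** The units at 0 of [F] and of its complement [T] multiply to the [k]th power of the product of
    all [S]-units at 0. So the unit of [F] lies in E[S], hence in Z[S], and its cell at 0 is [F]. *)
Lemma H_representable_ZS F : Zpoly S = Epoly S -> lattice_polytope F ->
  H_representable M F -> exists y, expands S (supf F) y.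
Proof.
move=> ZE FL FH; have Fp := lattice_polytopeW FL.
have [k sub] := H_representable_subadd FH Fp.
have [T [Tp TE /(_ FL) TL]] := summand_exists Fp sub.
have [f [fU fN fE]] := unit_exists 0 FL; have [g [gU gN gE]] := unit_exists 0 TL.
have fZ : Zpoly S f.
  rewrite ZE; exists g; split.
    by exists 1%N, (fun=> g); split=> //; apply: tequiv_eq => x; rewrite big_ord1.
  pose L := [seq (P, 0 : 'rV[R]_n) | P <- enum_fset S].
  apply: (@keys_Npoly _ (flatten [seq nseq k p | p <- L])).
    move=> p /flattenP[_ /mapP[q /mapP[P PS ->] ->]].
    by rewrite mem_nseq => /andP[_ /eqP ->].
  apply: tequiv_eq => x; rewrite ksum_nseq big_map /= fE gE TE supf_Stotal //.
  by rewrite mulr_sumr; apply: eq_bigr => P _.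
have [y hy] := Zpoly_expands 0 fZ; exists y.
suff -> : F = cell f 0 by [].
apply/esym/cell_germ => //; have F0 : face 0 F = F.
  by apply/face_full => //; rewrite /width oppr0 supf0 // addr0.
apply: (@germ_eq _ _ (fun z => supf F (z - 0)) _ (supf F)) => //.
by apply: germ_shift; rewrite subr0 -{2}F0; apply: germ_supf.
Qed.

Lemma EZ_full : Zpoly S = Epoly S -> full_basis S.
Proof.
move=> ZE; split; first by case: S_basis.
move=> b; split=> [[m [x [y [xB [t bE]]]]]|[y [t bE]]].
  have /choice[Y hY] : forall i, exists Y : set 'rV[R]_n -> int,
      eq_mod_translation (x i) (fun w => \sum_(P <- S) (Y P)%:~R * bH (Stotal S) P w).
    move=> i; have [F [FL FH] <-] := xB i.
    (* A junk value is the zero vector and has the zero expansion. *)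
    have [/is_bHE bF|junk] := bH_cases (Stotal S) F; last first.
      exists (fun=> 0), 0 => v; rewrite junk emb0 dot0r addr0 big1 // => P _.
      by rewrite mul0r.
    have [Y [t' hY]] := H_representable_ZS ZE FL FH; exists Y, t' => v.
    rewrite (bF (lattice_polytopeW FL)) hY dotC; congr (_ + _).
    by apply: eq_big_seq => P PS; rewrite bH_S.
  have /choice[ts hts] := hY.
  exists (fun P => \sum_i y i * Y i P), (t + \sum_i y i *: ts i) => v.
  rewrite bE embD dotDr addrA addrAC; congr (_ + _).
  rewrite emb_sum dot_sumr.
  rewrite (eq_bigr (fun i => \sum_(P <- S) (y i * Y i P)%:~R * bH (Stotal S) P v +
     dot (emb R (val v)) (emb R (y i *: ts i)))); last first.
    move=> i _; rewrite hts mulrDr embMz dotZr mulr_sumr; congr (_ + _).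
    by apply: eq_bigr => P _; rewrite intrM mulrA.
  rewrite big_split /= exchange_big /=; congr (_ + _); apply: eq_bigr => P _.
  by rewrite -mulr_suml rmorph_sum.
exists (size (enum_fset S)), (fun i => bH M (nth set0 (enum_fset S) i)).
exists (fun i => y (nth set0 (enum_fset S) i)); split.
  move=> i; have PS : nth set0 (enum_fset S) i \in S by apply: mem_nth.
  set P := nth _ _ _ in PS *; exists P => //=; split; first exact: S_lattice.
  have [k hk] := subadd_expands (expands_supf PS).
  exact: subadd_H_representable (S_polytope PS) hk.
by exists t => v; rewrite bE (big_nth set0) big_mkord.
Qed.

(** Edges of a cell are edges of the subdivision, so each is a multiple of an edge of some polytope
    in [S] and hence a summand of a multiple of [M]; [subadd_from_edges] extends this to the
    cell. *)
Lemma parallel_edges_Zpoly f : full_basis S -> edges_parallel S f -> Zpoly S f.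
Proof.
move=> full par; apply: local_factorization_S => _ /subdivisionP[x ->].
have Cp := polytope_cell f x.
have [||||z col|k hk] := @subadd_from_edges _ _ (supf M) (cell f x).
- exact: subadd_supf.
- exact: homog_supf.
- move=> z; exists (supf (face z M)); split; first exact: germ_supf.
  exact/homog_supf/polytope_face.
- exact: Cp.
- have Ep := polytope_face z Cp; have [u uE] := collinear_edge Ep col.
  have [x' xE] := face_cell f x z.
  have [|P [F [w [PS [u0 FE] [w0 [p Fpw]] [j [_ [c [_ uw]]]]]]]] := par _ u _ uE.
    by apply/subdivisionP; exists x'.
  have [k hk] := subadd_expands (expands_face u0 PS).
  have [_ [q Eqw]] := uE.
  have ul : u = (c * j%:~R) *: w by rewrite uw scalerA.
  have [m hm] := subadd_parallel_segments q p ul.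
  exists (m * k)%N.
  apply: subadd_eq (subaddD (subaddZ (ler0n R m) hk) hm) => v.
  by rewrite Eqw -FE Fpw natrM; ring.
exact: full_ZS full (lattice_cell f x) hk.
Qed.

Lemma integer_multiple_parallel f : edges_integer_multiple S f -> edges_parallel S f.
Proof.
move=> h E u fE uE; have [P [F [w [PS FP wF [k ukw]]]]] := h E u fE uE.
exists P, F, w; split=> //; exists k; split.
  by apply/eqP => k0; have [+ _] := uE; rewrite ukw k0 scale0r eqxx.
by exists 1; rewrite oner_eq0 scale1r.
Qed.

(** A lattice point would expand both as itself and as 0. *)
Lemma S_not_point P : P \in S -> exists u, width P u <> 0.
Proof.
move=> PS; apply: contrapT => h; have Pp := S_polytope PS.
have [|x PE] := set1_width Pp.
  by move=> u; apply: contrapT => hu; apply: h; exists u.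
have := S_lattice PS; rewrite PE => /lattice_point[t xE].
have e0 : expands S (supf P) (fun=> 0).
  by apply: expands_eq (expands_dot S t) => // u; rewrite PE supf_set1 xE dotC.
by have := expands_uniq (expands_supf PS) e0 PS; rewrite eqxx.
Qed.

(* The direction space of a polytope of least rank occurring in the expansion of
   an edge is contained in that of the edge. *)
Lemma edge_parallel_S x u y : expands S (supf (conv [:: x; x + u])) y -> u != 0 ->
  exists P, P \in S /\ exists w (l : R), [/\ edge_vector P w, 0 < l & w = l *: u].
Proof.
move=> yE u0; have uu := dot_gt0 u0; have Ep := polytope_segment x u.
have ex_rk : exists r, `[< exists2 P, P \in S & y P != 0 /\ rk P = r >].
  apply: contrapT => h; have [t tE] := yE.
  have supp P : P \in S -> y P = 0.
    move=> PS; apply: contrapT => /eqP y0; apply: h; exists (rk P); apply/asboolP.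
    by exists P.
  have sE v : supf (conv [:: x; x + u]) v = dot (emb R t) v.
    by rewrite tE big_seq big1 ?add0r // => P /supp ->; rewrite mul0r.
  have : width (conv [:: x; x + u]) u = 0 by rewrite /width !sE dotNr subrr.
  by rewrite width_segment => /eqP; rewrite normr_eq0 gt_eqF.
case: (ex_minnP ex_rk) => r /asboolP[P PS [yP rP]] rmin.
have Pp := S_polytope PS.
have y_rk Q : Q \in S -> y Q != 0 -> (r <= rk Q)%N.
  by move=> QS yQ; apply: rmin; apply/asboolP; exists Q.
(* The segment is its own face in direction [w], so the coefficient of [P] survives passing to that
   face; by [coef_face] this forces zero width. *)
have LP w : dot u w = 0 -> width P w = 0.
  move=> uw; have wE : width (conv [:: x; x + u]) w = 0 by rewrite width_segment uw normr0.
  have [psi [y' [psi_h psi_g psi_e y'E]]] := coef_face w yE y_rk.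
  have Eg := germ_supf w Ep; rewrite (proj2 (face_full _ Ep) wE) in Eg.
  have E := germ_uniq psi_g Eg psi_h (homog_supf Ep).
  have := expands_uniq (expands_eq E (fun _ _ => erefl _) psi_e) yE PS.
  rewrite (y'E P PS rP) => e; apply: contrapT => wP; move: e; rewrite asboolF // mulr0 => e.
  by rewrite -e eqxx in yP.
(* The part [w] of [p' - p] orthogonal to [u] is a direction of zero width, so it is orthogonal to
   [p' - p] and hence to itself. *)
have line p p' : P p -> P p' -> p' = p + (dot (p' - p) u / dot u u) *: u.
  move=> Pp1 Pp2; pose w := (p' - p) - (dot (p' - p) u / dot u u) *: u.
  have uw : dot u w = 0.
    by rewrite /w dotBr dotZr (dotC u (p' - p)) divfK ?subrr // gt_eqF.
  have := proj1 (widthP w Pp) (LP w uw) p' p Pp2 Pp1.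
  move=> /eqP; rewrite -subr_eq0 -dotBr => /eqP wd.
  have : dot w w = 0 by rewrite {2}/w dotBr wd dotZr (dotC w) uw mulr0 subr0.
  move=> /dot_eq0/eqP; rewrite /w subr_eq0 => /eqP <-.
  by rewrite addrC subrK.
have [v vP] := S_not_point PS.
have [a [b [Pa Pb ab]]] : exists a b, [/\ P a, P b & a != b].
  apply: contrapT => h; apply: vP; apply/widthP => // p p' Pp1 Pp2.
  by have [->//|pp] := eqVneq p p'; exfalso; apply: h; exists p, p'.
have [|w wE] := collinear_edge Pp.
  exists a, b; split=> // c Pc.
  have bE := line a b Pa Pb; have cE := line a c Pa Pc.
  set l := _ / _ in bE; set l' := _ / _ in cE.
  have l0 : l != 0.
    by apply: contraNneq ab => l0; rewrite bE l0 scale0r addr0.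
  exists (l' / l); rewrite [b in b - a]bE [a + l *: u]addrC addrK scalerA divfK //.
exists P; split=> //; have [w0 [p PE]] := wE.
have Pe : P p by rewrite PE; apply: conv_mem; rewrite mem_head.
have Pe' : P (p + w) by rewrite PE; apply: conv_mem; rewrite !inE eqxx orbT.
have wl : w = (dot w u / dot u u) *: u.
  by have := line p (p + w) Pe Pe'; rewrite [p + w - p]addrC addKr => /addrI.
have [l0|l0|l0] := ltgtP 0 (dot w u / dot u u); last 1 first.
- by move: w0; rewrite wl -l0 scale0r eqxx.
- by exists w, (dot w u / dot u u).
exists (- w), (- (dot w u / dot u u)); rewrite oppr_gt0 scaleNr -wl.
by split=> //; apply: edge_vectorN.
Qed.

(** A nonzero coordinate b_i of [w] and the coordinate a_i of [u] turn the real proportionality into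
    the integral relation |b_i| u = |a_i| w. Comparing the coefficients of [P] in two expansions of
    |b_i| E gives |b_i| y(P) = |a_i|, so the ratio is the integer [y P]. *)
Lemma Zpoly_edges f : Zpoly S f -> edges_integer_multiple S f.
Proof.
move=> fZ E u /subdivisionP[x EE] [u0 [x0 Ex]].
have [y] := Zpoly_expands x fZ; rewrite -EE Ex => yE.
have EL := lattice_cell f x; rewrite -EE Ex in EL.
have [P [PS [w [l [wP l0 wl]]]]] := edge_parallel_S yE u0.
have [w0 [p PE]] := wP.
have [xi [a [xE aE]]] := segment_lattice u0 EL.
have PL := S_lattice PS; rewrite PE in PL.
have [p' [b [pE bE]]] := segment_lattice w0 PL.
have [i bi] : exists i, b ord0 i != 0.
  apply/existsP; apply: contraNT w0; rewrite negb_exists => /forallP h.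
  rewrite bE; apply/eqP/rowP => i; rewrite !mxE; apply/eqP.
  by rewrite intr_eq0 -[_ == _]negbK.
have blE : (b ord0 i)%:~R = l * (a ord0 i)%:~R :> R.
  by have /rowP/(_ i) := wl; rewrite bE aE !mxE.
(* |b_i| E and |a_i| P are translates of each other. *)
have uw : `|b ord0 i|%:~R *: u = `|a ord0 i|%:~R *: w.
  by rewrite !intr_norm blE normrM gtr0_norm // wl scalerA mulrC.
have e1 := expandsZ `|b ord0 i| yE.
have e2 := expandsD (expandsZ `|a ord0 i| (expands_supf PS))
  (expands_dot S (`|b ord0 i| *: xi - `|a ord0 i| *: p')).
have E2 : (fun v => `|a ord0 i|%:~R * supf P v +
      dot (emb R (`|b ord0 i| *: xi - `|a ord0 i| *: p')) v) =1
    (fun v => `|b ord0 i|%:~R * supf (conv [:: x0; x0 + u]) v).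
  move=> v; rewrite PE !supf_segment embB !embMz -xE -pE dotBl !dotZl.
  have b0 : 0 <= `|b ord0 i|%:~R :> R by rewrite ler0z.
  have a0 : 0 <= `|a ord0 i|%:~R :> R by rewrite ler0z.
  have : `|b ord0 i|%:~R * Num.max 0 (dot u v) = `|a ord0 i|%:~R * Num.max 0 (dot w v).
    by rewrite !maxr_pMr // !mulr0 -!dotZl uw.
  lra.
have yP := expands_uniq e1 (expands_eq E2 (fun _ _ => erefl _) e2) PS.
exists P, P, w; split=> //.
  exists 0; apply/esym/face_full; first exact: S_polytope.
  by rewrite /width oppr0 supf0 ?addr0 //; apply: S_polytope.
exists (y P); have bi0 : (`|b ord0 i|%:~R : R) != 0 by rewrite intr_eq0 normr_eq0.
apply: (scalerI bi0); rewrite uw scalerA -intrM yP eqxx mulr1 addr0.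
by [].
Qed.


End Hierarchy.

Theorem theorem2 (R : realType) (n : nat) (S : {fset set 'rV[R]_n})
    (S_lattice : forall P, P \in S -> lattice_polytope P)
    (S_positive_basis : positive_basis S) :
  [/\ unique_factorization S,
      local_factorization S,
      (Zpoly S = Epoly S <-> full_positive_basis S) &
      (full_positive_basis S -> forall f : tpoly R n,
         (Zpoly S f <-> edges_parallel S f) /\
         (Zpoly S f <-> edges_integer_multiple S f))].
Proof.
have [S_basis S_hier _] := S_positive_basis; split.
- exact: unique_factorization_S.
- exact: local_factorization_S.
- split=> [ZE|[_ full]]; first by split=> //; apply: EZ_full.
  apply/seteqP; split=> f; first exact: Zpoly_Epoly.
  exact: Epoly_Zpoly.
move=> [_ full] f.
have par := parallel_edges_Zpoly S_lattice S_basis S_hier (f := f) full.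
have mul := Zpoly_edges S_lattice S_basis S_hier (f := f).
have mp := integer_multiple_parallel (S := S) (f := f).
by split; split=> h; [exact/mp/mul | exact: par | exact: mul | exact/par/mp].
Qed.
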